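(* Let $S$ be the minimal Laplacian on $L_2(0,1)$: $\mathcal{D}(S)=\{f\in H^2(0,1): f(0)=f(1)=f'(0)=f'(1)=0\}$, $Sf=-f''$. Every maximally dissipative extension $\widehat S$ of $S$ belongs to exactly one of the cases listed below, and one can write $\mathcal{D}(\widehat S)=\mathcal{D}(S)\dot+\operatorname{span}\{u,v\}$ with $u,v\in\mathcal{D}(S^* )=H^2(0,1)$ linearly independent over $\mathcal{D}(S)$. (i) $\mathcal{D}(\widehat S)=\left\{f\in H^2(0,1):\begin{pmatrix} f(0) \\ f(1) \end{pmatrix}=\begin{pmatrix} c_{11} & c_{12} \\ c_{21} & c_{22} \end{pmatrix}\begin{pmatrix} f'(0) \\ -f'(1) \end{pmatrix}\right\}$ with $c_{jk}\in\mathbb{C}$ such that $\operatorname{Im}\begin{pmatrix} c_{11} & c_{12} \\ c_{21} & c_{22} \end{pmatrix}^*\ge0$; explicitly: $\operatorname{Im}c_{11}\le0$, $\operatorname{Im}c_{22}\le0$ and $\operatorname{Im}(c_{11})\operatorname{Im}(c_{22})\ge\frac14|c_{12}-\overline{c_{21}}|^2$. The functions $u,v$ can be chosen such that $(u(0),u(1),u'(0),u'(1))=(c_{11},c_{21},1,0)$ and $(v(0),v(1),v'(0),v'(1))=(-c_{12},-c_{22},0,1)$. (ii) $\mathcal{D}(\widehat S)=\{f\in H^2(0,1): f(1)-\overline{c_{22}}f(0)=\overline{c_{22}}c_{12}f'(1),\ f'(0)-c_{22}f'(1)=0\}$ with $c_{12},c_{22}\in\mathbb{C}$, $c_{22}\ne0$,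 $\operatorname{Im}(c_{12}\overline{c_{22}})\ge0$. The functions $u,v$ can be chosen such that $(u(0),u(1),u'(0),u'(1))=(\overline{c_{22}}^{-1},1,0,0)$ and $(v(0),v(1),v'(0),v'(1))=(-c_{12},0,c_{22},1)$. (iii) $\mathcal{D}(\widehat S)=\{f\in H^2(0,1): f(0)=c_{11}f'(0),\ f'(1)=0\}$ with $c_{11}\in\mathbb{C}$, $\operatorname{Im}(\overline{c_{11}})\ge0$. The functions $u,v$ can be chosen such that $(u(0),u(1),u'(0),u'(1))=(0,1,0,0)$ and $(v(0),v(1),v'(0),v'(1))=(c_{11},0,1,0)$. (iv) $\mathcal{D}(\widehat S)=\{f\in H^2(0,1): f(1)=-c_{12}f'(1),\ f'(0)=0\}$ with $c_{12}\in\mathbb{C}$, $\operatorname{Im}(\overline{c_{12}})\ge0$. The functions $u,v$ can be chosen such that $(u(0),u(1),u'(0),u'(1))=(1,0,0,0)$ and $(v(0),v(1),v'(0),v'(1))=(0,-c_{12},0,1)$. (v) $\mathcal{D}(\widehat S)=\{f\in H^2(0,1): f'(0)=f'(1)=0\}$. The functions $u,v$ can be chosen such that $(u(0),u(1),u'(0),u'(1))=(1,0,0,0)$ and $(v(0),v(1),v'(0),v'(1))=(0,1,0,0)$. In all cases $\widehat Sf=S^*f=-f''$ for all $f\in\mathcal{D}(\widehat S)$. Moreover, every operator of one of these forms is a maximally dissipative extension of $S$.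
   Context: $L_2(0,1)$ is complex with inner product linear in the second argument; $H^2(0,1)$ is the Sobolev space. The adjoint of $S$ is $S^*f=-f''$ with $\mathcal{D}(S^* )=H^2(0,1)$. A densely defined operator $T$ is dissipative if $\operatorname{Im}\langle x,Tx\rangle\ge0$ for all $x\in\mathcal{D}(T)$, and maximally dissipative if it is dissipative and has no non-trivial dissipative extension. For a square matrix $M$, $\operatorname{Im}M:=\frac1{2\mathrm{i}}(M-M^* )$. ''Linearly independent over $\mathcal{D}(S)$'' means linearly independent modulo $\mathcal{D}(S)$; $\dot+$ denotes a direct sum. *)

(* Defs.v *)
From HB Require Import structures.
From mathcomp Require Import all_boot all_order all_algebra generic_quotient.
From mathcomp Require Import spectral complex.
From mathcomp Require Import all_classical all_reals all_analysis.
From mathcomp Require Import measurable_realfun ring.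

Set Implicit Arguments.
Unset Strict Implicit.
Unset Printing Implicit Defensive.

Import Order.TTheory GRing.Theory Num.Theory.
Import numFieldNormedType.Exports.

Local Open Scope classical_set_scope.
Local Open Scope ring_scope.
Local Open Scope quotient_scope.
Local Open Scope sesquilinear_scope.

Local Notation Re := complex.Re.
Local Notation Im := complex.Im.

Section SquareIntegrable.
Context {R : realType}.
Local Notation mu := (@lebesgue_measure R).

Definition unit_itv : set R := `]0, 1[.

Definition sqr_integrable (f : R -> R) : Prop :=
  measurable_fun unit_itv f /\
  mu.-integrable unit_itv (fun x => (f x ^+ 2)%:E).

Definition is_L2 (f : R -> R[i]) : Prop :=
  sqr_integrable (fun x => Re (f x)) /\ sqr_integrable (fun x => Im (f x)).

Definition L2_pred : {pred R -> R[i]} := mem [set f | is_L2 f].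

Let mI : measurable unit_itv := measurable_itv _.

Lemma sqr_integrable_bound (f g : R -> R) (a : R) :
  measurable_fun unit_itv f -> sqr_integrable g ->
  (forall x, f x ^+ 2 <= a * g x ^+ 2) -> sqr_integrable f.
Proof.
move=> mf [mg ig] fg; split=> //.
apply: (@le_integrable _ _ _ mu _ mI _ (fun x => (a%:E * (g x ^+ 2)%:E)%E)).
- by apply/measurable_EFinP; exact: measurable_funX.
- move=> x _ /=; rewrite lee_fin ger0_norm ?sqr_ge0//.
  exact: le_trans (fg x) (ler_norm _).
- exact: integrableZl.
Qed.

Lemma sqr_integrable0 : sqr_integrable (fun=> 0).
Proof.
split; first exact: measurable_cst.
rewrite (_ : (fun _ => _) = cst 0%E); last by apply/funext => x; rewrite expr0n.
exact: integrable0.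
Qed.

Lemma sqr_integrableD (f g : R -> R) :
  sqr_integrable f -> sqr_integrable g -> sqr_integrable (fun x => f x + g x).
Proof.
move=> [mf f2] [mg g2]; split; first exact: measurable_funD.
apply: (@le_integrable _ _ _ mu _ mI _
  (fun x => (2%:E * ((f x ^+ 2)%:E + (g x ^+ 2)%:E))%E)).
- by apply/measurable_EFinP; apply: measurable_funX; exact: measurable_funD.
- move=> x _ /=; rewrite lee_fin ger0_norm ?sqr_ge0//.
  apply: le_trans (ler_norm _).
  by rewrite -subr_ge0 (_ : _ - _ = (f x - g x) ^+ 2) ?sqr_ge0//; ring.
- by apply: integrableZl => //; exact: integrableD.
Qed.

Lemma sqr_integrableZ (a : R) (f : R -> R) :
  sqr_integrable f -> sqr_integrable (fun x => a * f x).
Proof.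
move=> f2; apply: (@sqr_integrable_bound _ f (a ^+ 2)) => //.
  by apply: measurable_funM; [exact: measurable_cst|case: f2].
by move=> x; rewrite exprMn.
Qed.

Lemma L2_submod_closed : submod_closed L2_pred.
Proof.
split=> [|a f g]; rewrite !inE /=; first by split; exact: sqr_integrable0.
move=> [fr fi] [gr gi]; split.
  rewrite (_ : (fun _ => _) = fun x => (Re a * Re (f x) + - Im a * Im (f x))
    + Re (g x)); last first.
    apply/funext => x; rewrite -[LHS]/(Re (a * f x + g x)).
    by case: a (f x) (g x) => [? ?] [? ?] [? ?] /=; ring.
  by do ?apply: sqr_integrableD => //; exact: sqr_integrableZ.
rewrite (_ : (fun _ => _) = fun x => (Re a * Im (f x) + Im a * Re (f x))
  + Im (g x)); last first.
  apply/funext => x; rewrite -[LHS]/(Im (a * f x + g x)).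
  by case: a (f x) (g x) => [? ?] [? ?] [? ?] /=; ring.
by do ?apply: sqr_integrableD => //; exact: sqr_integrableZ.
Qed.

HB.instance Definition _ := GRing.isSubmodClosed.Build _ _ L2_pred
  L2_submod_closed.

End SquareIntegrable.

Record L2fun (R : realType) := MkL2fun {
  L2fun_val :> R -> R[i];
  L2fun_valP : L2fun_val \in L2_pred }.

HB.instance Definition _ (R : realType) := [isSub for @L2fun_val R].
HB.instance Definition _ (R : realType) := [Choice of L2fun R by <:].
HB.instance Definition _ (R : realType) :=
  [SubChoice_isSubLmodule of L2fun R by <:].

Section L2.
Context {R : realType}.
Local Notation mu := (@lebesgue_measure R).

Definition L2_eq (f g : L2fun R) : bool := `[< ae_eq mu unit_itv f g >].

Let L2_eq_refl : reflexive L2_eq.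
Proof. by move=> f; apply/asboolP; exact: ae_eq_refl. Qed.

Let L2_eq_sym : symmetric L2_eq.
Proof. by move=> f g; apply/asboolP/asboolP; exact: ae_eq_sym. Qed.

Let L2_eq_trans : transitive L2_eq.
Proof.
by move=> f g h /asboolP gf /asboolP fh; apply/asboolP; exact: ae_eq_trans fh.
Qed.

Canonical L2_eq_equiv := EquivRel L2_eq L2_eq_refl L2_eq_sym L2_eq_trans.

Definition L2 : Type := {eq_quot L2_eq}.
HB.instance Definition _ := Choice.on L2.
HB.instance Definition _ := EqQuotient.on L2.

(* Elements of [L2] are classes of functions modulo equality almost everywhere
   on (0,1); the coercion picks some representative. *)
Definition L2_to_fun (f : L2) : R -> R[i] := repr f.

Lemma L2_piP (f g : L2fun R) :
  \pi_L2 f = \pi_L2 g <-> ae_eq mu unit_itv f g.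
Proof.
split=> [/eqmodP /asboolP//|fg]; apply/eqmodP; exact/asboolP.
Qed.

Lemma L2_repr_pi (f : L2fun R) : ae_eq mu unit_itv (repr (\pi_L2 f)) f.
Proof. by apply/L2_piP; rewrite reprK. Qed.

Definition L2_zero : L2 := \pi_L2 0.
Definition L2_add (f g : L2) : L2 := \pi_L2 (repr f + repr g).
Definition L2_opp (f : L2) : L2 := \pi_L2 (- repr f).
Definition L2_scale (a : R[i]) (f : L2) : L2 := \pi_L2 (a *: repr f).

Let L2_addE (f g : L2fun R) : L2_add (\pi_L2 f) (\pi_L2 g) = \pi_L2 (f + g).
Proof.
apply/L2_piP; have := L2_repr_pi f; have := L2_repr_pi g.
apply: filterS2 => x h1 h2 Ix.
by move: (h1 Ix) (h2 Ix) => e1 e2; congr (_ + _).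
Qed.

Let L2_oppE (f : L2fun R) : L2_opp (\pi_L2 f) = \pi_L2 (- f).
Proof.
apply/L2_piP; have := L2_repr_pi f.
by apply: filterS => x h Ix; move: (h Ix) => e; congr (- _).
Qed.

Let L2_scaleE a (f : L2fun R) : L2_scale a (\pi_L2 f) = \pi_L2 (a *: f).
Proof.
apply/L2_piP; have := L2_repr_pi f.
by apply: filterS => x h Ix; move: (h Ix) => e; congr (_ * _).
Qed.

Let addA : associative L2_add.
Proof.
elim/quotW=> f; elim/quotW=> g; elim/quotW=> h.
by rewrite (L2_addE g h) (L2_addE f g) !L2_addE addrA.
Qed.

Let addC : commutative L2_add.
Proof. by elim/quotW=> f; elim/quotW=> g; rewrite !L2_addE addrC. Qed.

Let add0 : left_id L2_zero L2_add.
Proof. by elim/quotW=> f; rewrite L2_addE add0r. Qed.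

Let addN : left_inverse L2_zero L2_opp L2_add.
Proof. by elim/quotW=> f; rewrite L2_oppE L2_addE addNr. Qed.

HB.instance Definition _ := GRing.isZmodule.Build L2 addA addC add0 addN.

Let scaleA a b f : L2_scale a (L2_scale b f) = L2_scale (a * b) f.
Proof. by elim/quotW: f => f; rewrite (L2_scaleE b f) !L2_scaleE scalerA. Qed.

Let scale1 : left_id 1 L2_scale.
Proof. by elim/quotW=> f; rewrite L2_scaleE scale1r. Qed.

Let scaleDr : right_distributive L2_scale +%R.
Proof.
move=> a; elim/quotW=> f; elim/quotW=> g.
rewrite -[LHS]/(L2_scale a (L2_add _ _)) -[RHS]/(L2_add _ _).
rewrite (L2_addE f g) (L2_scaleE a f) (L2_scaleE a g).
by rewrite L2_scaleE L2_addE scalerDr.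
Qed.

Let scaleDl f : {morph L2_scale^~ f : a b / a + b}.
Proof.
move=> a b; elim/quotW: f => f.
rewrite -[RHS]/(L2_add _ _).
by rewrite (L2_scaleE a f) (L2_scaleE b f) L2_scaleE L2_addE scalerDl.
Qed.

HB.instance Definition _ := GRing.Zmodule_isLmodule.Build R[i] L2
  scaleA scale1 scaleDr scaleDl.

Lemma L2_piD (f g : L2fun R) : \pi_L2 f + \pi_L2 g = \pi_L2 (f + g) :> L2.
Proof. exact: L2_addE. Qed.

Lemma L2_piN (f : L2fun R) : - \pi_L2 f = \pi_L2 (- f) :> L2.
Proof. exact: L2_oppE. Qed.

Lemma L2_piZ a (f : L2fun R) : a *: \pi_L2 f = \pi_L2 (a *: f) :> L2.
Proof. exact: L2_scaleE. Qed.

End L2.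

Arguments L2 R : clear implicits.
Coercion L2_to_fun : L2 >-> Funclass.

Section HilbertSpace.
Context {R : realType}.
Local Notation mu := (@lebesgue_measure R).

Definition cintegral (f : R -> R[i]) : R[i] :=
  Complex (\int[mu]_(x in unit_itv) Re (f x))
          (\int[mu]_(x in unit_itv) Im (f x)).

(* linear in the second argument *)
Definition inner (f g : L2 R) : R[i] := cintegral (fun x => (f x)^* * g x).

Definition L2norm (f : L2 R) : R := Num.sqrt (Re (inner f f)).

End HilbertSpace.

Section Operators.
Context {R : realType}.

(* A partially defined map; only the restriction of [op] to [dom] is
   meaningful, and linearity is the separate predicate [linear_op]. *)
Record operator := Operator { dom : set (L2 R); op :> L2 R -> L2 R }.

Definition linear_op (T : operator) : Prop :=
  dom T 0 /\
  forall (a : R[i]) (f g : L2 R), dom T f -> dom T g ->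
    dom T (a *: f + g) /\ T (a *: f + g) = a *: T f + T g.

Definition densely_defined (T : operator) : Prop :=
  forall (f : L2 R) (e : R), 0 < e -> exists2 g, dom T g & L2norm (f - g) < e.

Definition extends (T T' : operator) : Prop :=
  dom T `<=` dom T' /\ forall f, dom T f -> T' f = T f.

(* For densely defined [T] the vector [z] is unique. *)
Definition adjoint (T : operator) : operator :=
  Operator
    [set y | exists z, forall x, dom T x -> inner y (T x) = inner z x]
    (fun y => xget 0 [set z | forall x, dom T x -> inner y (T x) = inner z x]).

Definition dissipative (T : operator) : Prop :=
  [/\ linear_op T, densely_defined T &
      forall x, dom T x -> 0 <= Im (inner x (T x))].

Definition maximally_dissipative (T : operator) : Prop :=
  dissipative T /\
  forall T', dissipative T' -> extends T T' -> extends T' T.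

Definition span2 (u v : L2 R) : set (L2 R) :=
  [set f | exists a b : R[i], f = a *: u + b *: v].

Definition lin_indep_mod (D : set (L2 R)) (u v : L2 R) : Prop :=
  forall a b : R[i], D (a *: u + b *: v) -> a = 0 /\ b = 0.

(* W is the internal direct sum of D and E. *)
Definition direct_sum (D E W : set (L2 R)) : Prop :=
  W = [set f | exists2 g, D g & exists2 h, E h & f = g + h] /\
  D `&` E `<=` [set 0].

End Operators.
Arguments operator R : clear implicits.

Section Sobolev.
Context {R : realType}.
Local Notation mu := (@lebesgue_measure R).

(* Test functions are real-valued and of class C^1 with compact support in the
   open interval (0,1), as in Brezis's definition of the Sobolev spaces of an
   interval; by linearity complex-valued ones would give the same notion. *)
Definition test_function (phi : R -> R) : Prop :=
  [/\ forall x, derivable phi x 1, continuous (phi^`()%classic) &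
      exists a b : R, [/\ 0 < a, b < 1 &
        forall x, ~ (a <= x <= b) -> phi x = 0]].

Definition weak_derivative (f g : L2 R) : Prop :=
  forall phi, test_function phi ->
    cintegral (fun x => (phi^`()%classic x)%:C%C * f x) =
    - cintegral (fun x => (phi x)%:C%C * g x).

(* the weak derivative of [f], if it has one in L^2, and 0 otherwise *)
Definition wderiv (f : L2 R) : L2 R := xget 0 [set g | weak_derivative f g].

Definition H1_01 : set (L2 R) := [set f | exists g, weak_derivative f g].

(* Membership in L^2 of f, f' and f'' is carried by the type [L2]. *)
Definition H2_01 : set (L2 R) := [set f | H1_01 f /\ H1_01 (wderiv f)].

Definition continuous_rep (f : L2 R) (h : R -> R[i]) : Prop :=
  [/\ {within `[0, 1], continuous (fun x => Re (h x))},
      {within `[0, 1], continuous (fun x => Im (h x))} &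
      ae_eq mu unit_itv h f].

(* The value at [x] of the representative of [f] that is continuous on [0,1];
   for x in [0,1] it does not depend on the choice made by [xget], and it
   exists when [f] is in H1_01. *)
Definition eval (f : L2 R) (x : R) : R[i] :=
  xget (fun=> 0) [set h | continuous_rep f h] x.

(* (f(0), f(1), f'(0), f'(1)) *)
Definition bvals (f : L2 R) : R[i] * R[i] * R[i] * R[i] :=
  (eval f 0, eval f 1, eval (wderiv f) 0, eval (wderiv f) 1).

Definition neg_laplace (f : L2 R) : L2 R := - wderiv (wderiv f).

Definition minimal_laplacian : operator R :=
  Operator [set f | H2_01 f /\ bvals f = (0, 0, 0, 0)] neg_laplace.

End Sobolev.
Arguments minimal_laplacian R : clear implicits.

Section BoundaryConditions.
Context {R : realType}.

Definition col2 (a b : R[i]) : 'cV[R[i]]_2 := \col_i (if i == 0 then a else b).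

Definition Im_mx n (M : 'M[R[i]]_n) : 'M[R[i]]_n := (2 * 'i)^-1 *: (M - M^t*).

(* [0 <= z] in R[i] means that z is real and nonnegative. *)
Definition psd n (M : 'M[R[i]]_n) : Prop :=
  forall x : 'cV[R[i]]_n, 0 <= (x^t* *m M *m x) 0 0.

(* The parameters of the five families of boundary conditions; their domains
   are given by [bc_dom]. *)
Inductive bc : Type :=
| BC1 of 'M[R[i]]_2
| BC2 (c12 c22 : R[i])
| BC3 (c11 : R[i])
| BC4 (c12 : R[i])
| BC5.

Inductive bc_case : Type := Case1 | Case2 | Case3 | Case4 | Case5.

Definition case_of (p : bc) : bc_case :=
  match p with
  | BC1 _ => Case1 | BC2 _ _ => Case2 | BC3 _ => Case3 | BC4 _ => Case4
  | BC5 => Case5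
  end.

Definition admissible (p : bc) : Prop :=
  match p with
  | BC1 C => psd (Im_mx (C^t* ))
  | BC2 c12 c22 => c22 != 0 /\ 0 <= Im (c12 * c22^*)
  | BC3 c11 => 0 <= Im (c11^*)
  | BC4 c12 => 0 <= Im (c12^*)
  | BC5 => True
  end.

Definition bc_dom (p : bc) : set (L2 R) :=
  [set f | H2_01 f /\
    let: (f0, f1, df0, df1) := bvals f in
    match p with
    | BC1 C => col2 f0 f1 = C *m col2 df0 (- df1)
    | BC2 c12 c22 =>
        f1 - c22^* * f0 = c22^* * c12 * df1 /\ df0 - c22 * df1 = 0
    | BC3 c11 => f0 = c11 * df0 /\ df1 = 0
    | BC4 c12 => f1 = - c12 * df1 /\ df0 = 0
    | BC5 => df0 = 0 /\ df1 = 0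
    end].

Definition u_bvals (p : bc) : R[i] * R[i] * R[i] * R[i] :=
  match p with
  | BC1 C => (C 0 0, C 1 0, 1, 0)
  | BC2 c12 c22 => ((c22^*)^-1, 1, 0, 0)
  | BC3 c11 => (0, 1, 0, 0)
  | BC4 c12 => (1, 0, 0, 0)
  | BC5 => (1, 0, 0, 0)
  end.

Definition v_bvals (p : bc) : R[i] * R[i] * R[i] * R[i] :=
  match p with
  | BC1 C => (- C 0 1, - C 1 1, 0, 1)
  | BC2 c12 c22 => (- c12, 0, c22, 1)
  | BC3 c11 => (c11, 0, 1, 0)
  | BC4 c12 => (0, - c12, 0, 1)
  | BC5 => (0, 1, 0, 0)
  end.

Definition belongs_to (T : operator R) (k : bc_case) : Prop :=
  exists p, [/\ case_of p = k, admissible p & dom T = bc_dom p].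

End BoundaryConditions.
Arguments bc R : clear implicits.

(* Main.v *)
(** On (0,1) an element of H^2 is a + b x + (double primitive of h) with h in L^2:
    this follows from the du Bois-Reymond lemma. Integration by parts for primitives
    of L^2 functions (Fubini on a triangle) then gives Green's identity
    Im <f, - f''> = Im (conj f(0) f'(0) - conj f(1) f'(1)), and the boundary values
    map H^2 onto C^4. The adjoint is computed by moving two primitives to the other
    side of the scalar product, which shows that y + (double primitive of z) is affine.
    A dissipative extension of the symmetric operator S lies below S*, so it is
    determined by its space of boundary values, a subspace of C^4 on which the
    boundary form is nonnegative; it is maximal exactly when the subspace is. In a
    maximal one, Gamma_1 + i Gamma_0 is onto, where Gamma_0 = (f(0), f(1)) and
    Gamma_1 = (f'(0), - f'(1)). If no nonzero vector of the subspace has Gamma_1 = 0,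
    this is case (i). Otherwise such a vector (p, 0) forces p to be orthogonal to every
    Gamma_1, and the position of p relative to the axes gives cases (ii)-(v). *)

Require Import Defs.
From mathcomp Require Import all_boot all_order all_algebra generic_quotient.
From mathcomp Require Import spectral complex.
From mathcomp Require Import all_classical all_reals all_analysis.
From mathcomp Require Import measurable_realfun ring lra.
Import Order.TTheory GRing.Theory Num.Theory.
Import numFieldNormedType.Exports.
Set Implicit Arguments.
Unset Strict Implicit.
Local Open Scope classical_set_scope.
Local Open Scope ring_scope.
Local Open Scope sesquilinear_scope.

(** * Integrals and primitives on (0,1) *)

Section UnitInterval.
Context {R : realType}.
Local Notation mu := (@lebesgue_measure R).
Local Notation I01 := (@unit_itv R).
Implicit Types f g h : R -> R.

(** Everything on (0,1) is built from the constant function 1 and the operator [J] of integration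
    from 0. The properties collected in [second_order_model] then reduce Green's identity, the
    adjoint and the extension argument to algebra: the orthogonal projection onto the span of 1 and
    [J 1] is explicit, because their Gram determinant is nonzero. The main analytic obstacle is
    density of D(S). Dissipativity includes a dense domain, so the converse half has to approximate
    any L^2 function by C^2 functions supported inside (0,1), whose second derivatives must have two
    vanishing moments. One device turns inequalities into equations: a function of a complex scalar
    that is real-affine and bounded below is constant. It puts dissipative extensions below the
    adjoint, gives the orthogonality to [p] in C^4, and proves that the five families are maximal.
    Surjectivity of Gamma_1 + i Gamma_0 supplies two explicit vectors of a maximal space, and these
    replace dimension counts. *)

Definition integrable01 f : Prop := mu.-integrable I01 (EFin \o f).
Definition int1 f : R := \int[mu]_(x in I01) f x.
(** Restricting inside the integral hides the values of [f] outside the open interval. For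
    integrable [f] the integrand is then integrable on the whole line ([integrable_restr]), which
    suits both Fubini and the fundamental theorem of calculus. *)
Definition prim f (x : R) : R := \int[mu]_(t in `[0, x]) (f \_ I01) t.

Lemma measurable_unit_itv : measurable I01.
Proof. exact: measurable_itv. Qed.
Hint Resolve measurable_unit_itv : core.

Lemma mu_unit_itv : mu I01 = 1%E.
Proof. by rewrite lebesgue_measure_itv/= lte_fin ltr01 oppr0 adde0. Qed.

Lemma integrable01_measurable f : integrable01 f -> measurable_fun I01 f.
Proof. by move=> /integrableP[/measurable_EFinP]. Qed.

Lemma integrable01D f g : integrable01 f -> integrable01 g -> integrable01 (fun x => f x + g x).
Proof. by move=> sf sg; exact: (integrableD _ sf sg). Qed.

Lemma integrable01Z a f : integrable01 f -> integrable01 (fun x => a * f x).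
Proof. by move=> sf; exact: (integrableZl _ a sf). Qed.

Lemma integrable01N f : integrable01 f -> integrable01 (fun x => - f x).
Proof. by move=> sf; exact: (integrableN sf). Qed.

Lemma integrable01B f g : integrable01 f -> integrable01 g -> integrable01 (fun x => f x - g x).
Proof. by move=> sf sg; apply: integrable01D => //; exact: integrable01N. Qed.

Lemma integrable01_bounded f (M : R) : measurable_fun I01 f ->
  (forall x, I01 x -> `|f x| <= M) -> integrable01 f.
Proof.
move=> mf fM; apply: measurable_bounded_integrable => //.
  by rewrite [X in (X < _)%E]mu_unit_itv ltry.
by exists M; split; [exact: num_real|move=> y My x /fM /le_trans; apply; exact: ltW].
Qed.

Lemma integrable01_cst (c : R) : integrable01 (fun=> c).
Proof. exact: (@integrable01_bounded _ `|c|). Qed.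

Lemma integrable01M_bounded f g (M : R) : measurable_fun I01 f ->
  (forall x, I01 x -> `|f x| <= M) -> integrable01 g -> integrable01 (fun x => f x * g x).
Proof.
move=> mf fM sg; apply: (@le_integrable _ _ _ mu _ _ _ (fun x => (M * g x)%:E)) => //.
- apply/measurable_EFinP; apply: measurable_funM => //; exact: integrable01_measurable.
- move=> x Ix /=; rewrite lee_fin !normrM ler_wpM2r//.
  by rewrite (le_trans (fM x Ix))// ler_norm.
- exact: (integrable01Z M sg).
Qed.

(** The interval has finite measure and [|f| <= 1 + f^2]. *)
Lemma sqr_integrable_integrable01 f : sqr_integrable f -> integrable01 f.
Proof.
move=> [mf f2]; apply: (@le_integrable _ _ _ mu _ _ _ (fun x => (1 + f x ^+ 2)%:E)) => //.
- exact/measurable_EFinP.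
- move=> x _ /=; rewrite lee_fin [leRHS]ger0_norm ?addr_ge0 ?sqr_ge0//.
  by rewrite -(real_normK (num_real (f x))); nra.
- by apply: (integrable01D (integrable01_cst 1) f2).
Qed.

Lemma sqr_integrable_mul f g : sqr_integrable f -> sqr_integrable g ->
  integrable01 (fun x => f x * g x).
Proof.
move=> [mf f2] [mg g2].
apply: (@le_integrable _ _ _ mu _ _ _ (fun x => (f x ^+ 2 + g x ^+ 2)%:E)) => //.
- by apply/measurable_EFinP; exact: measurable_funM.
- move=> x _ /=; rewrite lee_fin [leRHS]ger0_norm ?addr_ge0 ?sqr_ge0//.
  rewrite normrM -(real_normK (num_real (f x))) -(real_normK (num_real (g x))).
  have := normr_ge0 (f x); have := normr_ge0 (g x); nra.
- exact: (integrable01D f2 g2).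
Qed.

Lemma sqr_integrable_bounded f (M : R) : measurable_fun I01 f ->
  (forall x, I01 x -> `|f x| <= M) -> sqr_integrable f.
Proof.
move=> mf fM; split=> //; apply: (@integrable01_bounded _ (M ^+ 2)).
  exact: measurable_funX.
move=> x Ix; rewrite normrX; apply: lerXn2r (fM x Ix); rewrite nnegrE//.
exact: le_trans (fM x Ix).
Qed.

Lemma eq_int1 f g : (forall x, I01 x -> f x = g x) -> int1 f = int1 g.
Proof. by move=> fg; apply: eq_Rintegral => x; rewrite inE; exact: fg. Qed.

Lemma int1D f g : integrable01 f -> integrable01 g ->
  int1 (fun x => f x + g x) = int1 f + int1 g.
Proof. exact: RintegralD. Qed.

Lemma int1B f g : integrable01 f -> integrable01 g ->
  int1 (fun x => f x - g x) = int1 f - int1 g.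
Proof. exact: RintegralB. Qed.

Lemma int1Z a f : integrable01 f -> int1 (fun x => a * f x) = a * int1 f.
Proof. by move=> sf; exact: RintegralZl. Qed.

Lemma int1N f : integrable01 f -> int1 (fun x => - f x) = - int1 f.
Proof.
by move=> sf; rewrite -mulN1r -int1Z//; apply: eq_int1 => x _; rewrite mulN1r.
Qed.

Lemma int1_cst c : int1 (fun=> c) = c.
Proof. by rewrite /int1 Rintegral_cst// [X in fine X]mu_unit_itv mulr1. Qed.

Lemma le_int1 f g : integrable01 f -> integrable01 g ->
  (forall x, I01 x -> f x <= g x) -> int1 f <= int1 g.
Proof. by move=> sf sg fg; exact: le_Rintegral. Qed.

Lemma int1_ge0 f : (forall x, I01 x -> 0 <= f x) -> 0 <= int1 f.
Proof. by move=> f0; exact: Rintegral_ge0. Qed.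

Lemma ae_int1 f g : measurable_fun I01 f -> measurable_fun I01 g ->
  ae_eq mu I01 f g -> int1 f = int1 g.
Proof.
move=> mf mg fg; rewrite /int1 /Rintegral; congr fine.
apply: ae_eq_integral => //; [exact/measurable_EFinP..|].
by apply: filterS fg => x fg Ix; rewrite fg.
Qed.

Lemma int1_sqr_eq0 f : sqr_integrable f -> int1 (fun x => f x ^+ 2) = 0 ->
  ae_eq mu I01 f (fun=> 0).
Proof.
move=> [mf f2] f0.
have : (\int[mu]_(x in I01) `|(f x ^+ 2)%:E| = 0)%E.
  rewrite -[LHS]fineK; last first.
    by apply: integrable_fin_num => //; exact: integrable_abse.
  congr EFin; rewrite -[RHS]f0; congr fine; apply: eq_integral => x _.
  by rewrite gee0_abs// lee_fin sqr_ge0.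
have [K _] := ae_eq_integral_abs mu measurable_unit_itv (measurable_int mu f2).
move=> /K.
apply: filterS => x h Ix; move: (h Ix) => /= -[] /eqP.
by rewrite sqrf_eq0 => /eqP.
Qed.

End UnitInterval.

(** * Primitives of integrable functions and integration by parts *)

Section Primitive.
Context {R : realType}.
Local Notation mu := (@lebesgue_measure R).
Local Notation I01 := (@unit_itv R).
Implicit Types f g h : R -> R.
Hint Resolve measurable_unit_itv : core.

Lemma primE f x : prim f x = \int[mu]_(t in `[0, x] `&` I01) f t.
Proof. by rewrite Rintegral_mkcondr. Qed.

Lemma integrable_restr f : integrable01 f -> mu.-integrable setT (EFin \o (f \_ I01)).
Proof.
move=> sf; rewrite -restrict_EFin.
by have [K _] := @integrable_mkcond _ _ _ mu I01 (EFin \o f) measurable_unit_itv; exact: K.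
Qed.

Lemma measurable_prefix (x : R) : measurable (`[0, x] `&` I01).
Proof. by apply: measurableI; [exact: measurable_itv|exact: measurable_unit_itv]. Qed.
Hint Resolve measurable_prefix : core.

Lemma integrable_prefix f x : integrable01 f ->
  mu.-integrable (`[0, x] `&` I01) (EFin \o f).
Proof.
move=> sf; apply: integrableS sf.
- exact: measurable_unit_itv.
- exact: measurable_prefix.
- by move=> t [].
Qed.

Lemma primD f g x : integrable01 f -> integrable01 g ->
  prim (fun t => f t + g t) x = prim f x + prim g x.
Proof.
move=> sf sg; rewrite !primE RintegralD//; [exact: measurable_prefix|exact: integrable_prefix..].
Qed.

Lemma primZ a f x : integrable01 f -> prim (fun t => a * f t) x = a * prim f x.
Proof.
move=> sf; rewrite !primE RintegralZl//; [exact: measurable_prefix|exact: integrable_prefix].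
Qed.

Lemma eq_prim f g x : (forall t, I01 t -> f t = g t) -> prim f x = prim g x.
Proof.
by move=> fg; rewrite !primE; apply: eq_Rintegral => t /[!inE] -[_ /fg].
Qed.

Lemma ae_prim f g x : measurable_fun I01 f -> measurable_fun I01 g ->
  ae_eq mu I01 f g -> prim f x = prim g x.
Proof.
move=> mf mg fg; rewrite !primE /Rintegral; congr fine.
apply: ae_eq_integral; first exact: measurable_prefix.
- by apply/measurable_EFinP; exact: measurable_funS measurable_unit_itv (@subIsetr _ _ _) mf.
- by apply/measurable_EFinP; exact: measurable_funS measurable_unit_itv (@subIsetr _ _ _) mg.
by apply: filterS fg => t fg [_ It]; rewrite fg.
Qed.

Lemma prim0 f : prim f 0 = 0.
Proof.
rewrite primE (_ : _ `&` _ = set0) ?Rintegral_set0//.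
by apply/(@seteqP R); split=> // t [] /=; rewrite /I01 /= !in_itv/=; lra.
Qed.

Lemma prim1 f : prim f 1 = int1 f.
Proof.
rewrite primE (_ : _ `&` _ = I01)//.
by apply/(@seteqP R); split=> t /=; rewrite /I01 /= !in_itv/=; lra.
Qed.

Lemma prim_cst (c x : R) : 0 <= x <= 1 -> prim (fun=> c) x = c * x.
Proof.
move=> x01; rewrite primE Rintegral_cst; last exact: measurable_prefix.
congr (_ * _); have [->|x1] := eqVneq x 1.
  rewrite (_ : _ `&` _ = I01); first by rewrite [X in fine X]mu_unit_itv.
  by apply/(@seteqP R); split=> t /=; rewrite /I01 /= !in_itv/=; lra.
have {}x1 : x < 1 by rewrite lt_neqAle x1; lra.
rewrite (_ : _ `&` _ = `]0, x]%classic); last first.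
  by apply/seteqP; split=> t /=; rewrite /I01 /= !in_itv/=; lra.
rewrite [X in fine X]lebesgue_measure_itv/= lte_fin oppr0 adde0.
by case: ltP => /= x0 //; lra.
Qed.

Lemma prim_continuous f : integrable01 f -> {within `[0, 1], continuous (prim f)}.
Proof.
move=> sf; apply: parameterized_integral_continuous => //.
by apply: integrableS (integrable_restr sf).
Qed.

Lemma within01_measurable f : {within `[0, 1], continuous f} -> measurable_fun I01 f.
Proof.
move=> cf; have m01 : measurable (`[0, 1]%classic : set R) := measurable_itv _.
have sub : I01 `<=` `[0, 1] by move=> x; rewrite /I01/= !in_itv/=; lra.
exact: measurable_funS m01 sub (subspace_continuous_measurable_fun m01 cf).
Qed.

Lemma within01_bounded f : {within `[0, 1], continuous f} ->
  exists M : R, forall x, 0 <= x <= 1 -> `|f x| <= M.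
Proof.
move=> cf; have /compact_bounded[M [_ MP]] :=
  continuous_compact cf (@segment_compact R 0 1).
have M1 : M < M + 1 by rewrite ltrDl.
by exists (M + 1) => x x01; apply: (MP _ M1); exists x => //=; rewrite in_itv.
Qed.

Lemma within01_sqr_integrable f : {within `[0, 1], continuous f} -> sqr_integrable f.
Proof.
move=> cf; have [M fM] := within01_bounded cf.
apply: (@sqr_integrable_bounded _ _ M); first exact: within01_measurable.
by move=> x; rewrite /I01/= in_itv/= => x01; apply: fM; lra.
Qed.

Lemma prim_sqr_integrable f : integrable01 f -> sqr_integrable (prim f).
Proof. by move=> sf; apply: within01_sqr_integrable; exact: prim_continuous. Qed.

Lemma integrable01_primM f g : integrable01 f -> integrable01 g ->
  integrable01 (fun x => prim f x * g x).
Proof.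
move=> sf sg; have cf := prim_continuous sf; have [M fM] := within01_bounded cf.
apply: (@integrable01M_bounded _ _ _ M) => //; first exact: within01_measurable.
by move=> x; rewrite /I01/= in_itv/= => x01; apply: fM; lra.
Qed.

Lemma prim_ibp f g : integrable01 f -> integrable01 g ->
  int1 (fun x => prim f x * g x) + int1 (fun x => f x * prim g x) = int1 f * int1 g.
Proof.
move=> sf sg.
pose f0 := f \_ I01; pose g0 := g \_ I01.
have if0 : mu.-integrable setT (EFin \o f0) := integrable_restr sf.
have ig0 : mu.-integrable setT (EFin \o g0) := integrable_restr sg.
have mf0 : measurable_fun setT f0 by apply/measurable_EFinP; exact: (measurable_int mu).
have mg0 : measurable_fun setT g0 by apply/measurable_EFinP; exact: (measurable_int mu).
(* With [x = p.1] and [t = p.2], integrating first in [t] gives [g x * prim f x]; integrating first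
   in [x] gives [f t] times the integral of [g] from [t] to 1. *)
pose A : set (R * R) := [set p | p.2 <= p.1].
have mA : measurable A.
  by rewrite -[A]setTI; apply: measurable_fun_le => //; exact: measurableT.
pose H (p : R * R) : R := (g0 p.1 * f0 p.2) * \1_A p.
have mH : measurable_fun setT H.
  apply: measurable_funM; last exact: measurable_indic.
  by apply: measurable_funM; [exact: measurableT_comp|exact: measurableT_comp].
(* [H] is dominated by the product of [g0] and [f0], and the iterated integral of the absolute value
   of that product factors into two finite integrals. *)
have iH : (mu \x mu)%E.-integrable setT (EFin \o H).
  have mK : measurable_fun setT (fun p : R * R => g0 p.1 * f0 p.2).
    by apply: measurable_funM; exact: measurableT_comp.
  apply: (@le_integrable _ _ _ (mu \x mu)%E setT measurableT (EFin \o H) (fun p => (g0 p.1 * f0 p.2)%:E)).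
  - exact/measurable_EFinP.
  - move=> p _ /=; rewrite lee_fin normrM ler_piMr// indicE.
    by case: (_ \in _); rewrite ?normr1 ?normr0.
  apply/integrable12ltyP; first exact/measurable_EFinP.
  have N1 := integrable_lty measurableT (integrable_abse if0).
  have N2 := integrable_lty measurableT (integrable_abse ig0).
  rewrite [X in (X < _)%E](_ : _ = \int[mu]_x (`|(g0 x)%:E| * \int[mu]_t `|(f0 t)%:E|))%E; last first.
    apply: eq_integral => x _; rewrite -ge0_integralZl//; first by
      apply: eq_integral => t _; rewrite EFinM abseM.
    by apply: measurableT_comp => //; exact/measurable_EFinP.
  rewrite ge0_integralZr//.
  - apply: lte_mul_pinfty => //; first exact: integral_ge0.
    by rewrite ge0_fin_numE ?integral_ge0.
  - by apply: measurableT_comp => //; exact/measurable_EFinP.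
  - exact: integral_ge0.
have cut u (B : set R) : measurable B -> mu.-integrable setT (EFin \o u) ->
    mu.-integrable setT (EFin \o (u \_ B)).
  move=> mB iu; apply: (@le_integrable _ _ _ mu _ measurableT _ (EFin \o u)) => //.
  - have mU : measurable_fun setT u by apply/measurable_EFinP; exact: (measurable_int mu).
    apply/measurable_EFinP; have [K _] := measurable_restrictT u mB.
    exact: (K (measurable_funTS mU)).
  - by move=> x _ /=; rewrite lee_fin patchE; case: ifP => // _; rewrite normr0.
have F1 x : (\int[mu]_t (H (x, t))%:E = (g0 x * prim f x)%:E)%E.
  have mB : measurable (`[0, x]%classic : set R) := measurable_itv _.
  have ic := cut f0 _ mB if0.
  transitivity ((g0 x)%:E * \int[mu]_t ((f0 \_ `[0, x]) t)%:E)%E; last first.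
    rewrite EFinM /prim Rintegral_mkcond /Rintegral fineK//.
    exact: integrable_fin_num ic.
  rewrite -integralZl//; apply: eq_integral => t _.
  rewrite -EFinM /H /= -mulrA; congr (_ * _)%:E; rewrite indicE patchE.
  rewrite /f0 !patchE; have [|] := boolP (t \in I01); last by rewrite mul0r if_same.
  rewrite inE /I01/= in_itv/= => /andP[t0 t1].
  have -> : ((x, t) \in A) = (t \in `[0, x]%classic).
    by apply/idP/idP; rewrite !inE /A/= in_itv/= (ltW t0).
  by case: ifP; rewrite ?mulr1 ?mulr0.
have F2 t : (\int[mu]_x (H (x, t))%:E = (f0 t * (int1 g - prim g t))%:E)%E.
  (* The complement of the closed condition [t <= x] is the half-open [[0, t[]; passing to [[0, t]],
     as [prim] requires, only adds a null point. *)
  have mB : measurable (`[0, t[%classic : set R) := measurable_itv _.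
  have ic := cut g0 _ mB ig0.
  transitivity ((f0 t)%:E * \int[mu]_x ((g0 x)%:E - ((g0 \_ `[0, t[) x)%:E))%E; last first.
    rewrite integralB// EFinM; congr (_ * _)%E.
    rewrite EFinB; congr (_ - _)%E.
      rewrite /int1 Rintegral_mkcond /Rintegral fineK//.
      exact: integrable_fin_num ig0.
    rewrite /prim -Rintegral_itv_bndo_bndc; last by apply: integrableS ig0.
    rewrite Rintegral_mkcond /Rintegral fineK//.
    exact: integrable_fin_num ic.
  rewrite -integralZl//; last exact: integrableB.
  apply: eq_integral => x _.
  rewrite -EFinB -EFinM /H /= mulrAC mulrC; congr (_ * _)%:E; rewrite indicE patchE.
  rewrite /g0 !patchE; have [|] := boolP (x \in I01); last by rewrite mul0r if_same subrr.
  rewrite inE /I01/= in_itv/= => /andP[x0 x1].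
  have -> : ((x, t) \in A) = ~~ (x \in `[0, t[%classic).
    have -> : (x \in `[0, t[%classic) = (x < t).
      by apply/idP/idP; rewrite !inE/= in_itv/= (ltW x0).
    by rewrite -leNgt; apply/idP/idP; rewrite inE.
  by case: (x \in _); rewrite /= ?mulr1 ?mulr0 ?subr0 ?subrr.
have ipf : integrable01 (fun x => prim f x * g x) by exact: integrable01_primM.
have ipg : integrable01 (fun x => f x * prim g x).
  by under eq_fun do rewrite mulrC; exact: integrable01_primM.
have [K1 K2] : (\int[mu]_x (g0 x * prim f x)%:E = \int[mu]_(x in I01) (prim f x * g x)%:E)%E /\
   (\int[mu]_x (f0 x * (int1 g - prim g x))%:E =
      \int[mu]_(x in I01) (int1 g * f x - f x * prim g x)%:E)%E.
  split; rewrite [RHS]integral_mkcond; apply: eq_integral => x _;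
    by rewrite /f0 /g0 !patchE; case: ifP => _; rewrite ?mul0r//; congr EFin; ring.
have := Fubini iH.
under eq_integral do rewrite /= F1.
under [X in _ = X]eq_integral do rewrite /= F2.
rewrite K1 K2 => K3.
have : int1 (fun x => prim f x * g x) = int1 (fun x => int1 g * f x - f x * prim g x).
  by rewrite /int1 /Rintegral K3.
rewrite int1B//; last exact: integrable01Z.
by rewrite int1Z// => ->; rewrite subrK mulrC.
Qed.

End Primitive.

(** * Weak derivatives *)

Section DuBoisReymond.
Context {R : realType}.
Local Notation mu := (@lebesgue_measure R).
Local Notation I01 := (@unit_itv R).
Implicit Types f g h : R -> R.
Hint Resolve measurable_unit_itv : core.

Lemma prim_ae_derive f : integrable01 f ->
  {ae mu, forall x, I01 x -> derivable (prim f) x 1 /\ (prim f)^`()%classic x = f x}.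
Proof.
move=> sf; have if0 := integrable_restr sf.
have := @FTC1 R (f \_ I01) (BLeft 0) _ (integrable_locally measurable_unit_itv sf).
have H y : mu.-integrable [set` Interval (BLeft 0) (BRight y)] (EFin \o f \_ I01).
  exact: integrableS if0.
move=> /(_ H); apply: filterS; first exact: (ae_filter_ringOfSetsType mu).
move=> x K Ix.
have x0 : 0 < x by move: Ix; rewrite /I01/= in_itv/= => /andP[].
have [|dx ->] := K; first by rewrite lte_fin.
by split=> //; rewrite patchE mem_set.
Qed.

(** Almost everywhere [f] is the derivative of its primitive, which is locally constant. This is the
    injectivity of integration from 0. *)
Lemma prim_cst_ae0 f c : integrable01 f -> (forall x, I01 x -> prim f x = c) ->
  ae_eq mu I01 f (fun=> 0).
Proof.
move=> sf fc; have := prim_ae_derive sf.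
apply: filterS; first exact: (ae_filter_ringOfSetsType mu).
move=> x K Ix.
have [_ <-] := K Ix; rewrite derive1E (near_eq_derive (g := cst c)) ?derive_cst//.
near=> y; apply: fc; near: y; exact: near_in_itvoo.
Unshelve. all: by end_near. Qed.

Lemma int1_dominated (u : nat -> R -> R) (u0 g : R -> R) :
  (forall n, measurable_fun I01 (u n)) -> measurable_fun I01 u0 ->
  {ae mu, forall x, I01 x -> u ^~ x @ \oo --> u0 x} ->
  integrable01 g -> (forall x n, I01 x -> `|u n x| <= g x) ->
  int1 (u n) @[n --> \oo] --> int1 u0.
Proof.
move=> mu_ mu0 u_u0 ig ug.
have [] := @dominated_convergence _ _ _ mu I01 measurable_unit_itv
  (fun n => EFin \o u n) (EFin \o u0) (EFin \o g).
- by move=> n; apply/measurable_EFinP; exact: mu_.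
- by apply/measurable_EFinP; exact: mu0.
- apply: filterS u_u0; first exact: (ae_filter_ringOfSetsType mu).
  by move=> x K Ix; apply: cvg_EFin; [exact: nearW|exact: K].
- exact: ig.
- by apply: aeW => x n Ix /=; rewrite lee_fin; exact: ug.
move=> iu0 _ K; apply: fine_cvg; rewrite fineK; first exact: K.
exact: (@integrable_fin_num _ _ _ mu I01 measurable_unit_itv (EFin \o u0) iu0).
Qed.

(** This is max(0, min(1, m)); with absolute values its continuity is immediate. *)
Definition clip (m : R) : R := (`|m| - `|m - 1| + 1) / 2.

Lemma clip_ge0_le1 m : 0 <= clip m <= 1.
Proof.
by rewrite /clip; case: (ger0P m) => a; case: (ger0P (m - 1)) => b; lra.
Qed.

Lemma clip0 m : m <= 0 -> clip m = 0.
Proof.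
by rewrite /clip; case: (ger0P m) => a; case: (ger0P (m - 1)) => b; lra.
Qed.

Lemma clip1 m : 1 <= m -> clip m = 1.
Proof.
by rewrite /clip; case: (ger0P m) => a; case: (ger0P (m - 1)) => b; lra.
Qed.

(** For [a < b] the product [(x - a) * (b - x)] is positive exactly on []a, b[], so at each such [x]
    the clipped multiple is eventually 1, and elsewhere it is 0: a continuous approximation of the
    indicator. *)
Definition plateau (a b : R) (n : nat) (x : R) : R := clip (n%:R * ((x - a) * (b - x))).

Lemma plateau_continuous a b n : continuous (plateau a b n).
Proof.
have c : continuous (fun x : R => n%:R * ((x - a) * (b - x))).
  move=> x; apply: cvgM; first exact: cvg_cst.
  by apply: cvgM; apply: cvgB; (exact: cvg_cst || exact: cvg_id).
move=> x; apply: cvgM; last exact: cvg_cst.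
apply: cvgD; last exact: cvg_cst.
apply: cvgB; first by apply: cvg_norm; exact: c.
by apply: cvg_norm; apply: cvgB; [exact: c|exact: cvg_cst].
Qed.

Lemma plateau_out a b n x : a <= b -> ~ (a <= x <= b) -> plateau a b n x = 0.
Proof.
move=> ab xab; apply: clip0; rewrite mulr_ge0_le0//.
have [xa|xa] := ltP x a; first by apply: mulr_le0_ge0; lra.
have [xb|xb] := ltP b x; first by apply: mulr_ge0_le0; lra.
by exfalso; apply: xab; lra.
Qed.

Lemma plateau_cvg a b x : a < b -> plateau a b n x @[n --> \oo] --> (\1_(`]a, b[) x : R).
Proof.
move=> ab; rewrite indicE; have [|] := boolP (x \in `]a, b[%classic).
  rewrite inE/= in_itv/= => /andP[ax xb].
  have m0 : 0 < (x - a) * (b - x) by apply: mulr_gt0; lra.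
  apply: cvg_near_cst; near=> n; apply: clip1.
  rewrite -ler_pdivrMr// mul1r; near: n; exact: nbhs_infty_ger.
rewrite notin_setE/= in_itv/= => xab.
apply: cvg_near_cst; near=> n; apply: clip0; rewrite mulr_ge0_le0//.
have [xa|xa] := leP x a; first by apply: mulr_le0_ge0; lra.
have [xb|xb] := leP b x; first by apply: mulr_ge0_le0; lra.
by exfalso; apply: xab; lra.
Unshelve. all: by end_near. Qed.

Lemma plateau_int1_cvg a b h : 0 < a -> a < b -> b < 1 -> integrable01 h ->
  int1 (fun x => plateau a b n x * h x) @[n --> \oo] --> prim h b - prim h a.
Proof.
move=> a0 ab b1 ih.
have -> : prim h b - prim h a = int1 (fun x => \1_(`]a, b[) x * h x).
  have ih0 := integrable_restr ih.
  rewrite /prim Rintegral_itvB ?bnd_simp; [|by apply: integrableS ih0|lra|lra].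
  rewrite -Rintegral_itv_bndo_bndc; last by apply: integrableS ih0.
  rewrite -Rintegral_mkcondr setIC Rintegral_mkcondr; apply: eq_Rintegral => x _.
  by rewrite patchE indicE; case: ifP; rewrite ?mul1r ?mul0r.
apply: (@int1_dominated _ _ (fun x => `|h x|)).
- move=> n; apply: measurable_funM; last exact: integrable01_measurable.
  by apply: measurable_funTS; apply: continuous_measurable_fun; exact: plateau_continuous.
- apply: measurable_funM; last exact: integrable01_measurable.
  exact: measurable_indic.
- by apply: aeW => x _; apply: cvgM; [exact: plateau_cvg|exact: cvg_cst].
- exact: integrable_norm.
- move=> x n _; rewrite normrM ler_piMl//.
  by have /andP[p0 p1] := clip_ge0_le1 (n%:R * ((x - a) * (b - x))); rewrite ger0_norm.
Qed.

Lemma test_function_primitive psi (a b : R) : 0 < a -> a <= b -> b < 1 ->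
  continuous psi -> (forall x, ~ (a <= x <= b) -> psi x = 0) -> int1 psi = 0 ->
  exists2 phi, test_function phi & forall x, phi^`()%classic x = psi x.
Proof.
move=> a0 ab b1 cpsi psi0 ipsi.
have [M psiM] := within01_bounded (continuous_subspaceT cpsi : {within `[0, 1], continuous psi}).
have sI : integrable01 psi.
  by apply: sqr_integrable_integrable01; apply: within01_sqr_integrable; exact: continuous_subspaceT.
have psiE : psi = psi \_ I01.
  apply/funext => x; rewrite patchE; case: ifP => // /negP; rewrite inE /I01/= in_itv/= => xI.
  by apply: psi0; lra.
have iT : mu.-integrable setT (EFin \o psi) by rewrite psiE; exact: integrable_restr.
(* Starting at -oo makes the primitive derivable at every real point; it vanishes to the right of
   [b] because [psi] has integral 0. *)
pose phi x := \int[mu]_(t in `]-oo, x]) psi t.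
have dphi x : derivable phi x 1 /\ phi^`()%classic x = psi x.
  apply: (@continuous_FTC1 R psi (BInfty _ true) x (x + 1)) => //; first by lra.
  - exact: integrableS iT.
  - by rewrite ltNyr.
  - exact: cpsi.
exists phi; last by move=> x; have [] := dphi x.
split.
- by move=> x; have [] := dphi x.
- by rewrite (_ : phi^`()%classic = psi)//; apply/funext => x; have [] := dphi x.
exists a, b; split=> // x xab; have [xa|xa] := ltP x a.
  rewrite /phi (@eq_Rintegral _ _ _ _ _ (fun=> 0)).
    by rewrite /Rintegral integral0_eq.
  by move=> t; rewrite inE/= in_itv/= => tx; apply: psi0; lra.
rewrite -[RHS]ipsi /int1 [RHS]Rintegral_mkcond -psiE /phi Rintegral_mkcond.
apply: eq_Rintegral => t _; rewrite patchE; case: ifPn => //.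
rewrite notin_setE/= in_itv/= => /negP; rewrite -ltNge => xt.
by rewrite psi0//; lra.
Qed.

(* Differences of normalized plateaus are derivatives of test functions, so in the
   limit h has the same average over every subinterval. *)
Lemma du_bois_reymond h : integrable01 h ->
  (forall phi, test_function phi -> int1 (fun x => phi^`()%classic x * h x) = 0) ->
  exists c, ae_eq mu I01 h (fun=> c).
Proof.
move=> ih h0.
have key (a b c d : R) : 0 < a -> a < b -> b < 1 -> 0 < c -> c < d -> d < 1 ->
    (d - c) * (prim h b - prim h a) = (b - a) * (prim h d - prim h c).
  move=> a0 ab b1 c0 cd d1.
  pose K a b n := int1 (plateau a b n).
  pose A a b n := int1 (fun x => plateau a b n x * h x).
  have mp a' b' n : measurable_fun I01 (plateau a' b' n).
    by apply: measurable_funTS; apply: continuous_measurable_fun; exact: plateau_continuous.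
  have bp a' b' n x : I01 x -> `|plateau a' b' n x| <= 1.
    by have /andP[p0 p1] := clip_ge0_le1 (n%:R * ((x - a') * (b' - x))); rewrite ger0_norm.
  have ip a' b' n : integrable01 (plateau a' b' n) by exact: integrable01_bounded (mp a' b' n) (bp a' b' n).
  have iph a' b' n : integrable01 (fun x => plateau a' b' n x * h x).
    exact: integrable01M_bounded (mp a' b' n) (bp a' b' n) ih.
  have KA n : K c d n * A a b n = K a b n * A c d n.
    (* The weights make the two integrals cancel, so [psi] has mean zero. Its support lies in the
       smallest interval containing [[a, b]] and [[c, d]], hence [Num.min] and [Num.max] below. *)
    pose psi x := K c d n * plateau a b n x - K a b n * plateau c d n x.
    have [||||||phi tphi phiE] := @test_function_primitive psi (Num.min a c) (Num.max b d).
    - by rewrite lt_min a0.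
    - by rewrite ge_min !le_max (ltW ab).
    - by rewrite gt_max b1.
    - move=> x; apply: cvgB; (apply: cvgM; first exact: cvg_cst); exact: plateau_continuous.
    - move=> x; rewrite ge_min !le_max => xab; 
      have xab1 : ~ (a <= x <= b) by move=> /andP[u v]; apply: xab; rewrite u v.
      have xcd : ~ (c <= x <= d) by move=> /andP[u v]; apply: xab; rewrite u v !orbT.
      by rewrite /psi (plateau_out _ (ltW ab) xab1) (plateau_out _ (ltW cd) xcd) !mulr0 subrr.
    - rewrite /psi int1B; [|exact: integrable01Z|exact: integrable01Z].
      by rewrite !int1Z// -/(K a b n) -/(K c d n); ring.
    have := h0 phi tphi.
    rewrite (@eq_int1 _ _ (fun x => K c d n * (plateau a b n x * h x) -
        K a b n * (plateau c d n x * h x))); last first.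
      by move=> x _; rewrite phiE /psi; ring.
    rewrite int1B; [|exact: integrable01Z|exact: integrable01Z].
    rewrite !int1Z//.
    by move/eqP; rewrite subr_eq0 => /eqP.
  have cK (a' b' : R) : 0 < a' -> a' < b' -> b' < 1 -> K a' b' n @[n --> \oo] --> b' - a'.
    move=> a'0 ab' b'1; rewrite (_ : b' - a' = prim (fun=> 1) b' - prim (fun=> 1) a'); last first.
      by rewrite !prim_cst ?mul1r//; lra.
    rewrite (_ : K a' b' = fun n => int1 (fun x => plateau a' b' n x * 1)); last first.
      by apply/funext => n; apply: eq_int1 => x _; rewrite mulr1.
    by apply: plateau_int1_cvg => //; exact: integrable01_cst.
  have cA (a' b' : R) : 0 < a' -> a' < b' -> b' < 1 -> A a' b' n @[n --> \oo] --> prim h b' - prim h a'.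
    by move=> a'0 ab' b'1; exact: plateau_int1_cvg.
  have L1 := cvgM (cK c d c0 cd d1) (cA a b a0 ab b1).
  have L2 := cvgM (cK a b a0 ab b1) (cA c d c0 cd d1).
  have KA' : K c d \* A a b = K a b \* A c d by apply/funext => n; exact: KA.
  rewrite KA' in L1; exact: (cvg_unique (@Rhausdorff R) (L1 _) (L2 _)).
(* The average of [h] over [[1/4, 3/4]], whose length is 1/2. *)
pose k := 2 * (prim h (3 / 4) - prim h (1 / 4)).
exists k.
have ihk : integrable01 (fun x => h x - k).
  by apply: integrable01B => //; exact: integrable01_cst.
have : ae_eq mu I01 (fun x => h x - k) (fun=> 0).
  (* The average of [h] between [x] and 1/2 equals [k], so [prim h x - k * x] keeps the value it has
     at 1/2. *)
  apply: (@prim_cst_ae0 _ (prim h (1 / 2) - k / 2)) => // x Ix.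
  have {Ix} /andP[x0 x1] : 0 < x < 1 by move: Ix; rewrite /I01/= in_itv.
  rewrite (_ : prim _ x = prim h x - k * x); last first.
    rewrite (@primD _ h (fun=> - k)) ?prim_cst ?mulNr//; first by lra.
    exact: integrable01_cst.
  have [xh|xh|->] := ltgtP x (1 / 2).
  - have := key x (1 / 2) (1 / 4) (3 / 4); rewrite /k.
    move=> /(_ x0 xh) K; have := K ltac:(lra) ltac:(lra) ltac:(lra) ltac:(lra); clear; lra.
  - have := key (1 / 2) x (1 / 4) (3 / 4); rewrite /k.
    move=> /(_ ltac:(lra) xh x1) K; have := K ltac:(lra) ltac:(lra) ltac:(lra); clear; lra.
  - lra.
by apply: filterS => x K Ix; apply/eqP; rewrite -subr_eq0; apply/eqP; exact: K.
Qed.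
End DuBoisReymond.

(** * Continuous representatives and weak derivatives of primitives *)

Section WeakDerivative.
Context {R : realType}.
Local Notation mu := (@lebesgue_measure R).
Local Notation I01 := (@unit_itv R).
Implicit Types f g h : R -> R.
Hint Resolve measurable_unit_itv : core.

Lemma prim_closed f x : measurable_fun I01 f -> 0 <= x <= 1 ->
  prim f x = \int[mu]_(t in `[0, x]) f t.
Proof.
move=> mf x01; rewrite /prim /Rintegral.
have sub : `]0, x[ `<=` I01 by move=> t; rewrite /I01/= !in_itv/=; lra.
have mI : measurable (`]0, x[%classic : set R) := measurable_itv _.
congr fine; apply: (@eq_integral_itv_bounded _ 0 x).
- have [K _] := measurable_restrictT f measurable_unit_itv.
  exact: measurable_funTS (K mf).
- exact: measurable_funS measurable_unit_itv sub mf.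
- by move=> t tx; rewrite patchE mem_set//; apply: sub.
Qed.

(** The difference is continuous with zero primitive, so at interior points it is the derivative of
    0; one-sided limits reach the endpoints. Hence [eval] does not depend on the representative it
    picks. *)
Lemma within01_ae_eq (u v : R -> R) : {within `[0, 1], continuous u} ->
  {within `[0, 1], continuous v} -> ae_eq mu I01 u v ->
  forall x, 0 <= x <= 1 -> u x = v x.
Proof.
move=> cu cv uv.
pose w x := u x - v x.
have cw : {within `[0, 1], continuous w} by move=> x; apply: cvgB; [exact: cu|exact: cv].
have iw : integrable01 w.
  exact/sqr_integrable_integrable01/within01_sqr_integrable.
have w0 : ae_eq mu I01 w (fun=> 0).
  by apply: filterS uv => x E Ix; rewrite /w E// subrr.
have pw x : prim w x = 0.
  rewrite (ae_prim _ (integrable01_measurable iw) _ w0)//.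
  by rewrite primE /Rintegral integral0_eq.
have [wo w0r w1l] := (continuous_within_itvP w (@ltr01 R)).1 cw.
have win x : 0 < x < 1 -> w x = 0.
  move=> /andP[x0 x1].
  have xI : x \in `]0, 1[ by rewrite in_itv/= x0.
  have wIx : (w \_ I01) x = w x by rewrite patchE mem_set.
  have i01 : mu.-integrable `[0, 1] (EFin \o (w \_ I01)).
    by apply: integrableS (integrable_restr iw).
  have [|d E] := continuous_FTC1_closed x1 i01 x0.
  - have N : {near x, w =1 w \_ I01}.
      near=> y; rewrite patchE mem_set//; near: y; exact: near_in_itvoo.
    have := wo x xI; rewrite /prop_for /continuous_at.
    by rewrite wIx; apply: cvg_trans; exact: near_eq_cvg.
  move: wIx.
  rewrite -E => <-.
  rewrite (_ : (fun _ => _) = cst 0) ?derive1_cst//.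
  by apply/funext => y; exact: pw.
have wl : w 0 = 0.
  apply: (cvg_unique (@Rhausdorff R) w0r).
  apply: cvg_near_cst; near=> y; apply: win; apply/andP; split; near: y; [exact: nbhs_right_gt|exact: nbhs_right_lt].
have wr : w 1 = 0.
  apply: (cvg_unique (@Rhausdorff R) w1l).
  apply: cvg_near_cst; near=> y; apply: win; apply/andP; split; near: y; [exact: nbhs_left_gt|exact: nbhs_left_lt].
move=> x x01; apply/eqP; rewrite -subr_eq0; apply/eqP.
have [->//|xn0] := eqVneq x 0; have [->//|xn1] := eqVneq x 1.
by apply: win; rewrite !lt_neqAle eq_sym xn0 xn1 /=.
Unshelve. all: by end_near. Qed.

Lemma prim_derive (F f : R -> R) (x : R) : (forall t, derivable F t 1) ->
  F^`()%classic = f -> continuous f -> 0 <= x <= 1 -> prim f x = F x - F 0.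
Proof.
move=> dF F'f cf x01.
have [->|xn0] := eqVneq x 0; first by rewrite prim0 subrr.
have {xn0} x0 : 0 < x by rewrite lt_neqAle eq_sym xn0; lra.
have cF : continuous F by move=> t; apply: differentiable_continuous; apply/derivable1_diffP.
rewrite prim_closed//; last by apply: measurable_funTS; exact: continuous_measurable_fun.
rewrite /Rintegral (continuous_FTC2 (F := F))//=.
- exact: continuous_subspaceT.
- split=> [t _| |]; first exact: dF.
    by apply: cvg_at_right_filter; exact: cF.
  by apply: cvg_at_left_filter; exact: cF.
- by move=> t _; rewrite F'f.
Qed.

Lemma test_function_prim (phi : R -> R) (x : R) : test_function phi -> 0 <= x <= 1 ->
  prim (phi^`()%classic) x = phi x.
Proof.
move=> [dphi cphi [a [b [a0 b1 phi0]]]] x01.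
by rewrite (@prim_derive phi)// [phi 0]phi0 ?subr0//; lra.
Qed.

Lemma test_function_int_derive (phi : R -> R) : test_function phi ->
  int1 (phi^`()%classic) = 0.
Proof.
move=> tphi; rewrite -prim1 test_function_prim//; last lra.
by case: tphi => _ _ [a [b [a0 b1]]]; apply; lra.
Qed.

Lemma test_function_derive_sqr (phi : R -> R) : test_function phi ->
  sqr_integrable (phi^`()%classic).
Proof.
by case=> _ c _; apply: within01_sqr_integrable; exact: continuous_subspaceT.
Qed.

(** Integration by parts for [phi'] and [g]: [phi'] has integral 0, which removes both the boundary
    product and the contribution of [c], and the primitive of [phi'] is [phi] on the interval. *)
Lemma prim_weak_derivative (phi g : R -> R) (c : R) : test_function phi -> integrable01 g ->
  int1 (fun x => phi^`()%classic x * (c + prim g x)) = - int1 (fun x => phi x * g x).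
Proof.
move=> tphi ig.
have sd := test_function_derive_sqr tphi.
have id := sqr_integrable_integrable01 sd.
have := prim_ibp id ig; rewrite test_function_int_derive// mul0r.
rewrite (@eq_int1 _ (fun x => prim phi^`()%classic x * g x) (fun x => phi x * g x)); last first.
  by move=> x; rewrite /I01/= in_itv/= => Ix; rewrite test_function_prim//; lra.
rewrite (@eq_int1 _ (fun x => _ * (c + _)) (fun x => c * phi^`()%classic x + phi^`()%classic x * prim g x)); last first.
  by move=> x _; ring.
rewrite int1D ?int1Z ?test_function_int_derive//; last 2 first.
- exact: integrable01Z.
- by apply: sqr_integrable_mul => //; exact: prim_sqr_integrable.
lra.
Qed.

End WeakDerivative.

(** * Density of functions vanishing near the boundary *)

Section Density.
Context {R : realType}.
Local Notation mu := (@lebesgue_measure R).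
Local Notation I01 := (@unit_itv R).
Implicit Types f g h : R -> R.
Hint Resolve measurable_unit_itv : core.

Definition sqdist f g : R := int1 (fun x => (f x - g x) ^+ 2).

Lemma sqr_integrableB f g : sqr_integrable f -> sqr_integrable g ->
  sqr_integrable (fun x => f x - g x).
Proof.
move=> sf sg; apply: sqr_integrableD => //.
by have := sqr_integrableZ (-1) sg; under eq_fun do rewrite mulN1r.
Qed.

(** Working with squared distances avoids square roots; the factor 2 comes from
    [(s + t)^2 <= 2 (s^2 + t^2)]. *)
Lemma sqdist_triangle f g h : sqr_integrable f -> sqr_integrable g ->
  sqr_integrable h -> sqdist f h <= 2 * (sqdist f g + sqdist g h).
Proof.
move=> sf sg sh.
have [_ i1] := sqr_integrableB sf sg; have [_ i2] := sqr_integrableB sg sh.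
have [_ i3] := sqr_integrableB sf sh.
rewrite /sqdist -int1D// -int1Z; last exact: integrable01D.
apply: le_int1 => //; first by apply: integrable01Z; exact: integrable01D.
move=> x _; rewrite -subr_ge0 (_ : _ - _ = (f x - g x - (g x - h x)) ^+ 2) ?sqr_ge0//; ring.
Qed.

(** A class stable under Steklov averaging: [M] and [b] persist and only the left end [a] moves. *)
Record bump (M a b : R) f : Prop := Bump {
  bump_measurable : measurable_fun setT f;
  bump_bound : forall x, `|f x| <= M;
  bump_out : forall x, ~ (a <= x <= b) -> f x = 0 }.

Lemma bump_sqr M a b f : bump M a b f -> sqr_integrable f.
Proof.
by move=> [mf fM _]; apply: (@sqr_integrable_bounded _ _ M) => //; exact: measurable_funTS.
Qed.

Lemma bump_integrable M a b f : bump M a b f -> 0 < a -> b < 1 ->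
  mu.-integrable setT (EFin \o f).
Proof.
move=> bf a0 b1; rewrite (_ : f = f \_ I01).
  by apply: integrable_restr; exact/sqr_integrable_integrable01/(bump_sqr bf).
apply/funext => x; rewrite patchE; case: ifP => // /negP.
by rewrite inE /I01/= in_itv/= => xI; apply: (bump_out bf); lra.
Qed.

Definition primT f (x : R) : R := \int[mu]_(t in `]-oo, x]) f t.

(* Steklov averages gain one derivative and need no translation invariance of
   integrals: three of them turn a bounded function into a C^2 one. *)
Definition steklov f (s x : R) : R := s^-1 * (primT f (x + s) - primT f x).

Section Steklov.
Context (M a b : R) (f : R -> R) (bf : bump M a b f) (a0 : 0 < a) (b1 : b < 1).

Let ifT : mu.-integrable setT (EFin \o f) := bump_integrable bf a0 b1.

Lemma primTB x y : x <= y -> primT f y - primT f x = \int[mu]_(t in `]x, y]) f t.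
Proof.
by move=> xy; rewrite /primT Rintegral_itvB//; apply: integrableS ifT.
Qed.

Lemma primT_lipschitz x y : x <= y -> `|primT f y - primT f x| <= M * (y - x).
Proof.
move=> xy; rewrite primTB//.
have mD : measurable (`]x, y]%classic : set R) := measurable_itv _.
have iD : mu.-integrable `]x, y] (EFin \o f) by apply: integrableS ifT.
apply: (@le_trans _ _ (\int[mu]_(t in `]x, y]) `|f t|)).
  exact: le_normr_Rintegral.
have muD : mu `]x, y]%classic = (y - x)%:E.
  rewrite lebesgue_measure_itv/= lte_fin; case: ltP => // yx.
  by rewrite (_ : y = x) ?subrr//; lra.
have cD : mu.-integrable `]x, y] (EFin \o fun=> M).
  apply: measurable_bounded_integrable => //; first by rewrite [X in (X < _)%E]muD ltry.
  exact: bounded_cst.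
apply: (@le_trans _ _ (\int[mu]_(t in `]x, y]) M)).
  apply: le_Rintegral => //; [exact: integrable_norm|by move=> t _; exact: bump_bound bf t].
by rewrite Rintegral_cst// [X in fine X]muD.
Qed.

Lemma primT_continuous : continuous (primT f).
Proof.
have M0 : 0 <= M := le_trans (normr_ge0 _) (bump_bound bf 0).
have L x y : `|primT f x - primT f y| <= M * `|x - y|.
  have [xy|/ltW yx] := leP x y.
    have := primT_lipschitz xy; rewrite distrC (distrC x y).
    by rewrite (@ger0_norm _ (y - x)) ?subr_ge0.
  by have := primT_lipschitz yx; rewrite (@ger0_norm _ (x - y)) ?subr_ge0.
have M1 : 0 < M + 1 by rewrite ltr_wpDl.
move=> x; apply/cvgrPdist_lt => e e0; near=> y.
apply: le_lt_trans (L x y) _; apply: (@le_lt_trans _ _ ((M + 1) * `|x - y|)).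
  by rewrite ler_wpM2r// lerDl.
rewrite mulrC -ltr_pdivlMr//; near: y.
by apply: cvgr_dist_lt; [exact: cvg_id|exact: divr_gt0].
Unshelve. all: by end_near. Qed.

Lemma steklov_continuous s : continuous (steklov f s).
Proof.
move=> x; apply: cvgM; first exact: cvg_cst.
apply: cvgB; last exact: primT_continuous.
apply: (@continuous_comp _ _ _ (fun x => x + s) (primT f)); last exact: primT_continuous.
by apply: cvgD; [exact: cvg_id|exact: cvg_cst].
Qed.

(** A mean over []x, x + s]] looks only to the right, so the support grows only on the left, and a
    mean keeps the bound. *)
Lemma steklov_bump s : 0 < s -> s < a -> bump M (a - s) b (steklov f s).
Proof.
move=> s0 sa; split.
- by apply: continuous_measurable_fun; exact: steklov_continuous.
- move=> x; rewrite normrM gtr0_norm ?invr_gt0// mulrC ler_pdivrMr//.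
  by apply: le_trans (primT_lipschitz (_ : x <= x + s)) _; [lra|rewrite addrC addKr].
- move=> x xab; rewrite /steklov primTB; last lra.
  rewrite (@eq_Rintegral _ _ _ _ _ (fun=> 0)).
    by rewrite /Rintegral integral0_eq// mulr0.
  by move=> t; rewrite inE/= in_itv/= => tx; apply: (bump_out bf); lra.
Qed.

Lemma steklov_derive (s x : R) : continuous f ->
  is_derive x (1 : R) (steklov f s) (s^-1 * (f (x + s) - f x)).
Proof.
move=> cf.
have D (y : R) : is_derive y (1 : R) (primT f) (f y).
  have [||||d E] := @continuous_FTC1 R f (BInfty _ true) y (y + 1).
  - by rewrite ltrDl.
  - exact: integrableS ifT.
  - by rewrite ltNyr.
  - exact: cf.
  apply: DeriveDef; first exact: d.
  by rewrite -derive1E; exact: E.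
have Ds : is_derive x (1 : R) (fun x : R => primT f (x + s)) (f (x + s)).
  have dg : is_derive x (1 : R) (fun x : R => x + s) (1 + 0) by apply: is_deriveD.
  have := @is_derive1_comp _ (primT f) _ x _ _ (D (x + s)) dg.
  by rewrite addr0 mulr1.
exact: is_deriveZ.
Qed.

Lemma steklov_cvg : {ae mu, forall x,
  forall d : nat -> R, (forall n, 0 < d n) -> d n @[n --> \oo] --> 0 ->
  steklov f (d n) x @[n --> \oo] --> f x}.
Proof.
have li : locally_integrable setT f by apply: open_integrable_locally => //; exact: openT.
have H y : mu.-integrable `]-oo, y] (EFin \o f) by apply: integrableS ifT.
have := FTC1Ny H li.
apply: filterS; first exact: (ae_filter_ringOfSetsType mu).
move=> x [dx E] d d0 dc.
have EE : (fun h : R => h^-1 *: ((primT f \o shift x) (h *: (1 : R)) - primT f x)) =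
    (fun h : R => h^-1 * (primT f (h + x) - primT f x)).
  by apply/funext => h; rewrite /= [h *: _]mulr1.
have K : h^-1 * (primT f (h + x) - primT f x) @[h --> (0 : R)^'] --> f x.
  by rewrite -E derive1E /derive -EE; exact: dx.
have := (cvg_at_rightP _ _ _).1 (cvg_dnbhs_at_right K) d (conj d0 dc).
by under eq_fun do rewrite (addrC _ x).
Qed.

Lemma steklov_close (e r : R) : 0 < e -> 0 < r ->
  exists s, [/\ 0 < s, s < r & sqdist f (steklov f s) < e].
Proof.
move=> e0 r0.
(* Steps below [a] keep the support of the average to the right of 0, as [steklov_bump] requires. *)
pose r' := Num.min r a; have r'0 : 0 < r' by rewrite lt_min r0.
pose d n : R := r' / 2 * n.+1%:R^-1.
have d0 n : 0 < d n by rewrite mulr_gt0// ?invr_gt0// divr_gt0.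
have dr n : d n < r'.
  apply: (@le_lt_trans _ _ (r' / 2)); last by lra.
  by rewrite ler_piMr// ?invf_le1// ?ler1n//; lra.
have dc : d n @[n --> \oo] --> 0.
  rewrite -(mulr0 (r' / 2)); apply: cvgM; first exact: cvg_cst.
  exact: cvg_harmonic.
have sb n : bump M (a - d n) b (steklov f (d n)).
  by apply: steklov_bump => //; apply: lt_le_trans (dr n) _; rewrite ge_min lexx orbT.
have : sqdist f (steklov f (d n)) @[n --> \oo] --> int1 (fun _ => 0 : R).
  apply: (@int1_dominated _ (fun n x => (f x - steklov f (d n) x) ^+ 2) _ (fun=> (2 * M) ^+ 2)).
  - move=> n; apply: measurable_funX; apply: measurable_funB; apply: measurable_funTS.
      exact: bump_measurable bf.
    exact: bump_measurable (sb n).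
  - exact: measurable_cst.
  - have := steklov_cvg; apply: filterS; first exact: (ae_filter_ringOfSetsType mu).
    move=> x K _; have {}K := K d d0 dc.
    rewrite (_ : 0 = (f x - f x) ^+ 2); last by rewrite subrr expr0n.
    have L : f x - steklov f (d n) x @[n --> \oo] --> f x - f x.
      by apply: cvgB; [exact: cvg_cst|exact: K].
    exact: (cvgM L L).
  - exact: integrable01_cst.
  - move=> x n _; rewrite normrX ler_sqr ?nnegrE//.
      apply: le_trans (ler_normB _ _) _; rewrite mulr2n mulrDl !mul1r lerD//.
        exact: bump_bound bf x.
      exact: bump_bound (sb n) x.
    by rewrite mulr_ge0//; exact: le_trans (bump_bound bf 0).
rewrite int1_cst => /cvgrPdist_lt /(_ e e0) [n _ /(_ n (leqnn n))].
rewrite sub0r normrN => Hn; exists (d n); split=> //.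
  by apply: lt_le_trans (dr n) _; rewrite ge_min lexx.
exact: le_lt_trans (ler_norm _) Hn.
Qed.

End Steklov.

Lemma dense_bump f (e : R) : sqr_integrable f -> 0 < e ->
  exists M a b g, [/\ 0 < a, b < 1, bump M a b g & sqdist f g < e].
Proof.
move=> sf e0; have [mf if2] := sf.
(* Truncation both in height and away from the endpoints; [n.+2] makes the interval nonempty already
   at [n = 0]. The squared error is dominated by [f^2]. *)
pose A n : set R := [set x | `|f x| <= n%:R] `&` `[n.+2%:R^-1, 1 - n.+2%:R^-1].
pose g n := (fun x => f x * \1_(A n) x) \_ I01.
have mA n : measurable (I01 `&` A n).
  rewrite setIA; apply: measurableI; last exact: measurable_itv.
  apply: measurable_fun_le => //; first exact: measurable_unit_itv.
  exact: measurableT_comp.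
have mg n : measurable_fun I01 (fun x => f x * \1_(A n) x).
  apply: measurable_funM => //.
  have := @measurable_indic _ _ R I01 _ (mA n).
  by apply: eq_measurable_fun => x /[!inE] Ix; rewrite !indicE in_setI mem_set.
have : sqdist f (g n) @[n --> \oo] --> int1 (fun _ => 0 : R).
  apply: (@int1_dominated _ (fun n x => (f x - g n x) ^+ 2) _ (fun x => f x ^+ 2)).
  - move=> n; apply: measurable_funX; apply: measurable_funB => //.
    apply: eq_measurable_fun (mg n) => x xI.
    by rewrite /g patchE xI.
  - exact: measurable_cst.
  - apply: aeW => x Ix; apply: cvg_near_cst; near=> n.
    rewrite /g patchE mem_set// indicE mem_set ?mulr1 ?subrr ?expr0n//.
    have {Ix} /andP[x0 x1] : 0 < x < 1 by move: Ix; rewrite /I01/= in_itv.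
    split; first by near: n; exact: nbhs_infty_ger.
    have N1 : x^-1 <= n%:R by near: n; exact: nbhs_infty_ger.
    have N2 : (1 - x)^-1 <= n%:R by near: n; exact: nbhs_infty_ger.
    have n0 : n%:R <= n.+2%:R :> R by rewrite ler_nat ltnW.
    rewrite /= in_itv/=; apply/andP; split.
      by rewrite -[x]invrK lef_pV2 ?posrE ?invr_gt0//; exact: le_trans N1 n0.
    rewrite lerBrDr addrC -lerBrDr -[1 - x]invrK lef_pV2 ?posrE ?invr_gt0 ?subr_gt0//.
    exact: le_trans N2 n0.
  - exact: if2.
  - move=> x n Ix; rewrite /g patchE mem_set// indicE.
    by case: (_ \in _); rewrite ?mulr1 ?mulr0 ?subrr ?subr0 ?expr0n /= ger0_norm ?sqr_ge0.
rewrite int1_cst => /cvgrPdist_lt /(_ e e0) [n _ /(_ n (leqnn n))].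
rewrite sub0r normrN => Hn.
exists n%:R, n.+2%:R^-1, (1 - n.+2%:R^-1), (g n); split.
- by rewrite invr_gt0.
- by rewrite ltrBlDr ltrDl invr_gt0.
- split.
  + have [K _] := measurable_restrictT (fun x => f x * \1_(A n) x) measurable_unit_itv.
    exact: K (mg n).
  + move=> x; rewrite /g patchE indicE; case: ifP => _; last by rewrite normr0.
    case: (boolP (x \in A n)); last by rewrite mulr0 normr0.
    by rewrite inE mulr1 => -[].
  + move=> x xA; rewrite /g patchE indicE; case: ifP => // _.
    rewrite (_ : (x \in A n) = false) ?mulr0//.
    by apply/negbTE; rewrite notin_setE => -[_]; rewrite /= in_itv.
- exact: le_lt_trans (ler_norm _) Hn.
Unshelve. all: by end_near. Qed.


(** A bump close to [f] is averaged three times: the averages are continuous, C^1 and C^2, all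
    supported inside (0,1). With [h] the second derivative of the last one, the two integrals are
    its derivative and its value at 1, hence 0. *)
Lemma dense_second_primitive f (e : R) : sqr_integrable f -> 0 < e ->
  exists h, [/\ sqr_integrable h, int1 h = 0, int1 (prim h) = 0 &
    sqdist f (prim (prim h)) < e].
Proof.
(* Three triangle inequalities give [A <= 2 B + 4 D + 8 F + 8 G], less than 22/64 of [u], so shares
   of 1/64 are ample. *)
have arith (A B C D E F G u : R) : 0 < u -> B < u / 64 -> D < u / 64 -> F < u / 64 ->
    G < u / 64 -> A <= 2 * (B + C) -> C <= 2 * (D + E) -> E <= 2 * (F + G) -> A < u.
  by clear; lra.
move=> sf e0; have e1 : 0 < e / 64 by rewrite divr_gt0.
have [M [a [b [f0 [a0 b1 bf0 d0]]]]] := dense_bump sf e1.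
(* Three steps below [a / 4] move the left end of the support by less than [3 a / 4], so it stays
   positive. *)
have r0 : 0 < a / 4 by rewrite divr_gt0.
have [s1 [s1_gt0 s1_lt d1]] := steklov_close bf0 a0 b1 e1 r0.
pose f1 := steklov f0 s1.
have bf1 : bump M (a - s1) b f1 by apply: steklov_bump => //; clear -s1_lt a0; lra.
have a1 : 0 < a - s1 by clear -s1_lt a0; lra.
have [s2 [s2_gt0 s2_lt d2]] := steklov_close bf1 a1 b1 e1 r0.
pose f2 := steklov f1 s2.
have bf2 : bump M (a - s1 - s2) b f2 by apply: steklov_bump => //; clear -s1_lt s2_lt a0; lra.
have a2 : 0 < a - s1 - s2 by clear -s1_lt s2_lt a0; lra.
have [s3 [s3_gt0 s3_lt d3]] := steklov_close bf2 a2 b1 e1 r0.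
pose f3 := steklov f2 s3.
have bf3 : bump M (a - s1 - s2 - s3) b f3 by apply: steklov_bump => //; clear -s1_lt s2_lt s3_lt a0; lra.
have a3 : 0 < a - s1 - s2 - s3 by clear -s1_lt s2_lt s3_lt a0; lra.
have cf1 : continuous f1 by exact: steklov_continuous bf0 a0 b1 s1.
have cf2 : continuous f2 by exact: steklov_continuous bf1 a1 b1 s2.
pose df2 x := s2^-1 * (f1 (x + s2) - f1 x).
have Df2 (x : R) : is_derive x (1 : R) f2 (df2 x) by exact: steklov_derive bf1 a1 b1 _ _ cf1.
pose p x := s3^-1 * (f2 (x + s3) - f2 x).
have Df3 (x : R) : is_derive x (1 : R) f3 (p x) by exact: steklov_derive bf2 a2 b1 _ _ cf2.
(* [p] is the derivative of [f3] and a difference quotient of [f2], so differentiating once more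
   replaces [f2] by [df2]. *)
pose h x := s3^-1 * (df2 (x + s3) - df2 x).
have shift_cont (s : R) (u : R -> R) : continuous u -> continuous (fun x => u (x + s)).
  move=> cu x; apply: (@continuous_comp _ _ _ (fun x => x + s) u); last exact: cu.
  by apply: cvgD; [exact: cvg_id|exact: cvg_cst].
have quot_cont (s : R) (u : R -> R) : continuous u -> continuous (fun x => s^-1 * (u (x + s) - u x)).
  move=> cu x; apply: cvgM; first exact: cvg_cst.
  by apply: cvgB; [exact: shift_cont|exact: cu].
have cp : continuous p by exact: quot_cont.
have ch : continuous h by exact: (quot_cont _ _ (quot_cont _ _ cf1)).
have Dp (x : R) : is_derive x (1 : R) p (h x).
  have dg : is_derive x (1 : R) (fun x : R => x + s3) (1 + 0) by apply: is_deriveD.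
  have := @is_derive1_comp _ f2 _ x _ _ (Df2 (x + s3)) dg.
  by rewrite addr0 mulr1 => D; apply: is_deriveZ.
have prim_is (F u : R -> R) (x : R) : (forall x : R, is_derive x (1 : R) F (u x)) ->
    continuous u -> F 0 = 0 -> 0 <= x <= 1 -> prim u x = F x.
  move=> DF cu F0 x01; rewrite (@prim_derive _ F)//; first by rewrite F0 subr0.
  by apply/funext => y; rewrite derive1E; have := DF y => /@derive_val.
have o2 x : ~ (a - s1 - s2 <= x <= b) -> f2 x = 0 by exact: bump_out bf2 x.
have o3 x : ~ (a - s1 - s2 - s3 <= x <= b) -> f3 x = 0 by exact: bump_out bf3 x.
have out (u v w : R) : 0 < u -> v < 1 -> w = 0 \/ w = 1 -> ~ (u <= w <= v).
  by clear => u0 v1 [->|->]; lra.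
have in0 : 0 <= (0 : R) <= 1 by rewrite lexx ler01.
have in1 : 0 <= (1 : R) <= 1 by rewrite lexx ler01.
have p0 : p 0 = 0.
  rewrite /p !o2 ?subrr ?mulr0//; first by apply: out => //; left.
  by clear -s1_lt s2_lt s3_lt a0; lra.
have p1 : p 1 = 0.
  rewrite /p !o2 ?subrr ?mulr0//; first by apply: out => //; right.
  by clear -s3_gt0 b1; lra.
have f30 : f3 0 = 0 by apply: o3; apply: out => //; left.
have f31 : f3 1 = 0 by apply: o3; apply: out => //; right.
have Icc x : I01 x -> 0 <= x <= 1.
  by rewrite /I01/= in_itv/= => /andP[/ltW -> /ltW].
have primh x : 0 <= x <= 1 -> prim h x = p x by exact: prim_is.
have primp x : 0 <= x <= 1 -> prim p x = f3 x by exact: prim_is.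
have eqh x : I01 x -> prim h x = p x.
  by move=> /Icc; exact: primh.
exists h; split.
- by apply: within01_sqr_integrable; exact: continuous_subspaceT.
- by rewrite -prim1 primh.
- by rewrite (eq_int1 eqh) -prim1 primp.
have -> : sqdist f (prim (prim h)) = sqdist f f3.
  by apply: eq_int1 => x /Icc x01; rewrite (eq_prim _ eqh) primp.
have S0 := bump_sqr bf0; have S1 := bump_sqr bf1; have S2 := bump_sqr bf2.
have S3 := bump_sqr bf3.
have T1 := sqdist_triangle sf S0 S3.
have T2 := sqdist_triangle S0 S1 S3.
have T3 := sqdist_triangle S1 S2 S3.
exact: arith e0 d0 d1 d2 d3 T1 T2 T3.
Qed.

End Density.

(** * Complex-valued functions and the space L^2 *)

Local Notation Re := complex.Re.
Local Notation Im := complex.Im.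

Section ComplexParts.
Context {R : realType}.
Implicit Types z w : R[i].

Lemma ReD z w : Re (z + w) = Re z + Re w. Proof. by case: z w => [? ?] []. Qed.
Lemma ImD z w : Im (z + w) = Im z + Im w. Proof. by case: z w => [? ?] []. Qed.
Lemma ReN z : Re (- z) = - Re z. Proof. by case: z. Qed.
Lemma ImN z : Im (- z) = - Im z. Proof. by case: z. Qed.
Lemma ReM z w : Re (z * w) = Re z * Re w - Im z * Im w.
Proof. by case: z w => [? ?] []. Qed.
Lemma ImM z w : Im (z * w) = Re z * Im w + Im z * Re w.
Proof. by case: z w => [? ?] []. Qed.
Lemma ReJ z : Re z^* = Re z. Proof. by case: z. Qed.
Lemma ImJ z : Im z^* = - Im z. Proof. by case: z. Qed.
Lemma Re_real (x : R) : Re x%:C%C = x. Proof. by []. Qed.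
Lemma Im_real (x : R) : Im x%:C%C = 0. Proof. by []. Qed.

Lemma Re_Complex (a b : R) : Re (Complex a b) = a. Proof. by []. Qed.
Lemma Im_Complex (a b : R) : Im (Complex a b) = b. Proof. by []. Qed.
Lemma Re1 : Re (1 : R[i]) = 1. Proof. by []. Qed.
Lemma Im1 : Im (1 : R[i]) = 0. Proof. by []. Qed.
Lemma Re0 : Re (0 : R[i]) = 0. Proof. by []. Qed.
Lemma Im0 : Im (0 : R[i]) = 0. Proof. by []. Qed.
Lemma Re_i : Re ('i : R[i]) = 0. Proof. by []. Qed.
Lemma Im_i : Im ('i : R[i]) = 1. Proof. by []. Qed.

Definition cpartsE := (ReD, ImD, ReN, ImN, ReM, ImM, ReJ, ImJ, Re_real, Im_real,
  Re_Complex, Im_Complex, Re0, Im0, Re1, Im1, Re_i, Im_i).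

Lemma complex_eq z w : Re z = Re w -> Im z = Im w -> z = w.
Proof. by case: z w => [? ?] [? ?] /= -> ->. Qed.

End ComplexParts.

Section ComplexIntegral.
Context {R : realType}.
Local Notation mu := (@lebesgue_measure R).
Local Notation I01 := (@unit_itv R).
Implicit Types (f g : R -> R[i]) (c : R[i]).
Hint Resolve measurable_unit_itv : core.

Definition cintegrable f : Prop :=
  integrable01 (fun x => Re (f x)) /\ integrable01 (fun x => Im (f x)).

Lemma Re_cintegral f : Re (cintegral f) = int1 (fun x => Re (f x)).
Proof. by []. Qed.

Lemma Im_cintegral f : Im (cintegral f) = int1 (fun x => Im (f x)).
Proof. by []. Qed.

Definition cintegralE := (Re_cintegral, Im_cintegral).

Lemma eq_cintegral f g : (forall x, I01 x -> f x = g x) ->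
  cintegral f = cintegral g.
Proof. by move=> fg; congr Complex; apply: eq_int1 => x Ix; rewrite fg. Qed.

Lemma cintegralD f g : cintegrable f -> cintegrable g ->
  cintegral (fun x => f x + g x) = cintegral f + cintegral g.
Proof.
move=> [f1 f2] [g1 g2]; apply: complex_eq; rewrite !(cpartsE, cintegralE).
- by rewrite -[RHS](int1D f1 g1); apply: eq_int1 => x _; rewrite ReD.
- by rewrite -[RHS](int1D f2 g2); apply: eq_int1 => x _; rewrite ImD.
Qed.

Lemma cintegralZ c f : cintegrable f ->
  cintegral (fun x => c * f x) = c * cintegral f.
Proof.
move=> [f1 f2]; apply: complex_eq; rewrite !(cpartsE, cintegralE).
- rewrite -!int1Z// -int1B; [|exact: integrable01Z|exact: integrable01Z].
  by apply: eq_int1 => x _; rewrite ReM.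
- rewrite -!int1Z// -int1D; [|exact: integrable01Z|exact: integrable01Z].
  by apply: eq_int1 => x _; rewrite ImM.
Qed.

Lemma cintegralJ f : cintegrable f -> cintegral (fun x => (f x)^*) = (cintegral f)^*.
Proof.
move=> [f1 f2]; apply: complex_eq; rewrite !(cpartsE, cintegralE).
- by apply: eq_int1 => x _; rewrite ReJ.
- by rewrite -[RHS]int1N//; apply: eq_int1 => x _; rewrite ImJ.
Qed.

Lemma ae_cintegral f g : cintegrable f -> cintegrable g -> ae_eq mu I01 f g ->
  cintegral f = cintegral g.
Proof.
move=> [f1 f2] [g1 g2] fg; congr Complex.
- apply: ae_int1; [exact: integrable01_measurable..|].
  by apply: filterS fg => x E Ix; rewrite E.
- apply: ae_int1; [exact: integrable01_measurable..|].
  by apply: filterS fg => x E Ix; rewrite E.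
Qed.

Lemma is_L2_cintegrable f : is_L2 f -> cintegrable f.
Proof. by move=> [f1 f2]; split; exact: sqr_integrable_integrable01. Qed.

Lemma is_L2_mulJ f g : is_L2 f -> is_L2 g -> cintegrable (fun x => (f x)^* * g x).
Proof.
move=> [f1 f2] [g1 g2]; split.
- rewrite (_ : (fun x => _) = fun x => Re (f x) * Re (g x) + Im (f x) * Im (g x)).
    by apply: integrable01D; exact: sqr_integrable_mul.
  by apply/funext => x; rewrite !cpartsE; ring.
- rewrite (_ : (fun x => _) = fun x => Re (f x) * Im (g x) - Im (f x) * Re (g x)).
    by apply: integrable01B; exact: sqr_integrable_mul.
  by apply/funext => x; rewrite !cpartsE; ring.
Qed.

Lemma is_L2_realM (phi : R -> R) f : sqr_integrable phi -> is_L2 f ->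
  cintegrable (fun x => (phi x)%:C%C * f x).
Proof.
move=> sp [f1 f2]; split.
- rewrite (_ : (fun x => _) = fun x => phi x * Re (f x)); first exact: sqr_integrable_mul.
  by apply/funext => x; rewrite !cpartsE mul0r subr0.
- rewrite (_ : (fun x => _) = fun x => phi x * Im (f x)); first exact: sqr_integrable_mul.
  by apply/funext => x; rewrite !cpartsE mul0r addr0.
Qed.

Lemma cintegral_realM (phi : R -> R) f :
  cintegral (fun x => (phi x)%:C%C * f x) =
  Complex (int1 (fun x => phi x * Re (f x))) (int1 (fun x => phi x * Im (f x))).
Proof.
congr Complex; apply: eq_int1 => x _; rewrite cpartsE /=; ring.
Qed.

Lemma is_L2D f g : is_L2 f -> is_L2 g -> is_L2 (fun x => f x + g x).
Proof.
move=> [f1 f2] [g1 g2]; split.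
- by under eq_fun do rewrite ReD; exact: sqr_integrableD.
- by under eq_fun do rewrite ImD; exact: sqr_integrableD.
Qed.

Lemma is_L2Z c f : is_L2 f -> is_L2 (fun x => c * f x).
Proof.
move=> [f1 f2]; split.
- under eq_fun do rewrite ReM -mulNr.
  by apply: sqr_integrableD; exact: sqr_integrableZ.
- under eq_fun do rewrite ImM.
  by apply: sqr_integrableD; exact: sqr_integrableZ.
Qed.

Definition cprim f (x : R) : R[i] :=
  Complex (prim (fun t => Re (f t)) x) (prim (fun t => Im (f t)) x).

Lemma cprim0 f : cprim f 0 = 0.
Proof. by rewrite /cprim !prim0. Qed.

Lemma cprim1 f : cprim f 1 = cintegral f.
Proof. by rewrite /cprim !prim1. Qed.

Lemma is_L2_cprim f : cintegrable f -> is_L2 (cprim f).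
Proof. by move=> [f1 f2]; split; exact: prim_sqr_integrable. Qed.

Lemma cprim_ibp f g : cintegrable f -> cintegrable g ->
  cintegral (fun x => (cprim f x)^* * g x) + cintegral (fun x => (f x)^* * cprim g x) =
  (cintegral f)^* * cintegral g.
Proof.
move=> fL gL; have [f1 f2] := fL; have [g1 g2] := gL.
have mp u v : integrable01 u -> integrable01 v -> integrable01 (fun x => u x * prim v x).
  by move=> iu iv; under eq_fun do rewrite mulrC; exact: integrable01_primM.
have := prim_ibp f1 g1; have := prim_ibp f1 g2.
have := prim_ibp f2 g1; have := prim_ibp f2 g2.
set p := fun x => Re (f x); set q := fun x => Im (f x).
set r := fun x => Re (g x); set s := fun x => Im (g x).
move=> e22 e21 e12 e11.
have E1 : int1 (fun x => Re ((cprim f x)^* * g x)) =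
    int1 (fun x => prim p x * r x) + int1 (fun x => prim q x * s x).
  rewrite -int1D; [|exact: integrable01_primM..].
  by apply: eq_int1 => x _; rewrite !cpartsE /= mulNr opprK.
have E2 : int1 (fun x => Re ((f x)^* * cprim g x)) =
    int1 (fun x => p x * prim r x) + int1 (fun x => q x * prim s x).
  rewrite -int1D; [|exact: mp..].
  by apply: eq_int1 => x _; rewrite !cpartsE /= mulNr opprK.
have E3 : int1 (fun x => Im ((cprim f x)^* * g x)) =
    int1 (fun x => prim p x * s x) - int1 (fun x => prim q x * r x).
  rewrite -int1B; [|exact: integrable01_primM..].
  by apply: eq_int1 => x _; rewrite !cpartsE /= mulNr.
have E4 : int1 (fun x => Im ((f x)^* * cprim g x)) =
    int1 (fun x => p x * prim s x) - int1 (fun x => q x * prim r x).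
  rewrite -int1B; [|exact: mp..].
  by apply: eq_int1 => x _; rewrite !cpartsE /= mulNr.
apply: complex_eq; rewrite !(cpartsE, cintegralE) -/p -/q -/r -/s.
- by rewrite E1 E2 mulNr opprK -e11 -e22 addrACA.
- by rewrite E3 E4 mulNr -e12 -e21 opprD addrACA.
Qed.

End ComplexIntegral.

(** * L^2 as an inner product space with an integration operator *)

Section L2Space.
Context {R : realType}.
Local Open Scope quotient_scope.
Local Notation mu := (@lebesgue_measure R).
Local Notation I01 := (@unit_itv R).
Implicit Types (f g h : L2 R) (c : R[i]).
Hint Resolve measurable_unit_itv : core.
Local Notation "f =ae u" := (ae_eq mu I01 (L2_to_fun f) (u : R -> R[i]))
  (at level 70).

Lemma L2_is_L2 f : is_L2 f.
Proof. by have := L2fun_valP (repr f); rewrite inE. Qed.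
Hint Resolve L2_is_L2 : core.

Lemma L2_eqP f g : f =ae g -> f = g.
Proof. by move=> fg; rewrite -[f]reprK -[g]reprK; apply/L2_piP. Qed.

(** Made total by [xget], so that [L2prim] carries no proof argument; [toL2E] identifies the class
    for square-integrable [u]. *)
Definition toL2 (u : R -> R[i]) : L2 R := xget 0 [set f : L2 R | f =ae u].

Lemma toL2E u : is_L2 u -> toL2 u =ae u.
Proof.
move=> uL; have up : u \in L2_pred by rewrite inE.
rewrite /toL2; case: xgetP => [f _ //|/(_ (\pi_(L2 R) (MkL2fun up)))]; case.
exact: L2_repr_pi.
Qed.

Lemma L2_addE f g : f + g =ae (fun x => f x + g x).
Proof. exact: (@L2_repr_pi R (repr f + repr g)). Qed.

Lemma L2_scaleE c f : c *: f =ae (fun x => c * f x).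
Proof. exact: (@L2_repr_pi R (c *: repr f)). Qed.

Lemma L2_linE c f g : c *: f + g =ae (fun x => c * f x + g x).
Proof.
have := L2_addE (c *: f) g; have := L2_scaleE c f.
by apply: filterS2 => x E1 E2 Ix; rewrite E2// E1.
Qed.

Lemma is_L2_lin c f g : is_L2 (fun x => c * f x + g x).
Proof. by apply: is_L2D => //; exact: is_L2Z. Qed.

Lemma inner_linear f c g h : inner f (c *: g + h) = c * inner f g + inner f h.
Proof.
rewrite /inner -cintegralZ; last exact: is_L2_mulJ.
rewrite -cintegralD; last 2 first.
- have := is_L2_mulJ (L2_is_L2 f) (is_L2Z c (L2_is_L2 g)).
  by under eq_fun do rewrite mulrCA.
- exact: is_L2_mulJ.
apply: ae_cintegral.
- exact: is_L2_mulJ.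
- have := is_L2_mulJ (L2_is_L2 f) (is_L2_lin c g h).
  by under eq_fun do rewrite mulrDr mulrCA.
- by have := L2_linE c g h; apply: filterS => x E Ix; rewrite E// mulrDr mulrCA.
Qed.

Lemma inner_conj f g : inner g f = (inner f g)^*.
Proof.
rewrite /inner -cintegralJ; last exact: is_L2_mulJ.
by apply: eq_cintegral => x _; apply: complex_eq; rewrite !cpartsE; ring.
Qed.

Lemma inner_self f : inner f f =
  (int1 (fun x => Re (f x) ^+ 2) + int1 (fun x => Im (f x) ^+ 2))%:C%C.
Proof.
have [[_ f1] [_ f2]] := L2_is_L2 f; rewrite -int1D//.
rewrite /inner; apply: complex_eq; rewrite !(cpartsE, cintegralE).
- by apply: eq_int1 => x _; rewrite !cpartsE; ring.
- by rewrite -[RHS]int1_cst; apply: eq_int1 => x _; rewrite !cpartsE; ring.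
Qed.

Lemma inner_eq0 f : inner f f = 0 -> f = 0.
Proof.
rewrite inner_self => /(congr1 (@complex.Re R))/= /eqP.
rewrite paddr_eq0 ?int1_ge0//; try by move=> x _; rewrite sqr_ge0.
move=> /andP[/eqP f1 /eqP f2]; apply: L2_eqP.
have [r1 r2] := L2_is_L2 f.
have a1 := int1_sqr_eq0 r1 f1; have a2 := int1_sqr_eq0 r2 f2.
have a3 := L2_scaleE 0 f; rewrite scale0r in a3.
apply: filterS3 a1 a2 a3 => x e1 e2 e3 Ix.
by rewrite e3// mul0r; apply: complex_eq; rewrite ?e1 ?e2.
Qed.

Definition L2one : L2 R := toL2 (fun=> 1).
Definition L2prim f : L2 R := toL2 (cprim f).

Lemma is_L2_cst c : is_L2 (fun=> c).
Proof.
split.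
- by apply: (@sqr_integrable_bounded _ _ `|Re c|) => //; exact: measurable_cst.
- by apply: (@sqr_integrable_bounded _ _ `|Im c|) => //; exact: measurable_cst.
Qed.

Lemma L2oneE : L2one =ae (fun=> 1).
Proof. by apply: toL2E; exact: is_L2_cst. Qed.

Lemma L2_cprim f : is_L2 (cprim f).
Proof. by apply: is_L2_cprim; exact: is_L2_cintegrable. Qed.

Lemma L2primE f : L2prim f =ae cprim f.
Proof. by apply: toL2E; exact: L2_cprim. Qed.

Lemma inner_L2one f : inner L2one f = cintegral f.
Proof.
apply: ae_cintegral; [exact: is_L2_mulJ|exact: is_L2_cintegrable|].
by have := L2oneE; apply: filterS => x E Ix; rewrite E// rmorph1 mul1r.
Qed.

Lemma inner_L2one_L2one : inner L2one L2one = 1.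
Proof.
rewrite inner_L2one (@ae_cintegral _ L2one (fun=> 1)).
- by apply: complex_eq; rewrite cintegralE int1_cst.
- exact: is_L2_cintegrable.
- by apply: is_L2_cintegrable; exact: is_L2_cst.
- exact: L2oneE.
Qed.

Lemma ae_cprim (u v : R -> R[i]) x : is_L2 u -> is_L2 v -> ae_eq mu I01 u v ->
  cprim u x = cprim v x.
Proof.
move=> [[u1 _] [u2 _]] [[v1 _] [v2 _]] uv; congr Complex; apply: ae_prim => //.
- by apply: filterS uv => t E It; rewrite E.
- by apply: filterS uv => t E It; rewrite E.
Qed.

Lemma cprimZD c (u v : R -> R[i]) x : is_L2 u -> is_L2 v ->
  cprim (fun t => c * u t + v t) x = c * cprim u x + cprim v x.
Proof.
move=> /is_L2_cintegrable[u1 u2] /is_L2_cintegrable[v1 v2].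
apply: complex_eq; rewrite !cpartsE /=.
- rewrite -!primZ// (_ : - prim _ x = prim (fun t => -1 * (Im c * Im (u t))) x); last first.
    by rewrite [RHS]primZ ?mulN1r//; exact: integrable01Z.
  rewrite -!primD//; try by do ?[apply: integrable01D|apply: integrable01Z].
  by apply: eq_prim => t _; rewrite !cpartsE mulN1r.
- rewrite -!primZ// -!primD//; try by do ?[apply: integrable01D|apply: integrable01Z].
  by apply: eq_prim => t _; rewrite !cpartsE.
Qed.

Lemma L2prim_linear c f g : L2prim (c *: f + g) = c *: L2prim f + L2prim g.
Proof.
apply: L2_eqP.
have A : L2prim (c *: f + g) =ae (fun x => c * L2prim f x + L2prim g x).
  have := L2primE (c *: f + g); have := L2primE f; have := L2primE g.
  apply: filterS3 => x e1 e2 e3 Ix; rewrite e3// e2// e1//.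
  rewrite -cprimZD//; apply: ae_cprim => //; first exact: is_L2_lin.
  exact: L2_linE.
have := L2_linE c (L2prim f) (L2prim g); move: A.
by apply: filterS2 => x e1 e2 Ix; rewrite e1// e2.
Qed.

Lemma L2prim_ibp f g : inner (L2prim f) g + inner f (L2prim g) = (inner L2one f)^* * inner L2one g.
Proof.
rewrite !inner_L2one -cprim_ibp; [|exact: is_L2_cintegrable..].
congr (_ + _); apply: ae_cintegral.
- exact: is_L2_mulJ.
- by apply: is_L2_mulJ => //; exact: L2_cprim.
- by have := L2primE f; apply: filterS => x E Ix; rewrite E.
- exact: is_L2_mulJ.
- by apply: is_L2_mulJ => //; exact: L2_cprim.
- by have := L2primE g; apply: filterS => x E Ix; rewrite E.
Qed.

End L2Space.

(** * The Sobolev spaces H^1 and H^2 *)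

Local Notation eval := Defs.eval.

Section SobolevSpace.
Context {R : realType}.
Local Notation mu := (@lebesgue_measure R).
Local Notation I01 := (@unit_itv R).
Implicit Types (f g h : L2 R) (c : R[i]).
Hint Resolve measurable_unit_itv L2_is_L2 : core.
Local Notation "f =ae u" := (ae_eq mu I01 (L2_to_fun f) (u : R -> R[i]))
  (at level 70).

Lemma affineE c g : c *: L2one + L2prim g =ae (fun x => c + cprim g x).
Proof.
have := L2_linE c L2one (L2prim g); have := (@L2oneE R); have := L2primE g.
by apply: filterS3 => x e1 e2 e3 Ix; rewrite e3// e2// e1// mulr1.
Qed.

Lemma continuous_prim_shift (u : R -> R) (c : R) : integrable01 u ->
  {within `[0, 1], continuous (fun x => c + prim u x)}.
Proof.
by move=> iu x; apply: cvgD; [exact: cvg_cst|exact: prim_continuous].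
Qed.

Lemma affine_continuous_rep c g :
  continuous_rep (c *: L2one + L2prim g) (fun x => c + cprim g x).
Proof.
have [g1 g2] := is_L2_cintegrable (L2_is_L2 g); split.
- by under [X in continuous X]eq_fun do rewrite ReD /=; exact: continuous_prim_shift.
- by under [X in continuous X]eq_fun do rewrite ImD /=; exact: continuous_prim_shift.
- by apply: ae_eq_sym; exact: affineE.
Qed.

Lemma continuous_rep_unique f u v x : continuous_rep f u -> continuous_rep f v ->
  0 <= x <= 1 -> u x = v x.
Proof.
move=> [u1 u2 uf] [v1 v2 vf] x01.
have uv : ae_eq mu I01 u v by apply: ae_eq_trans uf _; exact: ae_eq_sym.
apply: complex_eq.
- apply: (within01_ae_eq u1 v1 _ x01).
  by apply: filterS uv => t E It; rewrite E.
- apply: (within01_ae_eq u2 v2 _ x01).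
  by apply: filterS uv => t E It; rewrite E.
Qed.

Lemma eval_affine c g (x : R) : 0 <= x <= 1 -> eval (c *: L2one + L2prim g) x = c + cprim g x.
Proof.
move=> x01; rewrite /eval; case: xgetP => [u _ ru|/(_ _ (affine_continuous_rep c g))//].
exact: continuous_rep_unique ru (affine_continuous_rep c g) x01.
Qed.

Lemma eval_affine0 c g : eval (c *: L2one + L2prim g) 0 = c.
Proof.
by rewrite eval_affine ?lexx ?ler01// cprim0 addr0.
Qed.

Lemma eval_affine1 c g : eval (c *: L2one + L2prim g) 1 = c + inner L2one g.
Proof.
by rewrite eval_affine ?lexx ?ler01// inner_L2one cprim1.
Qed.

(** The continuous representative [c + cprim g] of the zero class vanishes on all of [0,1]: at 0
    this gives [c = 0], and then a vanishing primitive gives [g = 0]. Uniqueness of weak derivatives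
    rests on this. *)
Lemma affine_eq0 c g : c *: L2one + L2prim g = 0 -> c = 0 /\ g = 0.
Proof.
move=> E0.
have r0 : continuous_rep (c *: L2one + L2prim g) (fun=> 0).
  split; [exact/continuous_subspaceT/cst_continuous..|].
  rewrite E0; have := L2_scaleE 0 (0 : L2 R); rewrite scale0r.
  by apply: filterS => x E Ix; rewrite E// mul0r.
have z x : 0 <= x <= 1 -> c + cprim g x = 0.
  by move=> x01; exact: continuous_rep_unique (affine_continuous_rep c g) r0 x01.
have c0 : c = 0.
  by have := z 0; rewrite lexx ler01 cprim0 addr0 => /(_ isT).
split=> //; apply: L2_eqP.
have [g1 g2] := is_L2_cintegrable (L2_is_L2 g).
have Icc x : I01 x -> 0 <= x <= 1.
  by rewrite /I01/= in_itv/= => /andP[/ltW -> /ltW].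
have a1 : ae_eq mu I01 (fun x => Re (g x)) (fun=> 0).
  apply: (@prim_cst_ae0 _ _ 0) => // x /Icc /z.
  by rewrite c0 add0r => /(congr1 (@complex.Re R)).
have a2 : ae_eq mu I01 (fun x => Im (g x)) (fun=> 0).
  apply: (@prim_cst_ae0 _ _ 0) => // x /Icc /z.
  by rewrite c0 add0r => /(congr1 (@complex.Im R)).
have a3 := L2_scaleE 0 (0 : L2 R); rewrite scale0r in a3.
apply: filterS3 a1 a2 a3 => x e1 e2 e3 Ix.
by rewrite e3// mul0r; apply: complex_eq; rewrite ?e1 ?e2.
Qed.

Lemma cintegral_test_affine (phi : R -> R) c g : test_function phi ->
  cintegral (fun x => (phi^`()%classic x)%:C%C * (c *: L2one + L2prim g : L2 R) x) =
  - cintegral (fun x => (phi x)%:C%C * g x).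
Proof.
move=> tphi.
have [g1 g2] := is_L2_cintegrable (L2_is_L2 g).
rewrite (@ae_cintegral _ _ (fun x => (phi^`()%classic x)%:C%C * (c + cprim g x))).
- rewrite !cintegral_realM; apply: complex_eq; rewrite cpartsE /=.
  + rewrite -(prim_weak_derivative (Re c) tphi g1).
    by apply: eq_int1 => x _; rewrite ReD.
  + rewrite -(prim_weak_derivative (Im c) tphi g2).
    by apply: eq_int1 => x _; rewrite ImD.
- by apply: is_L2_realM => //; exact: test_function_derive_sqr.
- apply: is_L2_realM; first exact: test_function_derive_sqr.
  by apply: is_L2D; [exact: is_L2_cst|exact: L2_cprim].
- by have := affineE c g; apply: filterS => x E Ix; rewrite E.
Qed.

Lemma weak_derivativeP f g :
  weak_derivative f g <-> exists c, f = c *: L2one + L2prim g.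
Proof.
split=> [wd|[c ->] phi tphi]; last exact: cintegral_test_affine.
(* [f] minus the primitive of [g] has weak derivative 0, so its real and imaginary parts are
   constant by [du_bois_reymond]. *)
pose k : L2 R := - 1 *: L2prim g + f.
have [k1 k2] := L2_is_L2 k.
have kphi phi : test_function phi ->
    cintegral (fun x => (phi^`()%classic x)%:C%C * k x) = 0.
  move=> tphi.
  have sd := test_function_derive_sqr tphi.
  rewrite (@ae_cintegral _ _ (fun x => -1 * ((phi^`()%classic x)%:C%C * L2prim g x) +
      (phi^`()%classic x)%:C%C * f x)).
  - rewrite cintegralD ?cintegralZ ?wd//.
    + rewrite (_ : L2prim g = 0 *: L2one + L2prim g) ?scale0r ?add0r//.
      have := cintegral_test_affine 0 g tphi.
      by rewrite scale0r add0r => ->; rewrite mulN1r opprK subrr.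
    + exact: is_L2_realM.
    + by under eq_fun do rewrite mulrCA; apply: is_L2_realM => //; exact: is_L2Z.
    + exact: is_L2_realM.
  - exact: is_L2_realM.
  - by under eq_fun do rewrite mulrCA -mulrDr; apply: is_L2_realM => //; exact: is_L2_lin.
  - by have := L2_linE (-1) (L2prim g) f; apply: filterS => x E Ix; rewrite E//; ring.
have [c1 a1] : exists c : R, ae_eq mu I01 (fun x => Re (k x)) (fun=> c).
  apply: du_bois_reymond => [|phi tphi]; first exact: sqr_integrable_integrable01.
  by have := kphi phi tphi; rewrite cintegral_realM => /(congr1 (@complex.Re R)).
have [c2 a2] : exists c : R, ae_eq mu I01 (fun x => Im (k x)) (fun=> c).
  apply: du_bois_reymond => [|phi tphi]; first exact: sqr_integrable_integrable01.
  by have := kphi phi tphi; rewrite cintegral_realM => /(congr1 (@complex.Im R)).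
exists (Complex c1 c2).
have -> : Complex c1 c2 *: L2one = k.
  apply: L2_eqP; have a3 := L2_scaleE (Complex c1 c2) L2one.
  have a4 : L2one =ae (fun=> 1) := @L2oneE R.
  have a5 : Complex c1 c2 *: L2one =ae (fun=> Complex c1 c2).
    by apply: filterS2 a3 a4 => x e3 e4 Ix; rewrite e3// e4// mulr1.
  apply: filterS3 a1 a2 a5 => x e1 e2 e5 Ix.
  by rewrite e5//; apply: complex_eq; rewrite /= ?e1 ?e2.
by rewrite /k scaleN1r addrC addNKr.
Qed.

(** [affine_eq0] makes the weak derivative unique, so the choice hidden in [wderiv] is harmless. *)
Lemma wderiv_affine c g : wderiv (c *: L2one + L2prim g) = g.
Proof.
rewrite /wderiv; case: xgetP => [g' _ /weak_derivativeP[c' E]|/(_ g)]; last first.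
  by case; apply/weak_derivativeP; exists c.
have [_ /eqP] : c - c' = 0 /\ g - g' = 0.
  apply: affine_eq0; rewrite scalerBl.
  have := L2prim_linear (-1) g' g; rewrite !scaleN1r [- g' + g]addrC => ->.
  by rewrite [- L2prim g' + L2prim g]addrC addrACA E -opprD subrr.
by rewrite subr_eq0 => /eqP.
Qed.

Lemma H1_affineP f : H1_01 f <-> exists c g, f = c *: L2one + L2prim g.
Proof.
split=> [[g /weak_derivativeP[c ->]]|[c [g ->]]]; first by exists c, g.
by exists g; apply/weak_derivativeP; exists c.
Qed.

(** The parameters are f(0), f'(0) and f''. *)
Definition H2fun (a b : R[i]) (h : L2 R) : L2 R := a *: L2one + L2prim (b *: L2one + L2prim h).

Lemma H2_P f : H2_01 f <-> exists a b h, f = H2fun a b h.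
Proof.
split=> [[/H1_affineP[a [g ->]]]|[a [b [h ->]]]].
  by rewrite wderiv_affine => /H1_affineP[b [h ->]]; exists a, b, h.
split; first by apply/H1_affineP; exists a, (b *: L2one + L2prim h).
by rewrite wderiv_affine; apply/H1_affineP; exists b, h.
Qed.

Lemma neg_laplace_H2fun a b h : neg_laplace (H2fun a b h) = - h.
Proof. by rewrite /neg_laplace !wderiv_affine. Qed.

Lemma bvals_H2fun a b h : bvals (H2fun a b h) =
  (a, a + inner L2one (b *: L2one + L2prim h), b, b + inner L2one h).
Proof.
rewrite /bvals wderiv_affine; congr (_, _, _, _).
- exact: eval_affine0.
- exact: eval_affine1.
- exact: eval_affine0.
- exact: eval_affine1.
Qed.

Lemma L2norm_lt f (e : R) : 0 < e -> Re (inner f f) < e ^+ 2 -> L2norm f < e.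
Proof.
move=> e0 fe; rewrite /L2norm -[e]gtr0_norm// -sqrtr_sqr ltr_sqrt//.
by rewrite exprn_gt0.
Qed.

(** The two moment conditions say that the double primitive of [h] and its derivative vanish at 1 as
    well as at 0, so the approximant lies in D(S). Real and imaginary parts are approximated
    separately, each within [e ^+ 2 / 2] in squared distance. *)
Lemma dense_H20 f (e : R) : 0 < e -> exists h,
  [/\ inner L2one h = 0, inner L2one (L2prim h) = 0 & L2norm (f - L2prim (L2prim h)) < e].
Proof.
move=> e0; have [f1 f2] := L2_is_L2 f.
have e2 : 0 < e ^+ 2 / 2 by rewrite divr_gt0// exprn_gt0.
have [h1 [s1 i1 p1 d1]] := dense_second_primitive f1 e2.
have [h2 [s2 i2 p2 d2]] := dense_second_primitive f2 e2.
pose u x := Complex (h1 x) (h2 x).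
have uL : is_L2 u by split.
pose h := toL2 u; have hu : h =ae u := toL2E uL.
have cpu x : cprim h x = Complex (prim h1 x) (prim h2 x) by rewrite (ae_cprim _ _ uL hu).
have Jh : L2prim h =ae (fun x => Complex (prim h1 x) (prim h2 x)).
  by have := L2primE h; apply: filterS => x E Ix; rewrite E// cpu.
have pL : is_L2 (fun x => Complex (prim h1 x) (prim h2 x)).
  by split; apply: prim_sqr_integrable; exact: sqr_integrable_integrable01.
have JJh : L2prim (L2prim h) =ae (fun x => Complex (prim (prim h1) x) (prim (prim h2) x)).
  by have := L2primE (L2prim h); apply: filterS => x E Ix; rewrite E// (ae_cprim _ _ pL Jh).
exists h; split.
- rewrite inner_L2one (ae_cintegral (is_L2_cintegrable _) (is_L2_cintegrable uL) hu)//.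
  by apply: complex_eq.
- rewrite inner_L2one (ae_cintegral (is_L2_cintegrable _) (is_L2_cintegrable pL) Jh)//.
  by apply: complex_eq.
apply: L2norm_lt => //; rewrite inner_self /=.
have sp1 := prim_sqr_integrable (sqr_integrable_integrable01 (prim_sqr_integrable (sqr_integrable_integrable01 s1))).
have sp2 := prim_sqr_integrable (sqr_integrable_integrable01 (prim_sqr_integrable (sqr_integrable_integrable01 s2))).
have [k1 k2] := L2_is_L2 (f - L2prim (L2prim h)).
have D : f - L2prim (L2prim h) =ae (fun x => f x - Complex (prim (prim h1) x) (prim (prim h2) x)).
  have := L2_linE (-1) (L2prim (L2prim h)) f; rewrite scaleN1r addrC; move: JJh.
  by apply: filterS2 => x E1 E2 Ix; rewrite E2// E1// mulN1r addrC.
have E1 : int1 (fun x => Re ((f - L2prim (L2prim h) : L2 R) x) ^+ 2) = sqdist (fun x => Re (f x)) (prim (prim h1)).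
  apply: ae_int1.
  - by apply: measurable_funX; case: k1.
  - by apply: measurable_funX; case: (sqr_integrableB f1 sp1).
  - by apply: filterS D => x E Ix; rewrite E// cpartsE.
have E2 : int1 (fun x => Im ((f - L2prim (L2prim h) : L2 R) x) ^+ 2) = sqdist (fun x => Im (f x)) (prim (prim h2)).
  apply: ae_int1.
  - by apply: measurable_funX; case: k2.
  - by apply: measurable_funX; case: (sqr_integrableB f2 sp2).
  - by apply: filterS D => x E Ix; rewrite E// cpartsE.
rewrite [ltRHS]splitr; apply: ltrD.
- exact: eq_ind_r (fun z => z < _) d1 _ E1.
- exact: eq_ind_r (fun z => z < _) d2 _ E2.
Qed.

End SobolevSpace.

(** * The boundary form *)

Section Form.
Context {R : realType}.
Implicit Types x y z w c : R[i].

Definition bform x0 x1 y0 y1 : R := Im (x0^* * y0 - x1^* * y1).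

Definition col2E (a b : R[i]) : (col2 a b 0 0 = a) * (col2 a b 1 0 = b).
Proof. by rewrite !mxE. Qed.

Lemma sum_ord2 (F : 'I_2 -> R[i]) : \sum_j F j = F 0 + F 1.
Proof. by rewrite !big_ord_recl big_ord0 addr0; congr (_ + F _); apply: val_inj. Qed.

Lemma ord2P (i : 'I_2) : i = 0 \/ i = 1.
Proof. by case: i => [[|[|//]] ?]; [left|right]; apply: val_inj. Qed.

Lemma mulmx_col2 (C : 'M[R[i]]_2) a b :
  C *m col2 a b = col2 (C 0 0 * a + C 0 1 * b) (C 1 0 * a + C 1 1 * b).
Proof.
by apply/matrixP => i j; rewrite mxE sum_ord2 !mxE /=; have [->|->] := ord2P i.
Qed.

Lemma col2_eta (x : 'cV[R[i]]_2) : x = col2 (x 0 0) (x 1 0).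
Proof.
by apply/matrixP => i j; rewrite !mxE ord1; have [->|->] := ord2P i.
Qed.

Lemma col2_inj a b c d : col2 a b = col2 c d -> a = c /\ b = d.
Proof.
move=> E; split; first by rewrite -(col2E a b).1 E col2E.
by rewrite -(col2E a b).2 E col2E.
Qed.

Lemma subJ_half_i w : (2 * 'i)^-1 * (w - w^*) = (Im w)%:C%C.
Proof.
have i2 : 2 * 'i != 0 :> R[i] by rewrite mulf_neq0 ?pnatr_eq0// neq0Ci.
apply: (mulfI i2); rewrite mulVKf//.
have E2 : 2 * 'i = Complex 0 2 :> R[i].
  have -> : 2 = Complex 2 0 :> R[i] by apply: complex_eq => //=; rewrite addr0.
  by apply: complex_eq; rewrite !cpartsE ?(mulr0, mul0r, mulr1, subrr, addr0).
rewrite E2; apply: complex_eq; rewrite !cpartsE ?(mulr0, mul0r, subrr, add0r)//.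
  by rewrite oppr0.
by rewrite opprK mulr_natl mulr2n.
Qed.

(** With Gamma_1 = y = [(a, b)] and Gamma_0 = [C] y, the boundary form is Im <C y, y>, the quadratic
    form at y of the imaginary part of the adjoint of [C]; this is why the adjoint enters the
    condition. The entry [- b] is f'(1). *)
Lemma Im_mx_adjoint_form (C : 'M[R[i]]_2) a b :
  ((col2 a b)^t* *m Im_mx (C^t* ) *m col2 a b) 0 0 =
  (bform (C 0 0 * a + C 0 1 * b) (C 1 0 * a + C 1 1 * b) a (- b))%:C%C.
Proof.
rewrite mxE sum_ord2 !(mxE, sum_ord2) /= /bform -subJ_half_i !conjCK.
rewrite !(rmorphD, rmorphB, rmorphN, rmorphM) /= !conjCK; ring.
Qed.

Lemma bformE x0 x1 y0 y1 : bform x0 x1 y0 y1 =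
  Re x0 * Im y0 - Im x0 * Re y0 - (Re x1 * Im y1 - Im x1 * Re y1).
Proof. by rewrite /bform !cpartsE; ring. Qed.

Lemma psd_Im_mx_adjointP (C : 'M[R[i]]_2) : psd (Im_mx (C^t* )) <->
  forall a b, 0 <= bform (C 0 0 * a + C 0 1 * b) (C 1 0 * a + C 1 1 * b) a (- b).
Proof.
split=> H => [a b|x].
  by have := H (col2 a b); rewrite Im_mx_adjoint_form lecR.
by rewrite (col2_eta x) Im_mx_adjoint_form lecR.
Qed.

Lemma affine_ge0_eq0 (k a : R) : (forall s : R, 0 <= k + s * a) -> a = 0.
Proof.
move=> H; apply/eqP; apply: contraT => a0.
(* At this [s] the affine function would take the value -1. *)
have := H (- (k + 1) / a); rewrite -mulrA mulVf// mulr1; lra.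
Qed.

(** For a = a1 + i a2, b = b1 + i b2 and w = u + i v this is the Hermitian form p |a|^2 + q |b|^2 +
    2 Re (w conj(a) b); the criterion is the sign of its diagonal and of its determinant. *)
Lemma quadratic_form_ge0P (p q u v : R) :
  (forall a1 a2 b1 b2 : R, 0 <= p * (a1 ^+ 2 + a2 ^+ 2) + q * (b1 ^+ 2 + b2 ^+ 2) +
     2 * (u * (a1 * b1 + a2 * b2) + v * (a2 * b1 - a1 * b2))) <->
  [/\ 0 <= p, 0 <= q & u ^+ 2 + v ^+ 2 <= p * q].
Proof.
split=> [H|[p0 q0 uv] a1 a2 b1 b2].
  have p0 : 0 <= p by have := H 1 0 0 0; nra.
  have q0 : 0 <= q by have := H 0 0 1 0; nra.
  split=> //; have [pz|pn] := eqVneq p 0.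
    have : u ^+ 2 + v ^+ 2 = 0; last by move=> ->; rewrite pz mul0r.
    apply: (@affine_ge0_eq0 q) => s.
    have := H (s * u / 2) (s * v / 2) 1 0; rewrite pz; lra.
  have pp : 0 < p by rewrite lt_neqAle eq_sym pn.
  (* The minimiser in a for b = p, where the form equals [p] times the determinant. *)
  have := H (- u) (- v) p 0.
  rewrite (_ : _ + _ = p * (p * q - (u ^+ 2 + v ^+ 2))); last by ring.
  by rewrite pmulr_rge0// subr_ge0.
have [pz|pn] := eqVneq p 0.
  have uv0 : u ^+ 2 + v ^+ 2 == 0 by rewrite eq_le addr_ge0 ?sqr_ge0// andbT; move: uv; rewrite pz mul0r.
  move: uv0; rewrite paddr_eq0 ?sqr_ge0// !sqrf_eq0 => /andP[/eqP -> /eqP ->].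
  by rewrite pz; nra.
have pp : 0 < p by rewrite lt_neqAle eq_sym pn.
rewrite -(pmulr_rge0 _ pp).
rewrite [leRHS](_ : _ = (p * a1 + (u * b1 - v * b2)) ^+ 2 + (p * a2 + (u * b2 + v * b1)) ^+ 2 +
  (p * q - (u ^+ 2 + v ^+ 2)) * (b1 ^+ 2 + b2 ^+ 2)); last by ring.
by rewrite !addr_ge0 ?sqr_ge0// mulr_ge0 ?subr_ge0 ?addr_ge0 ?sqr_ge0.
Qed.

Lemma psd_explicit (C : 'M[R[i]]_2) : psd (Im_mx (C^t* )) <->
  [/\ Im (C 0 0) <= 0, Im (C 1 1) <= 0 &
      4^-1 * `|C 0 1 - (C 1 0)^*| ^+ 2 <= (Im (C 0 0) * Im (C 1 1))%:C%C].
Proof.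
rewrite psd_Im_mx_adjointP.
set c := C 0 1 - (C 1 0)^*.
(* The off-diagonal coefficient u + i v of the boundary form is [i c / 2]; its squared modulus is
   put in this shape so that [quadratic_form_ge0P] matches [u] and [v]. *)
have -> : 4^-1 * `|c| ^+ 2 = ((- (Im c / 2)) ^+ 2 + (Re c / 2) ^+ 2)%:C%C.
  rewrite -add_Re2_Im2.
  have n4 : 4 != 0 :> R[i] by rewrite pnatr_eq0.
  apply: (mulfI n4); rewrite mulVKf//.
  have E4 : 4 = Complex 4 0 :> R[i] by apply: complex_eq => //=; rewrite !addr0.
  rewrite E4; apply: complex_eq; rewrite !cpartsE ?(mulr0, mul0r, subr0, addr0)//.
  by field.
rewrite lecR -[Im (C 0 0) * _]mulrNN -![Im _ <= 0]oppr_ge0.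
rewrite -quadratic_form_ge0P; split=> [H a1 a2 b1 b2|H a b].
- have := H (Complex a1 a2) (Complex b1 b2); rewrite bformE /c !cpartsE.
  by congr (0 <= _); field.
- have := H (Re a) (Im a) (Re b) (Im b); rewrite bformE /c !cpartsE.
  by congr (0 <= _); field.
Qed.

End Form.

(** * Maximal nonnegative boundary spaces *)

Section BoundarySpaces.
Context {R : realType}.
Implicit Types x y z w c : R[i].

Definition boundary_space := R[i] -> R[i] -> R[i] -> R[i] -> Prop.
Implicit Types V W : boundary_space.

Lemma sum4_sqr_eq0 (a b c d : R) : a ^+ 2 + b ^+ 2 + c ^+ 2 + d ^+ 2 = 0 ->
  [/\ a = 0, b = 0, c = 0 & d = 0].
Proof.
move=> /eqP; rewrite !paddr_eq0 ?addr_ge0 ?sqr_ge0// !sqrf_eq0.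
by move=> /andP[/andP[/andP[/eqP-> /eqP->] /eqP->] /eqP->].
Qed.

Record nonneg_space V : Prop := NonnegSpace {
  nonneg_space0 : V 0 0 0 0;
  nonneg_spaceZD : forall c x0 x1 y0 y1 z0 z1 w0 w1,
    V x0 x1 y0 y1 -> V z0 z1 w0 w1 ->
    V (c * x0 + z0) (c * x1 + z1) (c * y0 + w0) (c * y1 + w1);
  nonneg_space_ge0 : forall x0 x1 y0 y1, V x0 x1 y0 y1 -> 0 <= bform x0 x1 y0 y1 }.

Definition max_nonneg V : Prop := nonneg_space V /\
  forall W, nonneg_space W ->
    (forall x0 x1 y0 y1, V x0 x1 y0 y1 -> W x0 x1 y0 y1) ->
    forall x0 x1 y0 y1, W x0 x1 y0 y1 -> V x0 x1 y0 y1.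

Lemma nonneg_spaceZ V c x0 x1 y0 y1 : nonneg_space V -> V x0 x1 y0 y1 ->
  V (c * x0) (c * x1) (c * y0) (c * y1).
Proof.
by move=> nV Vx; have := nonneg_spaceZD nV c Vx (nonneg_space0 nV); rewrite !addr0.
Qed.

Lemma nonneg_spaceB V c x0 x1 y0 y1 z0 z1 w0 w1 : nonneg_space V ->
  V x0 x1 y0 y1 -> V z0 z1 w0 w1 ->
  V (x0 - c * z0) (x1 - c * z1) (y0 - c * w0) (y1 - c * w1).
Proof.
move=> nV Vx Vz; have := nonneg_spaceZD nV (- c) Vz Vx.
by rewrite !mulNr ![- _ + _]addrC.
Qed.

(** Testing [z] on the imaginary and then on the real axis isolates [Re c] and [Im c]. It serves
    both the boundary spaces and the operators. *)
Lemma ImM_ge0_eq0 (k : R) c : (forall z, 0 <= k + Im (z * c)) -> c = 0.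
Proof.
move=> H; apply: complex_eq.
- apply: (@affine_ge0_eq0 _ k) => s; have := H (Complex 0 s).
  by rewrite !cpartsE mul0r add0r.
- apply: (@affine_ge0_eq0 _ k) => s; have := H (Complex s 0).
  by rewrite !cpartsE mul0r addr0.
Qed.

(** Since [p] has Gamma_1 = 0, its own form vanishes, and adding multiples of [p] to a vector
    changes the form only by a term linear in the multiplier. *)
Lemma nonneg_space_orth V p0 p1 x0 x1 y0 y1 : nonneg_space V ->
  V p0 p1 0 0 -> V x0 x1 y0 y1 -> p0^* * y0 = p1^* * y1.
Proof.
move=> nV Vp Vx; apply/eqP; rewrite -subr_eq0; apply/eqP.
apply: (@ImM_ge0_eq0 (bform x0 x1 y0 y1)) => z.
have := nonneg_space_ge0 nV (nonneg_spaceZD nV z^* Vp Vx).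
by rewrite !bformE !cpartsE; congr (0 <= _); ring.
Qed.

(** The form of [x = z + c d] with [d = (- i r0, - i r1, r0, - r1)]: since Gamma_1 - i Gamma_0
    vanishes on [d], only |c|^2 |r|^2 and a cross term with Gamma_1 + i Gamma_0 of [z] are added. *)
Lemma bform_shift x0 x1 y0 y1 r0 r1 c :
  let z0 := x0 + c * ('i * r0) in let z1 := x1 + c * ('i * r1) in
  let w0 := y0 - c * r0 in let w1 := y1 + c * r1 in
  bform x0 x1 y0 y1 = bform z0 z1 w0 w1 +
    (Re c ^+ 2 + Im c ^+ 2) * (Re r0 ^+ 2 + Im r0 ^+ 2 + (Re r1 ^+ 2 + Im r1 ^+ 2)) +
    Re (c * ((w0 + 'i * z0)^* * r0 + (- w1 + 'i * z1)^* * r1)).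
Proof.
rewrite /= !bformE !cpartsE.
move: (Re x0) (Im x0) (Re x1) (Im x1) (Re y0) (Im y0) (Re y1) (Im y1).
by move: (Re r0) (Im r0) (Re r1) (Im r1) (Re c) (Im c) => *; ring.
Qed.

(* With Gamma_0 = (x0, x1) and Gamma_1 = (y0, - y1), the form is the difference of
   |Gamma_1 + i Gamma_0|^2 and |Gamma_1 - i Gamma_0|^2 up to a factor 4. The vector
   (- i r0, - i r1, r0, - r1) has Gamma_1 + i Gamma_0 = 2 r and
   Gamma_1 - i Gamma_0 = 0, so adjoining it to V for r orthogonal to the range of
   Gamma_1 + i Gamma_0 on V keeps V nonnegative. *)
Lemma max_nonneg_surj V w0 w1 : max_nonneg V ->
  exists x0 x1 y0 y1, [/\ V x0 x1 y0 y1, y0 + 'i * x0 = w0 & - y1 + 'i * x1 = w1].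
Proof.
move=> [nV mV].
pose P z0 z1 := exists x0 x1 y0 y1,
  [/\ V x0 x1 y0 y1, y0 + 'i * x0 = z0 & - y1 + 'i * x1 = z1].
have P0 : P 0 0.
  by exists 0, 0, 0, 0; split; [exact: nonneg_space0|rewrite mulr0 addr0|rewrite mulr0 oppr0 addr0].
have PZD c z0 z1 u0 u1 : P z0 z1 -> P u0 u1 -> P (c * z0 + u0) (c * z1 + u1).
  move=> [x0 [x1 [y0 [y1 [Vx <- <-]]]]] [a0 [a1 [b0 [b1 [Va <- <-]]]]].
  exists (c * x0 + a0), (c * x1 + a1), (c * y0 + b0), (c * y1 + b1).
  by split; [exact: nonneg_spaceZD|ring|ring].
have orth r0 r1 : (forall z0 z1, P z0 z1 -> z0^* * r0 + z1^* * r1 = 0) -> r0 = 0 /\ r1 = 0.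
  move=> Pr.
  pose W x0 x1 y0 y1 := exists c, V (x0 + c * ('i * r0)) (x1 + c * ('i * r1))
     (y0 - c * r0) (y1 + c * r1).
  have nW : nonneg_space W.
    split.
    - by exists 0; rewrite !mul0r !addr0 subrr; exact: nonneg_space0.
    - move=> c x0 x1 y0 y1 z0 z1 w0' w1' [a Va] [b Vb].
      exists (c * a + b); have := nonneg_spaceZD nV c Va Vb.
      by congr V; ring.
    - move=> x0 x1 y0 y1 [c Vc].
      have p := Pr _ _ (ex_intro _ _ (ex_intro _ _ (ex_intro _ _ (ex_intro _ _
        (And3 Vc erefl erefl))))).
      have B0 := nonneg_space_ge0 nV Vc.
      rewrite (bform_shift x0 x1 y0 y1 r0 r1 c) p mulr0 Re0 addr0.
      by rewrite addr_ge0// mulr_ge0// !addr_ge0// sqr_ge0.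
  (* The direction itself lies in [W], since subtracting it leaves 0. Maximality puts it in [V], and
     then [r] is orthogonal to [2 r]. *)
  have : W (- ('i * r0)) (- ('i * r1)) r0 (- r1).
    by exists 1; rewrite !mul1r !addNr subrr; exact: nonneg_space0.
  move=> /(mV W nW) Vr.
  have {}Vr : V (- ('i * r0)) (- ('i * r1)) r0 (- r1).
    by apply: Vr => x0 x1 y0 y1 Vx; exists 0; rewrite !mul0r !addr0 subr0.
  have := Pr _ _ (ex_intro _ _ (ex_intro _ _ (ex_intro _ _ (ex_intro _ _
        (And3 Vr erefl erefl))))).
  move=> /(congr1 (@complex.Re R)); rewrite !cpartsE => S.
  have [|a b d e] := @sum4_sqr_eq0 (Re r0) (Im r0) (Re r1) (Im r1).
    by move: S; clear; lra.
  by split; apply: complex_eq.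
(* The range contains a nonzero [u], and also some [z] independent of [u], for otherwise the vector
   (- conj u1, conj u0) would be orthogonal to the range. Cramer's rule then reaches every
   target. *)
have [u0 [u1 [Pu un]]] : exists u0 u1, P u0 u1 /\ ~ (u0 = 0 /\ u1 = 0).
  apply: contrapT => H; have [|/eqP + _] := orth 1 0; last by rewrite oner_eq0.
  move=> z0 z1 Pz; have [-> ->] : z0 = 0 /\ z1 = 0.
    by apply: contrapT => Hz; apply: H; exists z0, z1.
  by rewrite rmorph0 !mul0r addr0.
have [z0 [z1 [Pz D0]]] : exists z0 z1, P z0 z1 /\ u0 * z1 - u1 * z0 != 0.
  apply: contrapT => H; apply: un.
  have [|r0 r1] := orth (- u1^*) (u0^*).
    move=> z0 z1 Pz.
    have -> : z0^* * - u1^* + z1^* * u0^* = (u0 * z1 - u1 * z0)^*.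
      by rewrite rmorphB !rmorphM /=; ring.
    have [->|D0] := eqVneq (u0 * z1 - u1 * z0) 0; first by rewrite rmorph0.
    by exfalso; apply: H; exists z0, z1.
  split; apply/eqP; rewrite -conjC_eq0 ?r1//.
  by rewrite -oppr_eq0 r0.
have := PZD ((w0 * z1 - w1 * z0) / (u0 * z1 - u1 * z0)) _ _ _ _ Pu
  (PZD ((u0 * w1 - u1 * w0) / (u0 * z1 - u1 * z0)) _ _ _ _ Pz P0).
by congr P; field.
Qed.


(** * The five families as subspaces of C^4 *)

Definition bcV (p : bc R) : boundary_space := fun f0 f1 df0 df1 =>
  match p with
  | BC1 C => col2 f0 f1 = C *m col2 df0 (- df1)
  | BC2 c12 c22 =>
      f1 - c22^* * f0 = c22^* * c12 * df1 /\ df0 - c22 * df1 = 0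
  | BC3 c11 => f0 = c11 * df0 /\ df1 = 0
  | BC4 c12 => f1 = - c12 * df1 /\ df0 = 0
  | BC5 => df0 = 0 /\ df1 = 0
  end.

Lemma bcV1P (C : 'M[R[i]]_2) x0 x1 y0 y1 : bcV (BC1 C) x0 x1 y0 y1 <->
  x0 = C 0 0 * y0 - C 0 1 * y1 /\ x1 = C 1 0 * y0 - C 1 1 * y1.
Proof.
rewrite /= mulmx_col2 !mulrN; split=> [/col2_inj //|[-> ->]//].
Qed.

Lemma bcV_nonneg p : admissible p -> nonneg_space (bcV p).
Proof.
case: p => [C|c12 c22|c11|c12|].
- move=> /= /psd_Im_mx_adjointP adm; split.
  + by apply/bcV1P; rewrite !mulr0 subrr.
  + move=> c x0 x1 y0 y1 z0 z1 w0 w1 /bcV1P[-> ->] /bcV1P[-> ->]; apply/bcV1P.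
    by split; ring.
  + move=> x0 x1 y0 y1 /bcV1P[-> ->].
    by have := adm y0 (- y1); rewrite opprK !mulrN.
- move=> [c0 adm]; split.
  + by rewrite /= !mulr0 !subrr.
  + move=> c x0 x1 y0 y1 z0 z1 w0 w1 /= [e1 e2] [e3 e4]; split.
      rewrite (_ : _ - _ = c * (x1 - c22^* * x0) + (z1 - c22^* * z0)); last by ring.
      by rewrite e1 e3; ring.
    rewrite (_ : _ - _ = c * (y0 - c22 * y1) + (w0 - c22 * w1)); last by ring.
    by rewrite e2 e4 mulr0 addr0.
  + move=> x0 x1 y0 y1 /= [/eqP + /eqP]; rewrite subr_eq subr_eq0 => /eqP -> /eqP ->.
    have -> : bform x0 (c22^* * c12 * y1 + c22^* * x0) (c22 * y1) y1 =
       Im (c12 * c22^*) * (Re y1 ^+ 2 + Im y1 ^+ 2).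
      by rewrite bformE !cpartsE; ring.
    by rewrite mulr_ge0// addr_ge0 ?sqr_ge0.
- move=> /= adm; split.
  + by rewrite /= mulr0.
  + move=> c x0 x1 y0 y1 z0 z1 w0 w1 /= [-> ->] [-> ->]; split; ring.
  + move=> x0 x1 y0 y1 /= [-> ->].
    have -> : bform (c11 * y0) x1 y0 0 = Im (c11^*) * (Re y0 ^+ 2 + Im y0 ^+ 2).
      by rewrite bformE !cpartsE; ring.
    by rewrite mulr_ge0// addr_ge0 ?sqr_ge0.
- move=> /= adm; split.
  + by rewrite /= mulr0.
  + move=> c x0 x1 y0 y1 z0 z1 w0 w1 /= [-> ->] [-> ->]; split; ring.
  + move=> x0 x1 y0 y1 /= [-> ->].
    have -> : bform x0 (- c12 * y1) 0 y1 = Im (c12^*) * (Re y1 ^+ 2 + Im y1 ^+ 2).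
      by rewrite bformE !cpartsE; ring.
    by rewrite mulr_ge0// addr_ge0 ?sqr_ge0.
- move=> _; split=> /=.
  + by [].
  + by move=> c x0 x1 y0 y1 z0 z1 w0 w1 [-> ->] [-> ->]; rewrite mulr0 addr0.
  + by move=> x0 x1 y0 y1 [-> ->]; rewrite bformE !cpartsE !mulr0 !subrr.
Qed.

Definition tuple4 V (t : R[i] * R[i] * R[i] * R[i]) : Prop :=
  V t.1.1.1 t.1.1.2 t.1.2 t.2.

Lemma bcV_u p : admissible p -> tuple4 (bcV p) (u_bvals p).
Proof.
case: p => [C|c12 c22|c11|c12|] adm; rewrite /tuple4.
- by apply/bcV1P; rewrite /= !mulr1 !mulr0 !subr0.
- case: adm => c0 _ /=; have c0' : c22^* != 0 by rewrite conjC_eq0.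
  by rewrite mulfV// !mulr0 !subrr.
- by rewrite /= mulr0.
- by rewrite /= mulr0.
- by [].
Qed.

Lemma bcV_v p : tuple4 (bcV p) (v_bvals p).
Proof.
case: p => [C|c12 c22|c11|c12|]; rewrite /tuple4.
- by apply/bcV1P; rewrite /= !mulr1 !mulr0 !add0r.
- by rewrite /= !mulr1 subrr mulrN opprK add0r.
- by rewrite /= mulr1.
- by rewrite /= mulr1.
- by [].
Qed.

Definition comb (a b : R[i]) (s t : R[i] * R[i] * R[i] * R[i]) :=
  (a * s.1.1.1 + b * t.1.1.1, a * s.1.1.2 + b * t.1.1.2,
   a * s.1.2 + b * t.1.2, a * s.2 + b * t.2).

Lemma bcV_span p x0 x1 y0 y1 : admissible p -> bcV p x0 x1 y0 y1 ->
  exists a b, (x0, x1, y0, y1) = comb a b (u_bvals p) (v_bvals p).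
Proof.
case: p => [C|c12 c22|c11|c12|] adm.
- by move=> /bcV1P[-> ->]; exists y0, y1; congr (_, _, _, _) => /=; ring.
- case: adm => c0 _ /= [/eqP + /eqP]; rewrite subr_eq subr_eq0 => /eqP -> /eqP ->.
  have c0' : c22^* != 0 by rewrite conjC_eq0.
  exists (c22^* * c12 * y1 + c22^* * x0), y1; rewrite /comb /=.
  by congr (_, _, _, _); [field|ring..].
- by move=> /= [-> ->]; exists x1, y0; rewrite /comb /=; congr (_, _, _, _); ring.
- by move=> /= [-> ->]; exists x0, y1; rewrite /comb /=; congr (_, _, _, _); ring.
- by move=> /= [-> ->]; exists x0, x1; rewrite /comb /=; congr (_, _, _, _); ring.
Qed.

Lemma bcV_indep p a b : comb a b (u_bvals p) (v_bvals p) = (0, 0, 0, 0) ->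
  a = 0 /\ b = 0.
Proof.
by case: p => [C|c12 c22|c11|c12|] /= [];
  rewrite ?(mulr0, mulr1, addr0, add0r) => e1 e2 e3 e4.
Qed.

(** In case (i), subtracting multiples of [u] and [v] leaves a vector of [W] with Gamma_1 = 0, which
    orthogonality to Gamma_1 of [u] and [v] kills. In (ii)-(iv) [u] itself has Gamma_1 = 0, so
    orthogonality to it first gives the condition on the derivatives, and the same subtraction then
    gives the other one. In (v) both [u] and [v] act in this first way. *)
Lemma bcV_max p W : admissible p -> nonneg_space W ->
  (forall x0 x1 y0 y1, bcV p x0 x1 y0 y1 -> W x0 x1 y0 y1) ->
  forall x0 x1 y0 y1, W x0 x1 y0 y1 -> bcV p x0 x1 y0 y1.
Proof.
move=> adm nW sub x0 x1 y0 y1 Wx.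
have Wu := sub _ _ _ _ (bcV_u adm); have Wv := sub _ _ _ _ (bcV_v p).
case: p adm sub Wu Wv => [C|c12 c22|c11|c12|] adm sub /= Wu Wv.
- have := nonneg_spaceB y1 nW (nonneg_spaceB y0 nW Wx Wu) Wv.
  rewrite !mulr1 !mulr0 !subr0 !subrr => Wp.
  have e0 := nonneg_space_orth nW Wp Wu; have e1 := nonneg_space_orth nW Wp Wv.
  rewrite mulr1 mulr0 in e0; rewrite mulr1 mulr0 in e1.
  move/eqP: e0; rewrite conjC_eq0 => /eqP e0.
  move/esym/eqP: e1; rewrite conjC_eq0 => /eqP e1.
  apply/bcV1P; split; apply/eqP; rewrite -subr_eq0.
    by rewrite -[X in _ == X]e0; apply/eqP; ring.
  by rewrite -[X in _ == X]e1; apply/eqP; ring.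
- have [c0 _] := adm; have c0' : c22^* != 0 by rewrite conjC_eq0.
  have := nonneg_space_orth nW Wu Wx.
  rewrite fmorphV /= conjCK rmorph1 mul1r => e.
  have y0E : y0 = c22 * y1 by rewrite -e mulVKf.
  have := nonneg_spaceB x1 nW (nonneg_spaceB y1 nW Wx Wv) Wu.
  rewrite y0E !mulr1 !mulr0 !subr0 [y1 * c22]mulrC !subrr => Wp.
  have := nonneg_space_orth nW Wp Wv; rewrite rmorph0 mul0r => /eqP.
  rewrite mulf_eq0 (negbTE c0) orbF conjC_eq0 => /eqP e0.
  split; last by [].
  apply/eqP; rewrite -subr_eq0 -[X in _ == X](mulr0 (- c22^*)) -e0; apply/eqP; field.
  exact: c0'.
- have /eqP := nonneg_space_orth nW Wu Wx.
  rewrite rmorph0 rmorph1 mul0r mul1r eq_sym => /eqP y10; split=> //.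
  have := nonneg_spaceB y0 nW (nonneg_spaceB x1 nW Wx Wu) Wv.
  rewrite y10 !mulr1 !mulr0 !subr0 !subrr => Wp.
  have /eqP := nonneg_space_orth nW Wp Wv.
  by rewrite mulr1 mulr0 conjC_eq0 subr_eq0 mulrC => /eqP.
- have /eqP := nonneg_space_orth nW Wu Wx.
  rewrite rmorph0 rmorph1 mul0r mul1r => /eqP y00; split=> //.
  have := nonneg_spaceB y1 nW (nonneg_spaceB x0 nW Wx Wu) Wv.
  rewrite y00 !mulr1 !mulr0 !subr0 !subrr => Wp.
  have /eqP := nonneg_space_orth nW Wp Wv.
  by rewrite mulr1 mulr0 eq_sym conjC_eq0 subr_eq0 mulrC => /eqP.
- have /eqP := nonneg_space_orth nW Wu Wx; have /eqP := nonneg_space_orth nW Wv Wx.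
  by rewrite rmorph0 rmorph1 !mul0r !mul1r eq_sym => /eqP -> /eqP ->.
Qed.


Lemma max_nonneg_bcV V : max_nonneg V -> exists2 p, admissible p &
  forall x0 x1 y0 y1, V x0 x1 y0 y1 <-> bcV p x0 x1 y0 y1.
Proof.
move=> mV; have [nV _] := mV.
(* Since [u] and [v] span [bcV p], their membership in [V] yields one of the two inclusions. *)
suff [p [adm Vu Vv sub]] : exists p, [/\ admissible p, tuple4 V (u_bvals p),
    tuple4 V (v_bvals p) & forall x0 x1 y0 y1, V x0 x1 y0 y1 -> bcV p x0 x1 y0 y1].
  exists p => // x0 x1 y0 y1; split; first exact: sub.
  move=> /(bcV_span adm)[a [b [-> -> -> ->]]].
  exact: nonneg_spaceZD nV a _ _ _ _ _ _ _ _ Vu (nonneg_spaceZ b nV Vv).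
(* Preimages of the standard basis under Gamma_1 + i Gamma_0. Up to sign, [a2 * b3 - a3 * b2] is the
   determinant of Gamma_1 on their span. *)
have [a0 [a1 [a2 [a3 [Va ea0 ea1]]]]] := max_nonneg_surj 1 0 mV.
have [b0 [b1 [b2 [b3 [Vb eb0 eb1]]]]] := max_nonneg_surj 0 1 mV.
have [d0|d0] := eqVneq (a2 * b3 - a3 * b2) 0; last first.
  pose d := a2 * b3 - a3 * b2.
  (* Cramer's rule: the columns are Gamma_0 of the combinations of [a] and [b] whose Gamma_1 is (1,
     0) and (0, 1). *)
  pose C : 'M[R[i]]_2 := \matrix_(i, j)
    if j == 0 then (if i == 0 then (b3 * a0 - a3 * b0) / d else (b3 * a1 - a3 * b1) / d)
    else (if i == 0 then (b2 * a0 - a2 * b0) / d else (b2 * a1 - a2 * b1) / d).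
  have Vu : tuple4 V (u_bvals (BC1 C)).
    rewrite /tuple4 /= !mxE /=.
    have := nonneg_spaceZD nV (b3 / d) Va (nonneg_spaceZ (- (a3 / d)) nV Vb).
    by congr V; rewrite /d; field.
  have Vv : tuple4 V (v_bvals (BC1 C)).
    rewrite /tuple4 /= !mxE /=.
    have := nonneg_spaceZD nV (- (b2 / d)) Va (nonneg_spaceZ (a2 / d) nV Vb).
    by congr V; rewrite /d; field.
  exists (BC1 C); split=> //.
    apply/psd_Im_mx_adjointP => a b.
    have := nonneg_space_ge0 nV (nonneg_spaceZD nV a Vu (nonneg_spaceZ (- b) nV Vv)).
    by congr (0 <= bform _ _ _ _); rewrite /=; ring.
  move=> x0 x1 y0 y1 Vx.
  have := nonneg_spaceB y1 nV (nonneg_spaceB y0 nV Vx Vu) Vv.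
  rewrite /= !mulr1 !mulr0 !subr0 !subrr => Vp.
  have e0 := nonneg_space_orth nV Vp Vu; have e1 := nonneg_space_orth nV Vp Vv.
  rewrite /= mulr1 mulr0 in e0; rewrite /= mulr1 mulr0 in e1.
  move/eqP: e0; rewrite conjC_eq0 => /eqP e0.
  move/esym/eqP: e1; rewrite conjC_eq0 => /eqP e1.
  apply/bcV1P; split; apply/eqP; rewrite -subr_eq0.
    by rewrite -[X in _ == X]e0; apply/eqP; ring.
  by rewrite -[X in _ == X]e1; apply/eqP; ring.
have [p0 [p1 [Vp pn]]] : exists p0 p1, V p0 p1 0 0 /\ ~ (p0 = 0 /\ p1 = 0).
  (* The combination is nonzero because Gamma_1 + i Gamma_0 sends it to [(u, v)]. *)
  have key u v : u * a2 + v * b2 = 0 -> u * a3 + v * b3 = 0 -> ~ (u = 0 /\ v = 0) ->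
      exists p0 p1, V p0 p1 0 0 /\ ~ (p0 = 0 /\ p1 = 0).
    move=> e2 e3 uv; exists (u * a0 + v * b0), (u * a1 + v * b1); split.
      by have := nonneg_spaceZD nV u Va (nonneg_spaceZ v nV Vb); rewrite e2 e3.
    move=> [q0 q1]; apply: uv; split.
      transitivity (u * (a2 + 'i * a0) + v * (b2 + 'i * b0)).
        by rewrite ea0 eb0 mulr1 mulr0 addr0.
      transitivity (u * a2 + v * b2 + 'i * (u * a0 + v * b0)); first by ring.
      by rewrite e2 q0 mulr0 addr0.
    transitivity (u * (- a3 + 'i * a1) + v * (- b3 + 'i * b1)).
      by rewrite ea1 eb1 mulr1 mulr0 add0r.
    transitivity (- (u * a3 + v * b3) + 'i * (u * a1 + v * b1)); first by ring.
    by rewrite e3 q1 mulr0 addr0 oppr0.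
  (* If [(a2, b2)] is nonzero, [(b2, - a2)] annihilates it and, the determinant being 0, also
     [(a3, b3)]; the roles may be exchanged, and if both rows vanish any coefficients do. *)
  have [h2|h2] := pselect (b2 = 0 /\ - a2 = 0); last first.
    apply: (key b2 (- a2)) => //; first by ring.
    by transitivity (- (a2 * b3 - a3 * b2)); [ring|rewrite d0 oppr0].
  have [h3|h3] := pselect (b3 = 0 /\ - a3 = 0); last first.
    by apply: (key b3 (- a3)) => //; [transitivity (a2 * b3 - a3 * b2); [ring|exact: d0]|ring].
  apply: (key 1 0); last by move=> [/eqP]; rewrite oner_eq0.
    by move: h2 => [_ /eqP]; rewrite oppr_eq0 => /eqP ->; rewrite mulr0 mul0r addr0.
  by move: h3 => [_ /eqP]; rewrite oppr_eq0 => /eqP ->; rewrite mulr0 mul0r addr0.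
have orth x0 x1 y0 y1 (Vx : V x0 x1 y0 y1) := nonneg_space_orth nV Vp Vx.
have [y_0|[z0 [z1 [w0 [w1 [Vz wn]]]]]] :
    (forall x0 x1 y0 y1, V x0 x1 y0 y1 -> y0 = 0 /\ y1 = 0) \/
    (exists x0 x1 y0 y1, V x0 x1 y0 y1 /\ ~ (y0 = 0 /\ y1 = 0)).
  have [?|H] := pselect (forall x0 x1 y0 y1, V x0 x1 y0 y1 -> y0 = 0 /\ y1 = 0); first by left.
  right; apply: contrapT => H'; apply: H => x0 x1 y0 y1 Vx; apply: contrapT => yn.
  by apply: H'; exists x0, x1, y0, y1.
(* With Gamma_1 = 0 on [V], surjectivity becomes that of i Gamma_0, so every [(x0, x1, 0, 0)] is in
   [V]. *)
- have full x0 x1 : V x0 x1 0 0.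
    have [t0 [t1 [s0 [s1 [Vt e0 e1]]]]] := max_nonneg_surj ('i * x0) ('i * x1) mV.
    have [s00 s10] := y_0 _ _ _ _ Vt; move: Vt e0 e1; rewrite s00 s10 oppr0 !add0r.
    by move=> Vt /(mulfI (neq0Ci _)) <- /(mulfI (neq0Ci _)) <-.
  exists (@BC5 R); split=> //.
(* Orthogonality reads conj(p0) y0 = conj(p1) y1. If [p0 = 0] it forces [y1 = 0], case (iii); if
   [p1 = 0] it forces [y0 = 0], case (iv); otherwise [y0] and [y1] are proportional, case (ii). *)
have [p00|p00] := eqVneq p0 0; last have [p10|p10] := eqVneq p1 0.
- have p10 : p1 != 0 by apply/eqP => p10; apply: pn.
  have y10 x0 x1 y0 y1 : V x0 x1 y0 y1 -> y1 = 0.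
    move=> /orth; rewrite p00 rmorph0 mul0r => /esym/eqP.
    by rewrite mulf_eq0 conjC_eq0 (negbTE p10) => /eqP.
  have w10 := y10 _ _ _ _ Vz.
  have w00 : w0 != 0 by apply/eqP => w00; apply: wn.
  have Vu : V 0 1 0 0.
    have := nonneg_spaceZ p1^-1 nV Vp; rewrite p00 !mulr0.
    by rewrite mulVf.
  have Vv : V (z0 / w0) 0 1 0.
    have := nonneg_spaceB (z1 / w0) nV (nonneg_spaceZ w0^-1 nV Vz) Vu.
    by rewrite w10 !mulr0 !mulr1 !subr0 mulVf// [w0^-1 * z1]mulrC subrr mulrC.
  exists (BC3 (z0 / w0)); split=> //.
    have := nonneg_space_ge0 nV Vv; rewrite /= /bform; congr (0 <= _).
    by rewrite mulr1 rmorph0 mul0r subr0.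
  move=> x0 x1 y0 y1 Vx; split; last exact: y10 Vx.
  have := nonneg_spaceB y0 nV (nonneg_spaceB x1 nV Vx Vu) Vv.
  rewrite (y10 _ _ _ _ Vx) !mulr1 !mulr0 !subr0 !subrr => Vq.
  have /eqP := nonneg_space_orth nV Vq Vv.
  by rewrite mulr1 mulr0 conjC_eq0 subr_eq0 mulrC => /eqP.
- have y00 x0 x1 y0 y1 : V x0 x1 y0 y1 -> y0 = 0.
    move=> /orth; rewrite p10 rmorph0 mul0r => /eqP.
    by rewrite mulf_eq0 conjC_eq0 (negbTE p00) => /eqP.
  have w00 := y00 _ _ _ _ Vz.
  have w10 : w1 != 0 by apply/eqP => w10; apply: wn.
  have Vu : V 1 0 0 0.
    have := nonneg_spaceZ p0^-1 nV Vp; rewrite p10 !mulr0.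
    by rewrite mulVf.
  have Vv : V 0 (z1 / w1) 0 1.
    have := nonneg_spaceB (z0 / w1) nV (nonneg_spaceZ w1^-1 nV Vz) Vu.
    by rewrite w00 !mulr0 !mulr1 !subr0 mulVf// [w1^-1 * z0]mulrC subrr mulrC.
  exists (BC4 (- (z1 / w1))); split=> //.
  + have := nonneg_space_ge0 nV Vv; rewrite /= /bform; congr (0 <= _).
    by rewrite mulr1 rmorph0 mul0r rmorphN /= sub0r.
  + by rewrite /tuple4 /= opprK.
  move=> x0 x1 y0 y1 Vx; split; last exact: y00 Vx.
  have := nonneg_spaceB y1 nV (nonneg_spaceB x0 nV Vx Vu) Vv.
  rewrite (y00 _ _ _ _ Vx) !mulr1 !mulr0 !subr0 !subrr => Vq.
  have /esym/eqP := nonneg_space_orth nV Vq Vv.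
  by rewrite mulr1 mulr0 conjC_eq0 subr_eq0 opprK mulrC => /eqP.
(* The ratio of [y0] to [y1] imposed by orthogonality; dividing [p] by [p1] gives the [u] of case
   (ii). *)
- pose c := p1^* / p0^*.
  have p00' : p0^* != 0 by rewrite conjC_eq0.
  have p10' : p1^* != 0 by rewrite conjC_eq0.
  have c0 : c != 0 by rewrite mulf_neq0// invr_eq0.
  have cc : c^* = p1 / p0 by rewrite rmorphM fmorphV /= !conjCK.
  have y0E x0 x1 y0 y1 : V x0 x1 y0 y1 -> y0 = c * y1.
    by move=> /orth e; rewrite /c mulrAC -e mulrAC mulfV// mul1r.
  have w10 : w1 != 0.
    by apply/eqP => w10; apply: wn; rewrite (y0E _ _ _ _ Vz) w10 mulr0.
  have Vu : V (c^*)^-1 1 0 0.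
    have := nonneg_spaceZ p1^-1 nV Vp; rewrite !mulr0 mulVf//.
    by rewrite cc invfM invrK mulrC.
  have Vv : exists d, V (- d) 0 c 1.
    exists (- (w1^-1 * z0 - z1 / w1 * (c^*)^-1)).
    have := nonneg_spaceB (z1 / w1) nV (nonneg_spaceZ w1^-1 nV Vz) Vu.
    rewrite opprK (y0E _ _ _ _ Vz) !mulr0 !mulr1 !subr0 mulVf//.
    by rewrite [w1^-1 * z1]mulrC subrr mulrCA mulVf// mulr1.
  move: Vv => [d Vv]; exists (BC2 d c); split=> //.
    split=> //; have := nonneg_space_ge0 nV Vv; rewrite bformE !cpartsE.
    by congr (0 <= _); rewrite ?(mulr0, mulr1, mul0r, subr0); ring.
  move=> x0 x1 y0 y1 Vx.
  have y0e := y0E _ _ _ _ Vx; split; last by rewrite y0e subrr.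
  have := nonneg_spaceB x1 nV (nonneg_spaceB y1 nV Vx Vv) Vu.
  rewrite y0e !mulr1 !mulr0 !subr0 [y1 * c]mulrC !subrr => Vq.
  have := nonneg_space_orth nV Vq Vv; rewrite rmorph0 mul0r => /eqP.
  rewrite mulf_eq0 (negbTE c0) orbF conjC_eq0 => /eqP e0.
  have c0' : c^* != 0 by rewrite conjC_eq0.
  apply/eqP; rewrite -subr_eq0 -[X in _ == X](mulr0 (- c^*)) -e0; apply/eqP; field.
  exact: c0'.
Qed.


(** These three bits record the position of the vectors with Gamma_1 = 0 relative to the axes; their
    patterns in the five cases are pairwise different. *)
Let has10 k := match k with Case4 | Case5 => true | _ => false end.
Let has01 k := match k with Case3 | Case5 => true | _ => false end.
Let has1x k := match k with Case2 | Case4 | Case5 => true | _ => false end.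

Lemma bcV_case_invariants p : admissible p ->
  [/\ bcV p 1 0 0 0 <-> has10 (case_of p), bcV p 0 1 0 0 <-> has01 (case_of p) &
      (exists c, bcV p 1 c 0 0) <-> has1x (case_of p)].
Proof.
have n10 : (1 : R[i]) <> 0 by apply/eqP; exact: oner_neq0.
case: p => [C|c12 c22|c11|c12|] adm.
- have v1 x0 x1 : bcV (BC1 C) x0 x1 0 0 -> x0 = 0 /\ x1 = 0.
    by move=> /bcV1P[-> ->]; rewrite !mulr0 subrr.
  split; split=> //; first by move=> /v1[].
    by move=> /v1[].
  by move=> [c /v1[]].
- case: adm => c0 _; split; split=> //.
  + move=> [/eqP]; rewrite mulr1 mulr0 sub0r oppr_eq0 conjC_eq0.
    by rewrite (negbTE c0).
  + by move=> [/eqP]; rewrite !mulr0 subr0 => /eqP.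
  + by move=> _; exists c22^*; rewrite /= mulr1 !mulr0 !subrr.
- split; split=> //.
  + by move=> [/eqP]; rewrite mulr0 => /eqP.
  + by rewrite /= mulr0.
  + by move=> [c [/eqP]]; rewrite mulr0 => /eqP.
- split; split=> //.
  + by rewrite /= mulr0.
  + by move=> [/eqP]; rewrite mulr0 => /eqP.
  + by move=> _; exists 0; rewrite /= mulr0.
- by split; split=> //; exists 0.
Qed.

Lemma bcV_case p q : admissible p -> admissible q ->
  (forall x0 x1 y0 y1, bcV p x0 x1 y0 y1 <-> bcV q x0 x1 y0 y1) ->
  case_of p = case_of q.
Proof.
move=> /bcV_case_invariants[p1 p2 p3] /bcV_case_invariants[q1 q2 q3] E.
have e1 : has10 (case_of p) = has10 (case_of q).
  by apply/idP/idP => [/p1.2 /E /q1.1|/q1.2 /E /p1.1].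
have e2 : has01 (case_of p) = has01 (case_of q).
  by apply/idP/idP => [/p2.2 /E /q2.1|/q2.2 /E /p2.1].
have e3 : has1x (case_of p) = has1x (case_of q).
  by apply/idP/idP => [/p3.2[c /E H]|/q3.2[c /E H]]; [apply/q3|apply/p3]; exists c.
by move: e1 e2 e3; case: (case_of p); case: (case_of q).
Qed.

End BoundarySpaces.

(** * Abstract second-order operators *)

Section Model.
Context {R : realType} (V : lmodType R[i]) (ip : V -> V -> R[i]) (e : V) (J : V -> V)
  (W : V -> Prop) (N : V -> V) (B : V -> R[i] * R[i] * R[i] * R[i]).

Definition second_primitive (a b : R[i]) (h : V) : V := a *: e + J (b *: e + J h).

Definition boundary_trace (a b : R[i]) (h : V) :=
  (a, a + ip e (b *: e + J h), b, b + ip e h).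

(* All that is used about L^2(0,1): e is the constant function 1, J integrates
   from 0, and N is f |-> - f'' on W = H^2(0,1), with boundary values B. *)
Record second_order_model : Prop := SecondOrderModel {
  ip_linear : forall f c g h, ip f (c *: g + h) = c * ip f g + ip f h;
  ip_conj : forall f g, ip g f = (ip f g)^*;
  ip_eq0 : forall f, ip f f = 0 -> f = 0;
  ip_ee : ip e e = 1;
  J_linear : forall c f g, J (c *: f + g) = c *: J f + J g;
  J_ibp : forall f g, ip (J f) g + ip f (J g) = (ip e f)^* * ip e g;
  J_inj : forall c g, c *: e + J g = 0 -> c = 0 /\ g = 0;
  model_domP : forall f, W f <-> exists a b h, f = second_primitive a b h;
  model_opE : forall a b h, N (second_primitive a b h) = - h;
  model_traceE : forall a b h, B (second_primitive a b h) = boundary_trace a b h }.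

End Model.

Section SecondOrderModel.
Context {R : realType} (V : lmodType R[i]) (ip : V -> V -> R[i]) (e : V) (J : V -> V)
  (W : V -> Prop) (N : V -> V) (B : V -> R[i] * R[i] * R[i] * R[i])
  (M : second_order_model ip e J W N B).
Local Notation H2 := (second_primitive e J).
Local Notation trace := (boundary_trace ip e J).
Let ip_linear := ip_linear M.
Let ip_conj := ip_conj M.
Let ip_eq0 := ip_eq0 M.
Let ip_ee := ip_ee M.
Let J_linear := J_linear M.
Let J_ibp := J_ibp M.
Let J_inj := J_inj M.
Let model_domP := model_domP M.
Let model_opE := model_opE M.
Let model_traceE := model_traceE M.
Implicit Types (f g h : V) (a b c : R[i]).

Lemma ipDr f g h : ip f (g + h) = ip f g + ip f h.
Proof. by have := ip_linear f 1 g h; rewrite scale1r mul1r. Qed.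

Lemma ip0r f : ip f 0 = 0.
Proof. by apply: (addrI (ip f 0)); rewrite -ipDr !addr0. Qed.

Lemma ipZr c f g : ip f (c *: g) = c * ip f g.
Proof. by have := ip_linear f c g 0; rewrite ip0r !addr0. Qed.

Lemma ipNr f g : ip f (- g) = - ip f g.
Proof. by rewrite -scaleN1r ipZr mulN1r. Qed.

Lemma ipDl f g h : ip (f + g) h = ip f h + ip g h.
Proof. by rewrite ip_conj ipDr rmorphD /= -!ip_conj. Qed.

Lemma ipZl c f g : ip (c *: f) g = c^* * ip f g.
Proof. by rewrite ip_conj ipZr rmorphM /= -ip_conj. Qed.

Lemma ip0l f : ip 0 f = 0.
Proof. by rewrite ip_conj ip0r rmorph0. Qed.

Lemma ipNl f g : ip (- f) g = - ip f g.
Proof. by rewrite ip_conj ipNr rmorphN /= -ip_conj. Qed.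

Definition ipE := (ipDr, ipZr, ipNr, ip0r, ipDl, ipZl, ipNl, ip0l).

Lemma JD f g : J (f + g) = J f + J g.
Proof. by have := J_linear 1 f g; rewrite !scale1r. Qed.

Lemma J0 : J 0 = 0.
Proof. by apply: (addrI (J 0)); rewrite -JD !addr0. Qed.

Lemma JZ c f : J (c *: f) = c *: J f.
Proof. by have := J_linear c f 0; rewrite J0 !addr0. Qed.

Lemma JN f : J (- f) = - J f.
Proof. by rewrite -[- f]scaleN1r JZ scaleN1r. Qed.

(* Up to sign this is the Gram determinant of e and J e. *)
Lemma moment_det_neq0 : ip e (J (J e)) - ip e (J e) * ip e (J e) != 0.
Proof.
have e1 := J_ibp e e; have e2 := J_ibp e (J e).
rewrite ip_ee rmorph1 mulr1 ip_conj in e1.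
rewrite ip_ee rmorph1 mul1r in e2.
apply/eqP => d0.
have w0 : J e - ip e (J e) *: e = 0.
  apply: ip_eq0; rewrite !ipE ip_ee [ip (J _) e]ip_conj.
  move: e1 e2 d0; move: (ip (J e) (J e)) (ip e (J (J e))) (ip e (J e)) => n t2 t e1 e2 d0.
  have {e1}-> : t^* = 1 - t by rewrite -e1 addrK.
  have -> : n = t - t2 by rewrite -e2 addrK.
  have -> : t2 = t * t by apply/eqP; rewrite -subr_eq0 d0.
  by ring.
have := @J_inj (- ip e (J e)) e.
rewrite scaleNr addrC => /(_ w0)[_ o0].
by have := ip_ee; rewrite o0 ip0l => /esym/eqP; rewrite oner_eq0.
Qed.

Lemma solve_moments (t1 t2 m0 m1 : R[i]) : t2 - t1 * t1 != 0 ->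
  exists p q, p + q * t1 = m0 /\ p * t1 + q * t2 = m1.
Proof.
move=> d0; exists (m0 - (m1 - t1 * m0) / (t2 - t1 * t1) * t1),
  ((m1 - t1 * m0) / (t2 - t1 * t1)).
by split; [ring|field].
Qed.

(** f'(1) and f(1) depend on [h] only through these two moments, which the affine functions already
    realise freely. This gives the surjectivity of the boundary values and the projection in
    [adjoint_regularity]. *)
Lemma moments (m0 m1 : R[i]) : exists p q : R[i],
  ip e (p *: e + q *: J e) = m0 /\ ip e (J (p *: e + q *: J e)) = m1.
Proof.
have [p [q [e0 e1]]] := solve_moments m0 m1 moment_det_neq0.
by exists p, q; rewrite JD !JZ !ipE ip_ee mulr1.
Qed.

Lemma second_primitive_linear c a b h a' b' h' :
  c *: H2 a b h + H2 a' b' h' = H2 (c * a + a') (c * b + b') (c *: h + h').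
Proof.
have dist (x y z w : V) : c *: (x + y) + (z + w) = (c *: x + z) + (c *: y + w).
  by rewrite scalerDr addrACA.
by rewrite /second_primitive dist -J_linear dist -J_linear !scalerA -!scalerDl.
Qed.

Lemma trace_linear c a b h a' b' h' :
  let s := trace a b h in let t := trace a' b' h' in
  trace (c * a + a') (c * b + b') (c *: h + h') =
  (c * s.1.1.1 + t.1.1.1, c * s.1.1.2 + t.1.1.2, c * s.1.2 + t.1.2, c * s.2 + t.2).
Proof. by rewrite /boundary_trace /= J_linear !ipE ip_ee; congr (_, _, _, _); ring. Qed.

Lemma trace_surj (x0 x1 y0 y1 : R[i]) : exists h, trace x0 y0 h = (x0, x1, y0, y1).
Proof.
have [p [q [m0 m1]]] := moments (y1 - y0) (x1 - x0 - y0).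
exists (p *: e + q *: J e); rewrite /boundary_trace ipDr ipZr ip_ee m0 m1.
by congr (_, _, _, _); ring.
Qed.

(** For F = a + J f and G = b + J g the right side is conj F(1) G(1) - conj F(0) G(0). *)
Lemma affine_ibp a b f g :
  ip (a *: e + J f) g + ip f (b *: e + J g) =
  (a + ip e f)^* * (b + ip e g) - a^* * b.
Proof.
rewrite !ipE [ip f e]ip_conj.
transitivity (a^* * ip e g + b * (ip e f)^* + (ip (J f) g + ip f (J g))).
  by ring.
by rewrite J_ibp rmorphD /=; ring.
Qed.

Lemma green_identity a b h a' b' h' :
  let: (f0, f1, df0, df1) := trace a b h in
  let: (g0, g1, dg0, dg1) := trace a' b' h' in
  ip (H2 a b h) (- h') - ip (- h) (H2 a' b' h') =
  f0^* * dg0 - f1^* * dg1 - (df0^* * g0 - df1^* * g1).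
Proof.
rewrite /boundary_trace ipNl ipNr opprK.
have e1 := affine_ibp a b' (b *: e + J h) h'.
have e2 := affine_ibp b a' h (b' *: e + J h').
rewrite -/(H2 a b h) in e1; rewrite -/(H2 a' b' h') in e2.
transitivity ((ip (b *: e + J h) (b' *: e + J h') + ip h (H2 a' b' h')) -
  (ip (H2 a b h) h' + ip (b *: e + J h) (b' *: e + J h'))); first by ring.
by rewrite e1 e2; ring.
Qed.

(** One integration by parts suffices: besides boundary terms it leaves <f', f'>, which is real. *)
Lemma green_self a b h : Im (ip (H2 a b h) (- h)) =
  bform a (a + ip e (b *: e + J h)) b (b + ip e h).
Proof.
have f'r : Im (ip (b *: e + J h) (b *: e + J h)) = 0.
  have := ImJ (ip (b *: e + J h) (b *: e + J h)); rewrite -ip_conj.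
  by move=> /eqP; rewrite -addr_eq0 -mulr2n mulrn_eq0 /= => /eqP.
have /(congr1 (@complex.Im R)) := affine_ibp a b (b *: e + J h) h.
rewrite -/(H2 a b h) ipNr /bform !(ImD, ImN) f'r addr0 => ->.
by rewrite opprB.
Qed.

(** [k = y + J (J z)] is orthogonal to every [h] with both moments zero. Removing from [k] the
    combination of [e] and [J e] with the same moments leaves such an [h]; it is orthogonal to [k]
    and to that combination, hence to itself. *)
Lemma adjoint_regularity (y z : V) :
  (forall h, ip e h = 0 -> ip e (J h) = 0 -> ip y (- h) = ip z (J (J h))) ->
  exists p q, y = H2 p q (- z).
Proof.
move=> yz; pose k := y + J (J z).
have kh h : ip e h = 0 -> ip e (J h) = 0 -> ip k h = 0.
  move=> h0 h1; have := yz h h0 h1.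
  have i1 := J_ibp z (J h); have i2 := J_ibp (J z) h.
  rewrite h1 mulr0 in i1; rewrite h0 mulr0 in i2.
  rewrite ipNr /k ipDl; move: i1 i2.
  move: (ip y h) (ip (J (J z)) h) (ip (J z) (J h)) (ip z (J (J h))) => p q r s i1 i2 ps.
  by rewrite -[p]opprK ps -[q](addrK r) i2 sub0r -[s](addKr r) i1 addr0 opprK addrN.
have [p [q [m0 m1]]] := moments (ip e k) (ip e (J k)).
pose h0 := p *: e + q *: J e; pose h := k - h0.
rewrite -/h0 in m0 m1.
have eh : ip e h = 0 by rewrite /h ipDr ipNr m0 subrr.
have eJh : ip e (J h) = 0 by rewrite /h JD JN ipDr ipNr m1 subrr.
have h00 : ip h0 h = 0.
  have := J_ibp e h; rewrite eh eJh mulr0 addr0 => i.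
  by rewrite /h0 !ipDl !ipZl eh i !mulr0 addr0.
have : h = 0 by apply: ip_eq0; rewrite {1}/h ipDl ipNl kh// h00 subrr.
move/eqP; rewrite subr_eq0 => /eqP kE.
exists p, q; rewrite /second_primitive JD JZ JN JN addrA -/h0 -kE.
by rewrite addrK.
Qed.


Lemma domain0 : W 0.
Proof. by apply/model_domP; exists 0, 0, 0; rewrite /second_primitive !scale0r J0 addr0 J0 addr0. Qed.

Lemma domain_linear c f g : W f -> W g -> W (c *: f + g).
Proof.
move=> /model_domP[a [b [h ->]]] /model_domP[a' [b' [h' ->]]]; rewrite second_primitive_linear.
by apply/model_domP; exists (c * a + a'), (c * b + b'), (c *: h + h').
Qed.

Lemma operator_linear c f g : W f -> W g -> N (c *: f + g) = c *: N f + N g.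
Proof.
move=> /model_domP[a [b [h ->]]] /model_domP[a' [b' [h' ->]]].
by rewrite second_primitive_linear !model_opE scalerN opprD.
Qed.

Lemma boundary_linear c f g : W f -> W g -> B (c *: f + g) =
  (c * (B f).1.1.1 + (B g).1.1.1, c * (B f).1.1.2 + (B g).1.1.2,
   c * (B f).1.2 + (B g).1.2, c * (B f).2 + (B g).2).
Proof.
move=> /model_domP[a [b [h ->]]] /model_domP[a' [b' [h' ->]]].
by rewrite second_primitive_linear !model_traceE trace_linear.
Qed.

Lemma boundary_surj t : exists2 f, W f & B f = t.
Proof.
case: t => [[[x0 x1] y0] y1]; have [h ht] := trace_surj x0 x1 y0 y1.
by exists (H2 x0 y0 h); [apply/model_domP; exists x0, y0, h|rewrite model_traceE].
Qed.

Lemma green_min f g : W f -> W g -> B f = (0, 0, 0, 0) -> ip g (N f) = ip (N g) f.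
Proof.
move=> /model_domP[a [b [h ->]]] /model_domP[a' [b' [h' ->]]]; rewrite model_traceE !model_opE.
have := green_identity a' b' h' a b h; rewrite /boundary_trace.
move=> + [a0 e1 b0 e2]; rewrite e1 e2 a0 b0 !mulr0 !subrr => /eqP.
by rewrite subr_eq0 => /eqP.
Qed.

Lemma green_bform f : W f ->
  Im (ip f (N f)) = bform (B f).1.1.1 (B f).1.1.2 (B f).1.2 (B f).2.
Proof. by move=> /model_domP[a [b [h ->]]]; rewrite model_traceE model_opE green_self. Qed.

Lemma min_domP f : W f /\ B f = (0, 0, 0, 0) <->
  exists h, [/\ f = J (J h), ip e h = 0 & ip e (J h) = 0].
Proof.
have H00 h : J (J h) = H2 0 0 h by rewrite /second_primitive !scale0r !add0r.
split=> [[/model_domP[a [b [h ->]]]]|[h [-> h0 h1]]].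
  rewrite model_traceE /boundary_trace => -[a0 e1 b0 e2]; exists h; rewrite H00 a0 b0.
  by move: e1 e2; rewrite a0 b0 scale0r !add0r.
split; first by apply/model_domP; exists 0, 0, h.
by rewrite H00 model_traceE /boundary_trace scale0r !add0r h0 h1.
Qed.

Lemma adjoint_min y z :
  (forall x, W x /\ B x = (0, 0, 0, 0) -> ip y (N x) = ip z x) -> W y /\ z = N y.
Proof.
move=> yz.
have [p [q ->]] : exists p q, y = H2 p q (- z).
  apply: adjoint_regularity => h h0 h1.
  have H00 : J (J h) = H2 0 0 h by rewrite /second_primitive !scale0r !add0r.
  by rewrite -(model_opE 0 0) -H00; apply: yz; apply/min_domP; exists h.
by split; [apply/model_domP; exists p, q, (- z)|rewrite model_opE opprK].
Qed.

(* Expanding Im <z f + g, T (z f + g)> >= 0 in the scalar z kills the term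
   <f, T g> - <S f, g>, which is linear in z. *)
Lemma dissipative_extension (D : V -> Prop) (T : V -> V) :
  (forall c f g, D f -> D g -> D (c *: f + g) /\ T (c *: f + g) = c *: T f + T g) ->
  (forall f, D f -> 0 <= Im (ip f (T f))) ->
  (forall f, W f /\ B f = (0, 0, 0, 0) -> D f /\ T f = N f) ->
  forall g, D g -> W g /\ T g = N g.
Proof.
move=> linT posT extT g Dg; apply: adjoint_min => f minf.
have [Df Tf] := extT f minf; have [Wf Bf] := minf.
have real_f : Im (ip f (N f)) = 0.
  rewrite green_bform// Bf /bform /=.
  by rewrite !mulr0 subrr.
suff : ip f (T g) - ip (N f) g = 0.
  move/eqP; rewrite subr_eq0 => /eqP E.
  by rewrite ip_conj -E -ip_conj.
apply: (@ImM_ge0_eq0 _ (Im (ip g (T g)))) => z.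
(* The inner product is conjugate-linear in its first slot, so the conjugate makes the cross term
   linear in [z]; the term in |z|^2 drops out because <f, S f> is real. *)
have [Dz Tz] := linT z^* f g Df Dg.
have := posT _ Dz; rewrite Tz Tf !ipE conjCK [ip g (N f)]ip_conj.
move: (ip g (T g)) (ip f (T g)) (ip (N f) g) (ip f (N f)) real_f => u v w r r0.
by rewrite !cpartsE r0; congr (0 <= _); ring.
Qed.

Lemma trace_space_nonneg (D : V -> Prop) (T : V -> V) : D 0 ->
  (forall c f g, D f -> D g -> D (c *: f + g) /\ T (c *: f + g) = c *: T f + T g) ->
  (forall f, D f -> 0 <= Im (ip f (T f))) ->
  (forall f, D f -> W f /\ T f = N f) ->
  nonneg_space (fun x0 x1 y0 y1 : R[i] => exists2 f, D f & B f = (x0, x1, y0, y1)).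
Proof.
move=> D0 linT posT TN; split.
- exists 0 => //; have W0 : W 0 by have [] := TN 0 D0.
  have := boundary_linear (-1) W0 W0; rewrite scaler0 addr0 => ->.
  by rewrite !mulN1r !addNr.
- move=> c x0 x1 y0 y1 z0 z1 w0 w1 [f Df Bf] [g Dg Bg].
  have [Wf _] := TN f Df; have [Wg _] := TN g Dg.
  exists (c *: f + g); first by have [] := linT c f g Df Dg.
  by rewrite boundary_linear// Bf Bg.
- move=> x0 x1 y0 y1 [f Df Bf]; have [Wf Tf] := TN f Df.
  by have := posT f Df; rewrite Tf green_bform// Bf.
Qed.

Lemma restriction_dissipative (U : boundary_space (R := R)) : nonneg_space U ->
  let D f := W f /\ tuple4 U (B f) in
  [/\ D 0, forall c f g, D f -> D g ->
        D (c *: f + g) /\ N (c *: f + g) = c *: N f + N g &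
      forall f, D f -> 0 <= Im (ip f (N f))].
Proof.
move=> nU D; split.
- have W0 := domain0.
  split=> //; have := boundary_linear (-1) W0 W0; rewrite scaler0 addr0 => ->.
  by rewrite /tuple4 /= !mulN1r !addNr; exact: nonneg_space0.
- move=> c f g [Wf Uf] [Wg Ug]; split; last exact: operator_linear.
  split; first exact: domain_linear.
  by rewrite boundary_linear//; exact: nonneg_spaceZD.
- by move=> f [Wf Uf]; rewrite green_bform//; apply: (nonneg_space_ge0 nU); exact: Uf.
Qed.

(** [B] is onto C^4 and its kernel is D(S), so a basis of the boundary space lifts to a basis modulo
    D(S): any preimages of [s] and [t] serve. *)
Lemma span_decomposition (U : boundary_space (R := R)) (s t : R[i] * R[i] * R[i] * R[i]) :
  nonneg_space U -> tuple4 U s -> tuple4 U t ->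
  (forall x, tuple4 U x -> exists a b, x = comb a b s t) ->
  (forall a b, comb a b s t = (0, 0, 0, 0) -> a = 0 /\ b = 0) ->
  exists u v, [/\ W u /\ W v,
    forall a b, W (a *: u + b *: v) /\ B (a *: u + b *: v) = (0, 0, 0, 0) -> a = 0 /\ b = 0,
    forall f, W f /\ tuple4 U (B f) <-> exists2 g, W g /\ B g = (0, 0, 0, 0) &
      exists2 h, (exists a b, h = a *: u + b *: v) & f = g + h,
    B u = s & B v = t].
Proof.
move=> nU Us Ut span indep.
have [u Wu Bu] := boundary_surj s; have [v Wv Bv] := boundary_surj t.
have W0 := domain0.
have B0 : B 0 = (0, 0, 0, 0).
  have := boundary_linear (-1) W0 W0; rewrite scaler0 addr0 => ->.
  by rewrite !mulN1r !addNr.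
have WZ c f : W f -> W (c *: f) by move=> Wf; have := domain_linear c Wf W0; rewrite addr0.
have Wc a b : W (a *: u + b *: v) by apply: domain_linear => //; exact: WZ.
have Bc a b : B (a *: u + b *: v) = comb a b s t.
  rewrite boundary_linear//; last exact: WZ.
  rewrite Bu -[b *: v]addr0 boundary_linear// B0 Bv /comb /=.
  by rewrite !addr0.
exists u, v; split=> //.
- by move=> a b [_]; rewrite Bc; exact: indep.
- move=> f; split=> [[Wf Uf]|[g [Wg Bg] [h [a [b ->]] ->]]].
    have [a [b Bf]] := span _ Uf.
    exists (-1 *: (a *: u + b *: v) + f).
      split; first exact: domain_linear.
      rewrite boundary_linear// Bc Bf /=; by rewrite !mulN1r !addNr.
    exists (a *: u + b *: v); first by exists a, b.
    by rewrite scaleN1r addrC addrA subrr add0r.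
  rewrite -[g]scale1r; split; first exact: domain_linear.
  rewrite boundary_linear// Bg Bc /tuple4 /= !mulr0 !add0r.
  have := nonneg_spaceZD nU a Us (nonneg_spaceZ b nU Ut).
  by [].
Qed.

End SecondOrderModel.

(** * Dissipative extensions of the minimal Laplacian *)

Section Extensions.
Context {R : realType}.
Implicit Types (f g h : L2 R) (T : operator R) (U : @boundary_space R).
Local Notation S := (minimal_laplacian R).

Lemma L2_model : @second_order_model R (L2 R) (@inner R) L2one (@L2prim R)
  (@H2_01 R) (@neg_laplace R) (@bvals R).
Proof.
split; [exact: inner_linear|exact: inner_conj|exact: inner_eq0|exact: inner_L2one_L2one
  |exact: L2prim_linear|exact: L2prim_ibp|exact: affine_eq0|exact: H2_P
  |exact: neg_laplace_H2fun|exact: bvals_H2fun].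
Qed.

(** Every extension of S inherits from here the dense domain that dissipativity demands. *)
Lemma minimal_dense : densely_defined S.
Proof.
move=> f r r0; have [h [h0 h1 fh]] := dense_H20 f r0.
by exists (L2prim (L2prim h)) => //; apply/(min_domP L2_model); exists h.
Qed.

Lemma adjoint_minimal_dom : dom (adjoint S) = H2_01.
Proof.
apply/seteqP; split=> y.
  by move=> [z /(adjoint_min L2_model)[]].
move=> Hy; exists (neg_laplace y) => x [Hx x0].
exact: (green_min L2_model Hx Hy x0).
Qed.

Lemma adjoint_minimalE f : H2_01 f -> adjoint S f = neg_laplace f.
Proof.
move=> Hf.
rewrite -[adjoint S f]/(xget 0 [set z | forall x, dom S x -> inner f (S x) = inner z x]).
case: xgetP => [z _ /(adjoint_min L2_model)[_ //]|nz].
case: (nz (neg_laplace f)) => x [Hx x0].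
exact: (green_min L2_model Hx Hf x0).
Qed.

Lemma dissipative_extension_H2 T : dissipative T -> extends S T ->
  forall f, dom T f -> H2_01 f /\ T f = neg_laplace f.
Proof.
move=> [[_ linT] _ posT] [ST ST'].
apply: (dissipative_extension L2_model) => //.
by move=> f Sf; split; [exact: ST|exact: ST'].
Qed.

Definition trace_space T : @boundary_space R :=
  fun x0 x1 y0 y1 => exists2 f, dom T f & bvals f = (x0, x1, y0, y1).

(** Two functions with equal boundary values differ by an element of D(S), which lies in the domain
    of [T]; so the trace space determines the domain. *)
Lemma trace_spaceP T : dissipative T -> extends S T ->
  forall f, dom T f <-> H2_01 f /\ tuple4 (trace_space T) (bvals f).
Proof.
move=> dT eT f; have TN := dissipative_extension_H2 dT eT.
split=> [Tf|[Hf [g Tg gf]]].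
  split; first by have [] := TN f Tf.
  by exists f => //; case: (bvals f) => [[[]]].
have [Hg _] := TN g Tg; have [[_ linT] _ _] := dT.
have Sfg : dom S (-1 *: g + f).
  split; first exact: (domain_linear L2_model).
  rewrite (boundary_linear L2_model (-1) Hg Hf) gf.
  by case: (bvals f) => [[[a b] c] d] /=; rewrite !mulN1r !addNr.
have Tfg := eT.1 _ Sfg.
have [+ _] := linT 1 _ _ Tfg Tg.
by rewrite scale1r scaleN1r addrAC addNr add0r.
Qed.

Lemma trace_space_nonnegative T : dissipative T -> extends S T ->
  nonneg_space (trace_space T).
Proof.
move=> dT eT; have TN := dissipative_extension_H2 dT eT.
have [[T0 linT] _ posT] := dT.
exact: (trace_space_nonneg L2_model T0 linT posT TN).
Qed.

Lemma restriction_is_dissipative U T : nonneg_space U ->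
  (forall f, dom T f <-> H2_01 f /\ tuple4 U (bvals f)) ->
  (forall f, dom T f -> T f = neg_laplace f) ->
  dissipative T /\ extends S T.
Proof.
move=> nU TU TN; have [D0 Dlin Dpos] := restriction_dissipative L2_model nU.
have eT : extends S T.
  have sub : dom S `<=` dom T.
    move=> f [Hf f0]; apply/TU; split=> //; rewrite f0; exact: nonneg_space0.
  by split=> // f Sf; rewrite TN//; exact: sub.
split=> //; split.
- split; first exact/TU.
  move=> a f g Tf Tg; have [Dfg Nfg] := Dlin a f g ((TU f).1 Tf) ((TU g).1 Tg).
  have Tfg := (TU _).2 Dfg.
  by split=> //; rewrite (TN _ Tfg) Nfg (TN _ Tf) (TN _ Tg).
- move=> f r r0; have [g Sg fg] := minimal_dense f r0.
  by exists g => //; exact: eT.1.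
- by move=> f Tf; rewrite TN//; apply: Dpos; exact/TU.
Qed.

(** A larger nonnegative space [W] defines a dissipative extension of [T]; maximality sends it back
    into [T], and surjectivity of the boundary values carries this down to C^4. *)
Lemma maximal_trace_space T : maximally_dissipative T -> extends S T ->
  max_nonneg (trace_space T).
Proof.
move=> [dT mT] eT; have TN := dissipative_extension_H2 dT eT.
have TU := trace_spaceP dT eT.
split; first exact: trace_space_nonnegative.
move=> W nW TW x0 x1 y0 y1 Wx.
pose T' := @Operator R [set f | H2_01 f /\ tuple4 W (bvals f)] (@neg_laplace R).
have [dT' eT'] : dissipative T' /\ extends S T'.
  exact: (@restriction_is_dissipative W).
have TT' : extends T T'.
  split=> [f /TU[Hf Uf]|f Tf]; last by have [_ ->] := TN f Tf.
  by split=> //; exact: TW.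
have [sub _] := mT T' dT' TT'.
have [f Hf fx] := boundary_surj L2_model (x0, x1, y0, y1).
exists f => //; apply: sub; split=> //; rewrite fx; exact: Wx.
Qed.

Lemma bc_domP (p : bc R) f : bc_dom p f <-> H2_01 f /\ tuple4 (bcV p) (bvals f).
Proof.
rewrite /bc_dom /tuple4 /=; case: (bvals f) => [[[a b] c] d].
by case: p.
Qed.

(** Every vector of C^4 is the boundary value of some H^2 function, so the domain remembers the
    whole subspace. *)
Lemma bc_dom_inj (p q : bc R) : bc_dom p = bc_dom q ->
  forall x0 x1 y0 y1, bcV p x0 x1 y0 y1 <-> bcV q x0 x1 y0 y1.
Proof.
move=> pq x0 x1 y0 y1.
have [f Hf fx] := boundary_surj L2_model (x0, x1, y0, y1).
have := bc_domP p f; have := bc_domP q f; rewrite pq fx /tuple4 /=.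
by move=> Q P; split=> H; [have := Q.1 (P.2 (conj Hf H))|have := P.1 (Q.2 (conj Hf H))]; case.
Qed.

Lemma maximal_extension_bc T : maximally_dissipative T -> extends S T ->
  exists2 p, admissible p & dom T = bc_dom p.
Proof.
move=> mT eT; have [p ap TV] := max_nonneg_bcV (maximal_trace_space mT eT).
exists p => //; have TU := trace_spaceP mT.1 eT.
by apply/seteqP; split=> f; [move=> /TU[Hf /TV Vf]; exact/bc_domP
  |move=> /bc_domP[Hf /TV Vf]; exact/TU].
Qed.

Lemma maximal_extension_case T : maximally_dissipative T -> extends S T ->
  exists! k : bc_case, belongs_to T k.
Proof.
move=> mT eT; have [p ap Tp] := maximal_extension_bc mT eT.
exists (case_of p); split; first by exists p.
move=> k [q [<- aq Tq]]; apply: bcV_case => //; apply: bc_dom_inj.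
by rewrite -Tp.
Qed.

Lemma bc_dom_decomposition (p : bc R) : admissible p ->
  exists u v : L2 R, [/\ H2_01 u /\ H2_01 v, lin_indep_mod (dom S) u v,
    direct_sum (dom S) (span2 u v) (bc_dom p), bvals u = u_bvals p & bvals v = v_bvals p].
Proof.
move=> ap.
have [|u [v [Huv indep dec bu bv]]] := span_decomposition L2_model (bcV_nonneg ap)
    (bcV_u ap) (bcV_v p) _ (@bcV_indep _ p).
  by move=> [[[x0 x1] y0] y1]; exact: bcV_span.
exists u, v; split=> //; split.
  by apply/seteqP; split=> f; [move=> /bc_domP /dec|move=> /dec /bc_domP].
move=> f [Sf [a [b fE]]]; have := indep a b; rewrite -fE => /(_ Sf)[a0 b0].
by rewrite fE a0 b0 !scale0r addr0.
Qed.

(** A dissipative extension of [T] also extends S, hence acts as - f'' inside H^2; its trace space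
    is nonnegative and contains [bcV p], so [bcV_max] leaves no room. *)
Lemma bc_maximally_dissipative (p : bc R) T : admissible p -> dom T = bc_dom p ->
  (forall f, dom T f -> T f = neg_laplace f) -> maximally_dissipative T /\ extends S T.
Proof.
move=> ap Tp TN.
have [dT eT] : dissipative T /\ extends S T.
  by apply: (restriction_is_dissipative (bcV_nonneg ap)) => // f; rewrite Tp; exact: bc_domP.
split=> //; split=> // T' dT' TT'.
have eT' : extends S T'.
  split=> [f /eT.1 /TT'.1 //|f Sf].
  by rewrite TT'.2; [exact: eT.2|exact: eT.1].
have T'N := dissipative_extension_H2 dT' eT'.
have sub : dom T' `<=` dom T.
  move=> f T'f; rewrite Tp; apply/bc_domP; split; first by have [] := T'N f T'f.
  have [_ Vf] := (trace_spaceP dT' eT' f).1 T'f; move: Vf.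
  apply: (bcV_max ap (trace_space_nonnegative dT' eT')) => x0 x1 y0 y1 px.
  have [g Hg gx] := boundary_surj L2_model (x0, x1, y0, y1).
  exists g => //; apply: TT'.1; rewrite Tp; apply/bc_domP; split=> //.
  by rewrite gx.
split=> // f T'f; have [_ ->] := T'N f T'f.
by apply: TN; exact: sub.
Qed.

End Extensions.

Theorem theorem3p3 (R : realType) :
  (* the explicit form of the condition on C in case (i) *)
  (forall C : 'M[R[i]]_2,
     psd (Im_mx (C^t* )) <->
     [/\ complex.Im (C 0 0) <= 0, complex.Im (C 1 1) <= 0 &
         4^-1 * `|C 0 1 - (C 1 0)^*| ^+ 2 <=
           (complex.Im (C 0 0) * complex.Im (C 1 1))%:C%C])
  /\ dom (adjoint (minimal_laplacian R)) = H2_01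
  /\ (forall T : operator R,
       maximally_dissipative T -> extends (minimal_laplacian R) T ->
       [/\ exists! k : bc_case, belongs_to T k,
           forall p : bc R, admissible p -> dom T = bc_dom p ->
             exists u v : L2 R,
               [/\ dom (adjoint (minimal_laplacian R)) u /\
                   dom (adjoint (minimal_laplacian R)) v,
                   lin_indep_mod (dom (minimal_laplacian R)) u v,
                   direct_sum (dom (minimal_laplacian R)) (span2 u v) (dom T),
                   bvals u = u_bvals p & bvals v = v_bvals p] &
           forall f : L2 R, dom T f ->
             [/\ dom (adjoint (minimal_laplacian R)) f,
                 T f = adjoint (minimal_laplacian R) f &
                 T f = neg_laplace f]])
  /\ (forall (p : bc R) (T : operator R),
       admissible p -> dom T = bc_dom p ->
       (forall f : L2 R, dom T f -> T f = neg_laplace f) ->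
       maximally_dissipative T /\ extends (minimal_laplacian R) T).
Proof.
split; first exact: psd_explicit.
split; first exact: adjoint_minimal_dom.
split; last by move=> p T; exact: bc_maximally_dissipative.
move=> T mT eT; split; first exact: maximal_extension_case.
- move=> p ap ->; have [u [v [[Hu Hv] ind dec bu bv]]] := bc_dom_decomposition ap.
  by exists u, v; split=> //; rewrite adjoint_minimal_dom.
- move=> f Tf; have [Hf TfE] := dissipative_extension_H2 mT.1 eT Tf.
  by split=> //; [rewrite adjoint_minimal_dom|rewrite adjoint_minimalE].
Qed.
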